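(* Assume that $F:\Omega\times X\to\mathbb{R}^m$ is continuous, of class $C^1$ with respect to the second variable, that $F(\Omega\times X_1)$ is bounded in $\mathbb{R}^m$ for every bounded set $X_1\subset X$, that $$F(\omega,\psi)-F(\omega,\phi)\geq B\,(\psi(0)-\phi(0))\quad\text{whenever }\phi\leq_B\psi \text{ and }\omega\in\Omega,$$ that $$F(\omega,\lambda\psi)\ge\lambda F(\omega,\psi)\quad\text{whenever }\psi\ge_B0,\ \lambda\in[0,1]\text{ and }\omega\in\Omega,$$ and that there exists a pair $(\omega_0,\phi_0)\in\Omega\times\operatorname{Int}\widetilde K_B$ with bounded semitrajectory $\{(\omega_0\cdot t,y_t(\omega_0,\phi_0))\mid t\ge0\}$ and such that $y_t(\omega_0,\phi_0)\ge_B\psi_0$ for some $\psi_0\gg_B0$ and each $t\ge0$. Then, for each $\omega\in\Omega$ and $\phi\gg_B0$, the omega-limit set $\mathcal{O}(\omega,\phi)$ is a uniformly stable and strongly positive minimal set which admits a fiber distal flow extension.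
   Context: $\Omega$ is a compact metric space with a continuous minimal flow $\mathbb{R}\times\Omega\to\Omega$, $(t,\omega)\mapsto\omega\cdot t$. Fix $r>0$, $m\ge 1$. $X=C([-r,0],\mathbb{R}^m)$ with the sup-norm $\|\varphi\|_\infty=\sup_{s\in[-r,0]}\|\varphi(s)\|$, where $\|\cdot\|$ is the maximum norm on $\mathbb{R}^m$. For a continuous $y:[-r,\infty)\to\mathbb{R}^m$ and $t\ge0$, $y_t\in X$ is $y_t(s)=y(t+s)$, $s\in[-r,0]$. For $y\in\mathbb{R}^m$, $y\ge0$ (resp. $y\gg0$) means all components are nonnegative (resp. positive); for $\phi\in X$, $\phi\ge0$ (resp. $\phi\gg0$) means $\phi(s)\ge0$ (resp. $\phi(s)\gg0$) for all $s\in[-r,0]$. $B=[b_{ij}]$ is a fixed real $m\times m$ quasipositive matrix ($b_{ij}\ge0$ for $i\ne j$). The exponential ordering is given by the cone $K_B=\{\phi\in X\mid \phi\ge0,\ \phi(t)\ge e^{B(t-s)}\phi(s)\text{ for } -r\le s\le t\le0\}$: $\phi\le_B\psi$ iff $\psi-\phi\in K_B$. $X_L\subset X$ is the Banach space of Lipschitz functions with norm $\|\phi\|_L=\|\phi\|_\infty+\sup\{\|\phi(t)-\phi(s)\|/|t-s| : s\ne t\in[-r,0]\}$; $\widetilde K_B=K_B\cap X_L$, whose interior in $X_L$ is $\operatorname{Int}\widetilde K_B=\{\phi\in X_L\mid \phi\gg0 \text{ and, for some }\varepsilon>0,\ \phi'-B\phi\ge(\varepsilon,\dots,\varepsilon)\text{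 a.e. on }[-r,0]\}$. We write $\phi\gg_B0$ iff $\phi\in\operatorname{Int}\widetilde K_B$. For $\omega\in\Omega$, $\varphi\in X$, $y(t,\omega,\varphi)$ denotes the unique solution of $y'(t)=F(\omega\cdot t,y_t)$, $t\ge0$, with $y(s,\omega,\varphi)=\varphi(s)$ for $s\in[-r,0]$, and $y_t(\omega,\varphi)(s)=y(t+s,\omega,\varphi)$. The induced skew-product semiflow is $\tau_t(\omega,\varphi)=\tau(t,\omega,\varphi)=(\omega\cdot t,y_t(\omega,\varphi))$ (under the hypotheses of the claim it is globally defined on $\Omega\times K_B$). $\mathcal{O}(\omega,\phi)$ is the omega-limit set in $\Omega\times X_L$: the set of limits in $\Omega\times X_L$ of sequences $(\omega\cdot t_n,y_{t_n}(\omega,\phi))$ with $t_n\uparrow\infty$. A compact set $M\subset\Omega\times X_L$ is strongly positive if $M\subset\Omega\times\operatorname{Int}\widetilde K_B$. A minimal set is a nonempty compact invariant set ($\tau_t(M)=M$ for $t\ge0$) containing no proper nonempty compact invariant subset. $M$ is uniformly stable if for every $\varepsilon>0$ there is a $\delta>0$ such that if $(\omega,\phi)\in M$ and $\psi\in\operatorname{Int}\widetilde K_B$ satisfy $\|\phi-\psi\|_L<\delta$, then $\|y_t(\omega,\phi)-y_t(\omega,\psi)\|_L<\varepsilon$ for all $t\ge0$. $M$ admits a flow extension if the restriction of $\tau$ to $M$ extends to a continuous flow on $M$ defined for all $t\in\mathbb{R}$; it is fiber distal if for any two distinct points $(\omega,\psi_1),(\omega,\psi_2)\in M$ on the same fiber,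 the distance between their images under this flow stays bounded away from $0$ for all $t\in\mathbb{R}$. *)

(* Defs.v *)
From HB Require Import structures.
From mathcomp Require Import all_boot all_order all_algebra.
From mathcomp Require Import all_classical all_reals all_analysis.

Set Implicit Arguments.
Unset Strict Implicit.
Unset Printing Implicit Defensive.

Import Order.TTheory GRing.Theory Num.Theory.
Import numFieldNormedType.Exports.

Local Open Scope classical_set_scope.
Local Open Scope ring_scope.

Section SupNonneg.
Context {R : realType} {T : Type} (A : set T).
Implicit Types f g : T -> R.

Definition bddOn f := exists M, forall x, A x -> f x <= M.

Lemma le_sup_image f x : bddOn f -> A x -> f x <= sup (f @` A).
Proof.
move=> [M fM] Ax; apply: ub_le_sup; last by exists x.
by exists M => _ [y Ay <-]; exact: fM.
Qed.

Lemma sup_image_le f M : 0 <= M -> (forall x, A x -> f x <= M) ->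
  sup (f @` A) <= M.
Proof.
move=> M0 fM; have [->|/set0P A0] := eqVneq A set0; first by rewrite image_set0 sup0.
apply: ge_sup; first by case: A0 => x Ax; exists (f x), x.
by move=> _ [y Ay <-]; exact: fM.
Qed.

Lemma sup_image_ge0 f : (forall x, A x -> 0 <= f x) -> 0 <= sup (f @` A).
Proof.
move=> f0; have [->|/set0P[x Ax]] := eqVneq A set0.
  by rewrite image_set0 sup0.
have [fb|nfb] := pselect (bddOn f); first exact: le_trans (f0 _ Ax) (le_sup_image fb Ax).
rewrite sup_out// => -[_ [M fM]]; apply: nfb; exists M => y Ay.
by apply: fM; exists y.
Qed.

Lemma sup_imageZ f k : (forall x, A x -> 0 <= f x) -> bddOn f -> 0 <= k ->
  sup ((fun x => k * f x) @` A) = k * sup (f @` A).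
Proof.
move=> f0 fb k0; have s0 := sup_image_ge0 f0; apply/eqP; rewrite eq_le.
apply/andP; split.
  apply: sup_image_le; first exact: mulr_ge0.
  by move=> x Ax; rewrite ler_wpM2l// le_sup_image.
have [M fM] := fb.
have [->|kn0] := eqVneq k 0.
  by rewrite mul0r; apply: (@sup_image_ge0 (fun x => 0 * f x)) => x Ax; rewrite mul0r.
have {kn0}k0 : 0 < k by rewrite lt_neqAle eq_sym kn0.
rewrite mulrC -ler_pdivlMr//; apply: sup_image_le.
  apply: divr_ge0; last exact: ltW.
  by apply: (@sup_image_ge0 (fun x => k * f x)) => x Ax; rewrite mulr_ge0 ?f0 ?ltW.
move=> x Ax; rewrite ler_pdivlMr// mulrC.
apply: (@le_sup_image (fun x => k * f x)) => //.
by exists (k * M) => y Ay; rewrite ler_wpM2l ?fM// ltW.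
Qed.

End SupNonneg.

Definition delay_itv {R : realType} (r : R) : set R := `[- r, 0]%classic.

(* The space X = C([-r,0], R^m).  A function on [-r,0] is encoded by its unique
   extension to R that vanishes outside [-r,0], so that Leibniz equality is
   equality on [-r,0].  The norm of 'cV[R]_m is the maximum norm. *)
Section History.
Context (R : realType) (r : R) (m : nat).

Definition hist_pred : {pred R -> 'cV[R]_m} := fun f =>
  `[< {within (delay_itv r), continuous f} /\ forall s, ~ delay_itv r s -> f s = 0 >].

Record hist := Hist { hist_fun :> R -> 'cV[R]_m; _ : hist_pred hist_fun }.

HB.instance Definition _ := [isSub for hist_fun].
HB.instance Definition _ := [Choice of hist by <:].

Lemma hist_submod_closed : submod_closed hist_pred.
Proof.
split; first by apply/asboolP; split=> // x; exact: cvg_cst.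
move=> a f g /asboolP[fc f0] /asboolP[gc g0]; apply/asboolP; split.
  move=> x; apply: cvgD; last exact: gc.
  by apply: cvgZr; exact: fc.
move=> s ns; rewrite -[LHS]/(a *: f s + g s).
by rewrite f0// g0// scaler0 addr0.
Qed.

HB.instance Definition _ := GRing.isSubmodClosed.Build R (R -> 'cV[R]_m)
  hist_pred hist_submod_closed.
HB.instance Definition _ := [SubChoice_isSubLmodule of hist by <:].

Definition sup_norm (f : hist) : R := sup [set `|f s| | s in delay_itv r].

Lemma hist_continuous (f : hist) : {within (delay_itv r), continuous f}.
Proof. by case: f => f /= /asboolP[]. Qed.

Lemma hist_out (f : hist) s : ~ delay_itv r s -> f s = 0.
Proof. by case: f => f /= /asboolP[_]; exact. Qed.

Lemma histP (f g : hist) : (forall s, delay_itv r s -> f s = g s) -> f = g.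
Proof.
move=> fg; apply/val_inj/funext => s /=.
have [/fg//|ns] := pselect (delay_itv r s).
by rewrite !hist_out.
Qed.

Lemma hist_bdd (f : hist) : bddOn (delay_itv r) (fun s => `|f s|).
Proof.
have : compact ((f : R -> 'cV[R]_m) @` delay_itv r).
  by apply: continuous_compact; [exact: hist_continuous|exact: segment_compact].
move=> /compact_bounded[M [_ /(_ (M + 1))]].
rewrite ltrDl ltr01 => /(_ isT) fM; exists (M + 1) => s sr.
by apply: fM; exists s.
Qed.

Lemma sup_norm_ge0 (f : hist) : 0 <= sup_norm f.
Proof. exact: sup_image_ge0. Qed.

Lemma ler_sup_norm (f : hist) s : delay_itv r s -> `|f s| <= sup_norm f.
Proof. exact/le_sup_image/hist_bdd. Qed.

Lemma sup_normD (f g : hist) : sup_norm (f + g) <= sup_norm f + sup_norm g.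
Proof.
apply: sup_image_le => [|s sr]; first by rewrite addr_ge0 ?sup_norm_ge0.
by apply: le_trans (ler_normD _ _) _; rewrite lerD ?ler_sup_norm.
Qed.

Lemma sup_normZ a (f : hist) : sup_norm (a *: f) = `|a| * sup_norm f.
Proof.
rewrite -sup_imageZ//; last exact: hist_bdd.
by congr (sup _); apply: eq_imagel => s _; rewrite -normrZ.
Qed.

Lemma sup_norm0_eq0 (f : hist) : sup_norm f = 0 -> f = 0.
Proof.
move=> f0; apply: histP => s sr; apply/eqP; rewrite -normr_eq0 eq_le normr_ge0.
by rewrite andbT -f0 ler_sup_norm.
Qed.

HB.instance Definition _ :=
  Lmodule_isNormed.Build R hist sup_normD sup_normZ sup_norm0_eq0.

End History.

(* The Banach space X_L of Lipschitz elements of X, with its own norm, hence its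
   own topology, finer than the one induced by X. *)
Section LipHistory.
Context (R : realType) (r : R) (m : nat).

Definition lip_pred : {pred hist r m} := fun f =>
  `[< [lipschitz f s | s in delay_itv r] >].

Record lipHist := LipHist { lip_hist :> hist r m; _ : lip_pred lip_hist }.

HB.instance Definition _ := [isSub for lip_hist].
HB.instance Definition _ := [Choice of lipHist by <:].

Definition slope_dom : set (R * R) :=
  [set p | [/\ delay_itv r p.1, delay_itv r p.2 & p.1 != p.2]].

Definition slope (f : R -> 'cV[R]_m) (p : R * R) : R :=
  `|f p.1 - f p.2| / `|p.1 - p.2|.

Lemma slope_ge0 f p : 0 <= slope f p.
Proof. exact: divr_ge0. Qed.

Lemma slope_bddP (f : R -> 'cV[R]_m) :
  [lipschitz f s | s in delay_itv r] <-> bddOn slope_dom (slope f).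
Proof.
split=> [/pinfty_ex_gt0[M _ fM]|[M fM]].
  exists M => -[s t] [/= sr tr st]; rewrite /slope/= ler_pdivrMr.
  - exact: (fM (s, t)).
  - by rewrite normr_gt0 subr_eq0.
exists M; split=> [|N MN [s t] [/= sr tr]]; first exact: num_real.
have [->|st] := eqVneq s t; first by rewrite !subrr !normr0 mulr0.
rewrite -ler_pdivrMr.
- by apply: le_trans (fM (s, t) _) (ltW MN).
- by rewrite normr_gt0 subr_eq0.
Qed.

Lemma slopeD (f g : R -> 'cV[R]_m) p : slope (f + g) p <= slope f p + slope g p.
Proof.
rewrite /slope -mulrDl ler_wpM2r ?invr_ge0//.
by rewrite -[X in `|X|]/((f p.1 + g p.1) - (f p.2 + g p.2)) opprD addrACA ler_normD.
Qed.

Lemma slopeZ a (f : R -> 'cV[R]_m) p : slope (a *: f) p = `|a| * slope f p.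
Proof.
by rewrite /slope -[X in `|X|]/(a *: f p.1 - a *: f p.2) -scalerBr normrZ mulrA.
Qed.

Lemma lip_submod_closed : submod_closed lip_pred.
Proof.
split.
  apply/asboolP/slope_bddP; exists 0 => p _.
  by rewrite /slope subr0 normr0 mul0r.
move=> a f g /asboolP/slope_bddP[M fM] /asboolP/slope_bddP[N gN].
apply/asboolP/slope_bddP; exists (`|a| * M + N) => p pr.
apply: le_trans (slopeD (a *: (f : R -> _)) g p) _.
by rewrite slopeZ lerD ?gN// ler_wpM2l ?fM.
Qed.

HB.instance Definition _ := GRing.isSubmodClosed.Build R (hist r m)
  lip_pred lip_submod_closed.
HB.instance Definition _ := [SubChoice_isSubLmodule of lipHist by <:].

Definition lip_norm (f : lipHist) : R :=
  sup_norm f + sup [set slope f p | p in slope_dom].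

Lemma lip_bdd (f : lipHist) : bddOn slope_dom (slope f).
Proof. by apply/slope_bddP; case: f => f /= /asboolP. Qed.

Lemma lip_normD (f g : lipHist) : lip_norm (f + g) <= lip_norm f + lip_norm g.
Proof.
rewrite /lip_norm addrACA lerD ?sup_normD//; apply: sup_image_le.
  by rewrite addr_ge0// sup_image_ge0// => p _; exact: slope_ge0.
move=> p pr; apply: le_trans (slopeD f g p) _.
by rewrite lerD// le_sup_image//; exact: lip_bdd.
Qed.

Lemma lip_normZ a (f : lipHist) : lip_norm (a *: f) = `|a| * lip_norm f.
Proof.
rewrite /lip_norm mulrDr -sup_normZ -sup_imageZ//; last 2 first.
- by move=> p _; exact: slope_ge0.
- exact: lip_bdd.
congr (_ + sup _); apply: eq_imagel => p _.
by rewrite -slopeZ.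
Qed.

Lemma lip_norm0_eq0 (f : lipHist) : lip_norm f = 0 -> f = 0.
Proof.
move=> f0; apply/val_inj/sup_norm0_eq0/eqP; rewrite eq_le sup_norm_ge0 andbT.
rewrite -f0 lerDl; apply: sup_image_ge0 => p _; exact: slope_ge0.
Qed.

HB.instance Definition _ :=
  Lmodule_isNormed.Build R lipHist lip_normD lip_normZ lip_norm0_eq0.

End LipHistory.

Section Ordering.
Context {R : realType} {m : nat}.

Definition vle (x y : 'cV[R]_m) := forall i, x i 0 <= y i 0.
Definition vlt (x y : 'cV[R]_m) := forall i, x i 0 < y i 0.

Definition quasipositive (B : 'M[R]_m) := forall i j, i != j -> 0 <= B i j.

Definition expmx (A : 'M[R]_m) : 'M[R]_m :=
  limn (series (fun k => (k`!%:R)^-1 *: A ^+ k)).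

Context {r : R} (B : 'M[R]_m).

Definition coneB : set (hist r m) := [set phi |
  (forall s, delay_itv r s -> vle 0 (phi s)) /\
  (forall s t, - r <= s -> s <= t -> t <= 0 ->
     vle (expmx ((t - s) *: B) *m phi s) (phi t))].

Definition leB (phi psi : hist r m) := coneB (psi - phi).

Definition intConeB : set (lipHist r m) := [set phi |
  (forall s, delay_itv r s -> vlt 0 (phi s)) /\
  exists2 e : R, 0 < e &
    {ae lebesgue_measure, forall s : R, delay_itv r s ->
       derivable (phi : R -> 'cV[R]_m) s 1 /\
       vle (const_mx e) ('D_1 (phi : R -> 'cV[R]_m) s - B *m phi s)}].

End Ordering.

Section Dynamics.
Context {R : realType}.

(* Joint continuity in (t, x). *)
Definition is_flow (T : topologicalType) (sigma : R -> T -> T) :=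
  [/\ continuous (fun p : R * T => sigma p.1 p.2),
      forall x, sigma 0 x = x &
      forall s t x, sigma (s + t) x = sigma s (sigma t x)].

(* Minimality under the maps tau t, t in I; I is the whole line for a flow and
   the half-line of nonnegative times for a semiflow. *)
Definition invariant_set (T : Type) (I : set R) (tau : R -> T -> T) (M : set T) :=
  forall t, I t -> tau t @` M = M.

Definition minimal_set (T : topologicalType) (I : set R) (tau : R -> T -> T)
    (M : set T) :=
  [/\ M !=set0, compact M, invariant_set I tau M &
      forall N, N !=set0 -> compact N -> invariant_set I tau N ->
        N `<=` M -> N = M].

Definition nonneg_times : set R := [set t | 0 <= t].

End Dynamics.

Section FDE.
Context {R : realType} {r : R} {m : nat} {Omega : metricType R}.
Variables (sigma : R -> Omega -> Omega) (F : Omega -> hist r m -> 'cV[R]_m).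

(* C^1 in the second variable: the Frechet derivative exists and depends
   continuously, in the operator norm, on both variables. *)
Definition C1_snd :=
  (forall w phi, differentiable (F w) phi) /\
  (forall (w : Omega) (phi : hist r m) (e : R), 0 < e ->
     \forall w' \near w & psi \near phi, forall v : hist r m,
       `|'d (F w') psi v - 'd (F w) phi v| <= e * `|v|).

(* y_t, for y continuous on [-r, +oo[ and t >= 0 *)
Definition hist_at (y : R -> 'cV[R]_m) (t : R) : hist r m :=
  xget 0 [set phi : hist r m | forall s, delay_itv r s -> phi s = y (t + s)].

(* The derivative is that of the restriction of y to [0, +oo[, i.e. one-sided at
   t = 0. *)
Definition is_solution (w : Omega) (phi : hist r m) (y : R -> 'cV[R]_m) :=
  [/\ {within [set t | - r <= t], continuous y},
      forall s, delay_itv r s -> y s = phi s &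
      forall t, 0 <= t ->
        (u - t)^-1 *: (y u - y t)
          @[u --> within [set u | 0 <= u] (dnbhs t)]
          --> F (sigma t w) (hist_at y t)].

(* y(t, w, phi) *)
Definition sol (w : Omega) (phi : hist r m) : R -> 'cV[R]_m :=
  xget (cst 0) (is_solution w phi).

(* y_t(w, phi), in X and, for Lipschitz initial data, in X_L *)
Definition sol_hist (t : R) (w : Omega) (phi : hist r m) : hist r m :=
  hist_at (sol w phi) t.

Definition sol_lip (t : R) (w : Omega) (phi : lipHist r m) : lipHist r m :=
  xget 0 [set psi : lipHist r m | psi = sol_hist t w phi :> hist r m].

Definition semiflow (t : R) (p : Omega * lipHist r m) : Omega * lipHist r m :=
  (sigma t p.1, sol_lip t p.1 p.2).

Definition omega_limit (w : Omega) (phi : lipHist r m) :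
    set (Omega * lipHist r m) := [set p |
  exists t_ : nat -> R,
    [/\ forall n, 0 <= t_ n, increasing_seq t_, t_ @ \oo --> +oo &
        semiflow (t_ n) (w, phi) @[n --> \oo] --> p]].

Variable B : 'M[R]_m.

Definition strongly_positive (M : set (Omega * lipHist r m)) :=
  compact M /\ M `<=` setT `*` intConeB B.

Definition uniformly_stable (M : set (Omega * lipHist r m)) :=
  forall e : R, 0 < e -> exists2 d : R, 0 < d &
    forall w phi psi, M (w, phi) -> intConeB B psi -> `|phi - psi| < d ->
    forall t, 0 <= t -> `|sol_lip t w phi - sol_lip t w psi| < e.

(* theta is only relevant on M *)
Definition flow_extension (M : set (Omega * lipHist r m))
    (theta : R -> Omega * lipHist r m -> Omega * lipHist r m) :=
  [/\ forall t p, M p -> M (theta t p),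
      {within [set: R] `*` M,
        continuous (fun q : R * (Omega * lipHist r m) => theta q.1 q.2)},
      forall p, M p -> theta 0 p = p,
      forall s t p, M p -> theta (s + t) p = theta s (theta t p) &
      forall t p, 0 <= t -> M p -> theta t p = semiflow t p].

(* The two images lie on the same fiber, so their distance is that of their
   second components. *)
Definition fiber_distal (M : set (Omega * lipHist r m))
    (theta : R -> Omega * lipHist r m -> Omega * lipHist r m) :=
  forall w psi1 psi2, M (w, psi1) -> M (w, psi2) -> psi1 <> psi2 ->
    exists2 d : R, 0 < d &
      forall t, d <= `|(theta t (w, psi1)).2 - (theta t (w, psi2)).2|.

End FDE.

(* Main.v *)
(* A bounded solution is extended to the whole line and viewed as a point (w, y) of
   Omega times the functions on R with the topology of pointwise convergence, where
   translation of time is a flow.  On solutions with a common bound and Lipschitz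
   constant, (w, y) |-> (w, y_0) is continuous into Omega * X_L, so an omega-limit
   set is the image of a compact translation-invariant set Lam of whole trajectories.

   By monotonicity and sublinearity the part metric of the cone K_B does not increase
   along two solutions over the same base point.  As the base flow is minimal, hence
   recurrent, compactness of Lam forces it to be constant along trajectories of Lam.
   So two trajectories of Lam that agree at one time coincide, which makes the map
   from Lam to the omega-limit set injective and gives the flow extension; distality
   holds because the part metric is dominated by the Lipschitz norm, stability
   because it dominates the sup norm, the slopes being controlled by F.  For
   minimality, an invariant compact part N of the limit set contains, on each fiber,
   trajectories whose part distance to the given orbit is eventually small, so that N
   is dense in the limit set for the part metric.

   Global existence and comparison come from a monotone iteration.  The bounds for an
   arbitrary phi >>_B 0 come from comparing it with a point on the same fiber of the
   omega-limit set of (w0, phi0), which projects onto Omega. *)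
Require Import Defs.
From HB Require Import structures.
From mathcomp Require Import all_boot all_order all_algebra.
From mathcomp Require Import all_classical all_reals all_analysis.
From mathcomp Require Import ring lra.

Set Implicit Arguments.
Unset Strict Implicit.
Unset Printing Implicit Defensive.

Import Order.TTheory GRing.Theory Num.Theory.
Import numFieldNormedType.Exports.

Local Open Scope classical_set_scope.
Local Open Scope ring_scope.

(** * Monotonicity from one-sided difference quotients *)

Lemma compact_unif_continuous (R : realType) (X Y : pseudoMetricType R)
    (f : X -> Y) (K : set X) : compact K -> continuous f ->
  forall e : R, 0 < e -> exists2 d : R, 0 < d &
    forall x x', K x -> ball x d x' -> ball (f x) e (f x').
Proof.
move=> /compact_near_coveringP/near_covering_withinP cK fc e e0.
have : \forall d \near (0 : R)^'+,
    K `<=` (fun x => forall x', ball x d x' -> ball (f x) e (f x')).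
  apply: cK => x Kx.
  have /nbhs_ballP[d /= d0 fd] : \forall x' \near x, ball (f x) (e / 2) (f x').
    by apply: (fc x); apply: nbhsx_ballx; rewrite divr_gt0.
  exists (ball x (d / 2), [set d' | d' < d / 2]).
    split; first by apply: nbhsx_ballx; rewrite divr_gt0.
    by apply: nbhs_right_lt; rewrite divr_gt0.
  move=> [x1 d'] [/= xx1 dd'] Kx1 x2 x12.
  apply: (@ball_splitr _ _ (f x)).
    by apply: fd; apply: (@le_ball _ _ _ (d / 2)) => //; lra.
  apply: fd; rewrite (splitr d); apply: ball_triangle xx1 _.
  by apply: le_ball x12; exact: ltW.
move=> H; have [d [/= d0 Hd]] := filter_ex (filterI (nbhs_right_gt (0:R)) H).
by exists d => // x x' Kx; exact: Hd.
Qed.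

Section dini.
Variable R : realType.
Implicit Types (f : R -> R) (a b : R).

Lemma dini_ndecr f a b : a <= b -> {within `[a, b], continuous f} ->
  (forall t, a <= t -> t < b -> forall e, 0 < e ->
     \forall u \near t^'+, f t - e * (u - t) <= f u) -> f a <= f b.
Proof.
move=> ab fc fd; apply/ler_addgt0Pr => e' e'0.
pose e := e' / (b - a + 1).
have e0 : 0 < e by rewrite divr_gt0// ltr_pwDr// subr_ge0.
pose S := [set x | `[a, b]%classic x /\ f a - e * (x - a) <= f x].
have Sa : S a by split; [rewrite /= in_itv/= lexx ab|rewrite subrr mulr0 subr0].
have hsS : has_sup S.
  by split; [exists a|exists b => x [/=]; rewrite in_itv/= => /andP[]].
pose c := sup S.
have ac : a <= c by apply: sup_ubound => //; exact: hsS.2.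
have cb : c <= b.
  by apply: ge_sup; [exists a|move=> x [/=]; rewrite in_itv/= => /andP[]].
have Sc : S c.
  split; first by rewrite /= in_itv/= ac cb.
  apply/ler_addgt0Pr => n n0.
  have : \forall x \near within `[a, b] (nbhs c), `|f c - f x| < n / 2.
    move/(_ c) : fc => /cvgrPdist_lt/(_ (n / 2)); rewrite divr_gt0// => /(_ isT).
    by rewrite nbhs_subspace_in//= in_itv/= ac cb.
  move=> /nbhs_ballP[d /= d0 Hd].
  pose d1 := Num.min d (n / (2 * e)).
  have d10 : 0 < d1 by rewrite /d1 lt_min d0/= divr_gt0// mulr_gt0.
  have [x [xab fx] cx] := sup_adherent d10 hsS.
  have xc : x <= c by apply: sup_ubound => //; exact: hsS.2.
  have /Hd : ball c d x.
    rewrite /ball/= ger0_norm ?subr_ge0//.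
    have : d1 <= d by rewrite /d1 ge_min lexx.
    rewrite -/c in cx; lra.
  move=> /(_ xab); rewrite ltr_norml => /andP[h1 h2].
  have he : e * (c - x) <= n / 2.
    have : c - x <= n / (2 * e).
      have : d1 <= n / (2 * e) by rewrite /d1 ge_min lexx orbT.
      rewrite -/c in cx; lra.
    move=> /(ler_wpM2l (ltW e0)) /le_trans; apply.
    by rewrite (_ : e * (n / (2 * e)) = n / 2)//; field; rewrite gt_eqF.
  have -> : e * (c - a) = e * (c - x) + e * (x - a) by ring.
  have h3 : 0 <= e * (c - x) by rewrite mulr_ge0 ?subr_ge0// ltW.
  by lra.
have [cltb|] := ltP c b; last first.
  move=> bc; have cE : c = b by apply/eqP; rewrite eq_le cb bc.
  move: Sc; rewrite cE => -[_ fb].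
  have : e * (b - a) <= e'.
    rewrite /e mulrAC ler_pdivrMr ?ler_pM2l//; first lra.
    by lra.
  by lra.
have /filterI/(_ (nbhs_right_lt cltb)) := fd c ac cltb e e0.
move=> /(filterI (nbhs_right_gt c)) /filter_ex [u [/= cu [fu ub]]].
have /(sup_ubound hsS.2) : S u.
  split; first by rewrite /= in_itv/= (le_trans ac (ltW cu)) ltW.
  have -> : e * (u - a) = e * (u - c) + e * (c - a) by ring.
  by case: Sc => _; lra.
by rewrite -/c leNgt cu.
Qed.

End dini.

Section dini_ae.
Variable R : realType.
Implicit Types (f : R -> R) (a b : R).
Let mu (A : set R) : \bar R := lebesgue_measure A.

Let muU (A B : set (measurableTypeR R)) : measurable A -> measurable B -> A `&` B = set0 ->
  mu (A `|` B) = (mu A + mu B)%E.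
Proof.
exact: (@measureU _ _ _ (@lebesgue_measure R) A B). Qed.

Let mu_le (A B : set (measurableTypeR R)) : measurable A -> measurable B -> A `<=` B ->
  (mu A <= mu B)%E.
Proof. by move=> mA mB; apply: le_measure; rewrite inE. Qed.

Let mu_itv (x y : R) : x <= y -> mu `]x, y] = (y - x)%:E.
Proof.
move=> xy; rewrite /mu lebesgue_measure_itv/= lte_fin.
case: ltP => // yx; congr (_%:E).
by rewrite (@le_anti _ _ x y) ?subrr// xy yx.
Qed.

Let mu_ge0 (A : set R) : (0 <= mu A)%E. Proof. exact: measure_ge0. Qed.

Let subitv_measure_le (U : set R) (x y : R) : open U -> x <= y ->
  (mu (U `&` `]x, y]) <= (y - x)%:E)%E.
Proof.
move=> oU xy; apply: (@le_trans _ _ (mu `]x, y]%classic)).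
  apply: mu_le; last by move=> ? [].
    by apply: measurableI; [exact: measurable_realfun.open_measurable|exact: measurable_itv].
  exact: measurable_itv.
by rewrite mu_itv.
Qed.

Lemma dini_ndecr_ae f a b (L : R) : a <= b ->
  (forall x y, a <= x -> x <= y -> y <= b -> `|f y - f x| <= L * (y - x)) ->
  {ae lebesgue_measure, forall t, a <= t -> t < b -> forall e, 0 < e ->
     \forall u \near t^'+, f t - e * (u - t) <= f u} -> f a <= f b.
Proof.
move=> ab fL [A [mA muA badA]]; have A0 : mu A = 0%E := muA.
have [{}ab|] := ltP a b; last by move=> ba; rewrite (@le_anti _ _ a b)// ab ba.
have L0 : 0 <= L.
  have := le_trans (normr_ge0 _) (fL a b (lexx _) (ltW ab) (lexx _)).
  by rewrite pmulr_lge0// subr_gt0.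
apply/ler_addgt0Pr => n n0.
pose d := n / (L + 1).
have d0 : 0 < d by rewrite divr_gt0// ltr_pwDr.
have [|U [oU AU UA]] := lebesgue_regularity_outer mA _ d0.
  by rewrite [X in (X < _)%E]muA ltry.
have mUle (A' : set (measurableTypeR R)) : measurable A' -> A' `<=` U -> (mu A' <= d%:E)%E.
  move=> mA' A'U; apply: le_trans (mu_le mA' (measurable_realfun.open_measurable oU) A'U) _; apply: ltW.
  apply: le_lt_trans UA.
  have /muU/(_ mA) : measurable (U `\` A : set (measurableTypeR R)).
    by apply: measurableD => //; exact: measurable_realfun.open_measurable.
  rewrite setDKU // -/mu => ->; last by rewrite setDE -setIA setICl setI0.
  by rewrite [X in (_ + X)%E]muA adde0.
move=> {UA muA A0}.
pose I x := U `&` `]a, x].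
have mI x : measurable (I x : set (measurableTypeR R)).
  by apply: measurableI; [exact: measurable_realfun.open_measurable|exact: measurable_itv].
have finI x : a <= x -> mu (I x) \is a fin_num.
  move=> ax; rewrite ge0_fin_numE ?mu_ge0// (le_lt_trans (subitv_measure_le oU ax))//.
  by rewrite ltry.
pose M x := fine (mu (I x)).
have ID x y : a <= x -> x <= y ->
    mu (I y) = (mu (I x) + mu (U `&` `]x, y]))%E.
  move=> ax xy.
  have mxy : measurable (U `&` `]x, y] : set (measurableTypeR R)).
    by apply: measurableI; [exact: measurable_realfun.open_measurable|exact: measurable_itv].
  have /(muU (mI x) mxy) <- : I x `&` (U `&` `]x, y]) = set0.
    apply/seteqP; split=> // z [[_ h1] [_ h2]]; move: h1 h2.
    by rewrite /= !in_itv/= => /andP[_ h1] /andP[h2 _]; have : false by lra.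
  rewrite -setIUr; congr (mu (_ `&` _)); apply/seteqP; split=> z /=.
    rewrite !in_itv/= => /andP[az zy].
    by case: (leP z x) => zx; [left; rewrite az|right].
  by rewrite !in_itv/= => -[/andP[h1 h2]|/andP[h1 h2]]; lra.
have fin2 x y : x <= y -> mu (U `&` `]x, y]) \is a fin_num.
  move=> xy; rewrite ge0_fin_numE ?mu_ge0// (le_lt_trans (subitv_measure_le oU xy))//.
  by rewrite ltry.
have MD x y : a <= x -> x <= y -> M y = M x + fine (mu (U `&` `]x, y])).
  by move=> ax xy; rewrite /M (ID x)// fineD ?finI ?fin2.
have M0 x y : x <= y -> 0 <= fine (mu (U `&` `]x, y])) <= y - x.
  by move=> xy; rewrite fine_ge0 ?mu_ge0//= -lee_fin fineK ?fin2// subitv_measure_le.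
pose G x := f x + L * M x.
have : G a <= G b.
  apply: dini_ndecr; first exact: ltW.
    have GL x y : a <= x -> x <= y -> y <= b -> `|G y - G x| <= 2 * L * (y - x).
      move=> ax xy yb; rewrite /G (MD x y)//.
      have := fL x y ax xy yb; have /andP[] := M0 x y xy.
      set q := fine _ => q0 qxy; rewrite !ler_norml => /andP[h1 h2].
      have : 0 <= L * q by exact: mulr_ge0.
      have : L * q <= L * (y - x) by rewrite ler_wpM2l.
      by rewrite mulrDr; lra.
    apply/subspace_continuousP => x; rewrite /= in_itv/= => /andP[ax xb].
    apply/cvgrPdist_lt => e e0.
    have Ke : 0 < e / (2 * L + 1) by rewrite divr_gt0//; lra.
    have key z : 0 <= z -> z < e / (2 * L + 1) -> 2 * L * z < e.
      by move=> z0; rewrite ltr_pdivlMr; lra.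
    near=> y.
    have : `[a, b]%classic y by near: y; exact: withinT.
    rewrite /= in_itv/= => /andP[ay yb].
    have : `|x - y| < e / (2 * L + 1).
      by near: y; apply: cvg_within; apply: nbhsx_ballx.
    have [xy|yx] := leP x y.
      rewrite distrC (@distrC _ _ (G x)) ger0_norm ?subr_ge0// => h.
      by apply: le_lt_trans (GL _ _ ax xy yb) _; rewrite key// subr_ge0.
    rewrite ger0_norm ?subr_ge0 ?(ltW yx)// => h.
    by apply: le_lt_trans (GL _ _ ay (ltW yx) xb) _; rewrite key// subr_ge0 ltW.
  move=> t at_ tb e e0.
  have [Ut|nUt] := pselect (U t).
    have /nbhs_ballP[k /= k0 kU] : nbhs t U by exact: open_nbhs_nbhs.
    near=> u.
    have tu : t < u by near: u; exact: nbhs_right_gt.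
    have ub : u <= b by near: u; exact: nbhs_right_le.
    have uk : u < t + k by near: u; apply: nbhs_right_lt; rewrite ltrDl.
    rewrite /G (MD t u) ?(ltW tu)//.
    have -> : U `&` `]t, u]%classic = `]t, u]%classic.
      apply/setIidPr => z /=; rewrite /= in_itv/= => /andP[tz zu].
      by apply: kU; rewrite /ball/= ltr_norml; lra.
    rewrite mu_itv ?(ltW tu)//=.
    have := fL t u at_ (ltW tu) ub; rewrite ler_norml mulrDr => /andP[+ _].
    have : 0 <= e * (u - t) by rewrite mulr_ge0// ltW// subr_gt0.
    by lra.
  have good : forall e, 0 < e -> \forall u \near t^'+, f t - e * (u - t) <= f u.
    apply: contrapT => nH; apply/nUt/AU/badA => H; apply: nH => e1 e10.
    exact: H.
  near=> u.
  have tu : t < u by near: u; exact: nbhs_right_gt.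
  have : f t - e * (u - t) <= f u by near: u; exact: good.
  rewrite /G (MD t u) ?(ltW tu)//.
  have /andP[q0 _] := M0 t u (ltW tu); have := mulr_ge0 L0 q0.
  by rewrite mulrDr; lra.
have Ma : M a = 0 by rewrite /M /I set_itvoc0 setI0 [mu _]measure0.
have Mb : M b <= d.
  rewrite -lee_fin /M fineK; last by rewrite finI// ltW.
  by apply: mUle => // z [].
have : L * M b <= n.
  apply: le_trans (ler_wpM2l L0 Mb) _.
  by rewrite /d mulrA ler_pdivrMr; [nra|lra].
by rewrite /G Ma; lra.
Unshelve. all: by end_near. Qed.

End dini_ae.

Section right_derivative.
Variable R : realType.

Definition rderiv (V : normedModType R) (z : R -> V) (t : R) (c : V) :=
  forall e, 0 < e ->
    \forall u \near t^'+, `|z u - z t - (u - t) *: c| <= e * (u - t).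

Lemma mx_norm_coord_le p q (v : 'M[R]_(p, q)) i j : `|v i j| <= `|v|.
Proof.
rewrite [leRHS]/Num.norm/= mx_normrE.
by apply: (@le_bigmax _ _ _ 0 (fun ij : 'I_p * 'I_q => `|v ij.1 ij.2|) (i, j)).
Qed.

Lemma mx_norm_leP p q (v : 'M[R]_(p, q)) k : 0 <= k ->
  reflect (forall i j, `|v i j| <= k) (`|v| <= k).
Proof.
move=> k0; apply: (iffP idP) => [vk i j|vk].
  exact: le_trans (mx_norm_coord_le _ _ _) vk.
by rewrite [leLHS]/Num.norm/= mx_normrE; apply/bigmax_leP; split=> // -[i j] _.
Qed.

Lemma rderiv_coord p q (z : R -> 'M[R]_(p, q)) t c i j : rderiv z t c ->
  rderiv (fun u => z u i j : R^o) t (c i j).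
Proof.
move=> zc e e0; apply: filterS (zc e e0) => u; apply: le_trans.
by have := mx_norm_coord_le (z u - z t - (u - t) *: c) i j; rewrite !mxE.
Qed.

Lemma rderivD (V : normedModType R) (y z : R -> V) t c d :
  rderiv y t c -> rderiv z t d -> rderiv (y \+ z) t (c + d).
Proof.
move=> yc zd e e0; near=> u.
have h1 : `|y u - y t - (u - t) *: c| <= e / 2 * (u - t).
  by near: u; apply: yc; rewrite divr_gt0.
have h2 : `|z u - z t - (u - t) *: d| <= e / 2 * (u - t).
  by near: u; apply: zd; rewrite divr_gt0.
have -> : e * (u - t) = e / 2 * (u - t) + e / 2 * (u - t) by field.
apply: le_trans (lerD h1 h2); apply: le_trans (ler_normD _ _).
by rewrite /= scalerDr !opprD (addrACA (y u)) (addrACA (y u - y t)).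
Unshelve. all: by end_near. Qed.

Lemma rderivZ (V : normedModType R) (y : R -> V) t c (k : R) :
  rderiv y t c -> rderiv (k \*: y) t (k *: c).
Proof.
move=> yc e e0.
have k0 : 0 < `|k| + 1 by rewrite ltr_wpDl.
near=> u.
have tu : t < u by near: u; exact: nbhs_right_gt.
have h1 : `|y u - y t - (u - t) *: c| <= e / (`|k| + 1) * (u - t).
  by near: u; apply: yc; rewrite divr_gt0.
rewrite /= scalerA mulrC -scalerA -!scalerBr normrZ.
apply: le_trans (ler_wpM2l (normr_ge0 _) h1) _.
rewrite mulrA ler_wpM2r ?subr_ge0 ?(ltW tu)//.
by rewrite mulrA ler_pdivrMr//; have := normr_ge0 k; nra.
Unshelve. all: by end_near. Qed.

Lemma rderivB (V : normedModType R) (y z : R -> V) t c d :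
  rderiv y t c -> rderiv z t d -> rderiv (y \- z) t (c - d).
Proof.
move=> yc zd; have := rderivD yc (rderivZ (-1) zd); rewrite scaleN1r.
by rewrite (_ : y \- z = y \+ (-1 \*: z))//; apply/funext => u /=; rewrite scaleN1r.
Qed.

Lemma rderiv_ndecr (f : R -> R^o) (a b : R) : a <= b -> continuous f ->
  (forall t, a <= t -> t < b -> exists2 c : R, 0 <= c & rderiv f t c) ->
  f a <= f b.
Proof.
move=> ab fc fd; apply: dini_ndecr => //; first exact: continuous_subspaceT.
move=> t at_ tb e e0; have [c c0 fdc] := fd t at_ tb.
near=> u.
have tu : t < u by near: u; exact: nbhs_right_gt.
have : `|f u - f t - (u - t) *: (c : R^o)| <= e * (u - t).
  by near: u; exact: fdc.
rewrite ler_norml => /andP[+ _]; have : 0 <= (u - t) * c by rewrite mulr_ge0// subr_ge0 ltW.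
by rewrite /GRing.scale/=; lra.
Unshelve. all: by end_near. Qed.

Lemma rderiv_id t (c : R^o) : rderiv (fun u : R => u *: c) t c.
Proof.
move=> e e0; near=> u.
have tu : t < u by near: u; exact: nbhs_right_gt.
by rewrite -scalerBl subrr normr0 mulr_ge0// ?ltW// subr_gt0.
Unshelve. all: by end_near. Qed.

Lemma continuous_coord (T : topologicalType) p q (z : T -> 'M[R]_(p, q)) i j :
  continuous z -> continuous (fun u => z u i j : R^o).
Proof.
move=> zc u; apply: (@continuous_comp _ _ _ z (fun M : 'M[R]_(p, q) => M i j)).
  exact: zc.
exact: coord_continuous.
Qed.

Lemma rderiv_mean_le p q (z g : R -> 'M[R]_(p, q)) (a b k : R) c :
  a <= b -> 0 <= k -> continuous z ->
  (forall t, a <= t -> t < b -> rderiv z t (g t) /\ `|g t - c| <= k) ->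
  `|z b - z a - (b - a) *: c| <= k * (b - a).
Proof.
move=> ab k0 zc zd; apply/mx_norm_leP => [|i j].
  by rewrite mulr_ge0// subr_ge0.
rewrite !mxE ler_norml.
have zic : continuous (fun u => z u i j : R^o).
  exact: continuous_coord.
have linc (l : R) : continuous (fun u : R => u *: (l : R^o)).
  by move=> u; apply: cvgM; [exact: cvg_id|exact: cvg_cst].
have up : ((k + c i j) * a - z a i j <= (k + c i j) * b - z b i j).
  have := @rderiv_ndecr ((fun u : R => u *: (k + c i j : R^o)) \- (fun u => z u i j : R^o)) a b ab.
  rewrite /= /GRing.scale/= [_ * a]mulrC [_ * b]mulrC; apply.
    by move=> u; apply: cvgB; [exact: linc|exact: zic].
  move=> t at_ tb; have [zt gt] := zd t at_ tb.
  exists (k + c i j - g t i j); last by apply: rderivB; [exact: rderiv_id|exact: rderiv_coord].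
  have := le_trans (mx_norm_coord_le (g t - c) i j) gt.
  by rewrite !mxE ler_norml => /andP[]; lra.
have down : (z a i j - (c i j - k) * a <= z b i j - (c i j - k) * b).
  have := @rderiv_ndecr ((fun u => z u i j : R^o) \- (fun u : R => u *: (c i j - k : R^o))) a b ab.
  rewrite /= /GRing.scale/= [_ * a]mulrC [_ * b]mulrC; apply.
    by move=> u; apply: cvgB; [exact: zic|exact: linc].
  move=> t at_ tb; have [zt gt] := zd t at_ tb.
  exists (g t i j - (c i j - k)); last by apply: rderivB; [exact: rderiv_coord|exact: rderiv_id].
  have := le_trans (mx_norm_coord_le (g t - c) i j) gt.
  by rewrite !mxE ler_norml => /andP[]; lra.
by apply/andP; split; lra.
Qed.

End right_derivative.

Section right_derivative2.
Variable R : realType.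

Lemma derive_expand (V : normedModType R) (f : R -> V) (t : R) (c : V) :
  is_derive t 1 f c -> forall e, 0 < e ->
  \forall u \near t, `|f u - f t - (u - t) *: c| <= e * `|u - t|.
Proof.
move=> [/cvg_ex[l fl]] fc e e0.
have {fc}lc : l = c by rewrite -fc; apply/esym/cvg_lim.
rewrite {}lc in fl.
have /cvgrPdist_le/(_ e e0) := fl => /nbhs_ballP[d /= d0 dP].
apply/nbhs_ballP; exists d => //= u; rewrite /ball/= distrC => ut.
have [->|nut] := eqVneq u t; first by rewrite !subrr scale0r subrr !normr0 mulr0.
have := dP (u - t); rewrite /ball/= sub0r normrN => /(_ ut).
rewrite subr_eq0 => /(_ nut); rewrite /= /shift/= [(u - t) *: 1]mulr1 subrK => h.
have -> : f u - f t - (u - t) *: c = (u - t) *: ((u - t)^-1 *: (f u - f t) - c).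
  by rewrite [RHS]scalerBr scalerA divff ?subr_eq0// scale1r.
by rewrite normrZ mulrC ler_wpM2r// distrC.
Qed.

Lemma is_derive_rderiv (V : normedModType R) (f : R -> V) (t : R) (c : V) :
  is_derive t 1 f c -> rderiv f t c.
Proof.
move=> fc e e0; have := derive_expand fc e0 => /nbhs_ballP[d /= d0 dP].
near=> u.
have tu : t < u by near: u; exact: nbhs_right_gt.
have ud : u < t + d by near: u; apply: nbhs_right_lt; rewrite ltrDl.
rewrite -[u - t in leRHS](@ger0_norm _ (u - t)) ?subr_ge0 ?(ltW tu)//.
by apply: dP; rewrite /ball/= ltr_norml; lra.
Unshelve. all: by end_near. Qed.

Lemma rderiv_expand m (y g : R -> 'cV[R]_m) (a t : R) :
  continuous y -> continuous g -> (forall t, a <= t -> rderiv y t (g t)) ->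
  a <= t -> forall e, 0 < e ->
  \forall u \near t, a <= u -> `|y u - y t - (u - t) *: g t| <= e * `|u - t|.
Proof.
move=> yc gc yg at_ e e0.
have /nbhs_ballP[d /= d0 dP] : \forall u \near t, `|g t - g u| < e.
  by have /cvgrPdist_lt/(_ e e0) := gc t.
apply/nbhs_ballP; exists d => //= u ud au.
have near_g s : `|s - t| <= `|u - t| -> `|g s - g t| <= e.
  move=> st; rewrite distrC ltW//; apply: dP; rewrite /ball/= distrC.
  by apply: le_lt_trans st _; rewrite distrC.
have [tu|ut] := leP t u.
  rewrite [X in _ * X]ger0_norm ?subr_ge0//.
  apply: (@rderiv_mean_le R m 1 y g) => //; first exact: ltW.
  move=> s ts su; split; first by apply: yg; exact: le_trans ts.
  by apply: near_g; rewrite !ger0_norm ?subr_ge0//; lra.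
have -> : y u - y t - (u - t) *: g t = - (y t - y u - (t - u) *: g t).
  by rewrite !opprD !opprK -scaleNr opprB [- y t + _]addrC.
rewrite normrN [`|u - t|]distrC [X in _ * X]ger0_norm ?subr_ge0 ?(ltW ut)//.
apply: (@rderiv_mean_le R m 1 y g) => //; [exact: ltW|exact: ltW|].
move=> s us st; split; first by apply: yg; exact: le_trans us.
apply: near_g; rewrite distrC (@distrC _ _ u).
by rewrite !ger0_norm ?subr_ge0//; lra.
Qed.

Lemma continuous_primitive_scalar (g : R -> R) : continuous g ->
  exists G : R -> R^o, [/\ continuous G, G 0 = 0 &
    forall t, 0 <= t -> rderiv G t (g t : R^o)].
Proof.
move=> gc.
pose F (x : R) : R^o := (\int[lebesgue_measure]_(t in `[(-1)%R, x]) (g t))%R.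
have Fd (x : R) : 0 <= x -> is_derive x 1 F (g x).
  move=> x0.
  have [] := @continuous_FTC1_closed R g (-1) x (x + 1) _ _ _ (gc x).
  - by rewrite ltrDl.
  - apply: continuous_compact_integrable; first exact: segment_compact.
    exact: continuous_subspaceT.
  - by lra.
  - by move=> dF <-; rewrite derive1E; exact: derivableP.
exists (fun x : R => F (Num.max x 0) - F 0); split.
- move=> x; apply: cvgB; last exact: cvg_cst.
  have h : 0 <= Num.max x 0 by rewrite le_max lexx orbT.
  apply: (@cvg_comp _ _ _ (fun x => Num.max x 0) F _ (nbhs (Num.max x 0))).
    by apply: (@continuous_max _ _ (fun x : R => x : R^o) (cst 0)); [exact: cvg_id|exact: cvg_cst].
  have [d _] := Fd _ h.
  by apply: differentiable_continuous; exact/derivable1_diffP.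
- by rewrite maxxx subrr.
- move=> t t0 e e0; have := is_derive_rderiv (Fd t t0) e0.
  apply: filterS2 (nbhs_right_gt t) => u tu.
  rewrite !max_l//; last by rewrite (le_trans t0)// ltW.
  by rewrite opprB addrA subrK.
Qed.

Lemma continuous_primitive m (g : R -> 'cV[R]_m) : continuous g ->
  exists G : R -> 'cV[R]_m, [/\ continuous G, G 0 = 0 &
    forall t, 0 <= t -> rderiv G t (g t)].
Proof.
move=> gc.
have /choice[G GP] : forall i : 'I_m, exists G : R -> R^o, [/\ continuous G,
    G 0 = 0 & forall t, 0 <= t -> rderiv G t (g t i 0 : R^o)].
  by move=> i; apply: continuous_primitive_scalar; exact: continuous_coord.
exists (fun t => \col_i G i t); split.
- move=> t; apply/cvgrPdist_lt => e e0.
  have : \forall u \near t, forall i, `|G i t - G i u| < e / 2.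
    apply: (@filter_forall R 'I_m (fun i u => `|G i t - G i u| < e / 2) (nbhs t) _) => i; have [+ _ _] := GP i => /(_ t).
    by move/cvgrPdist_lt; apply; rewrite divr_gt0.
  apply: filterS => u tu.
  have : `|\col_i G i t - \col_i G i u| <= e / 2.
    apply/mx_norm_leP => [|i j]; first by rewrite divr_ge0// ltW.
    by rewrite !mxE; exact/ltW.
  by lra.
- by apply/matrixP => i j; rewrite !mxE; have [_ ->] := GP i.
- move=> t t0 e e0.
  have : \forall u \near t^'+, forall i,
      `|G i u - G i t - (u - t) *: (g t i 0 : R^o)| <= e * (u - t).
    by apply: (@filter_forall R 'I_m (fun i u => `|G i u - G i t - (u - t) *: (g t i 0 : R^o)| <= e * (u - t))) => i; have [_ _ h] := GP i; exact: h.
  apply: filterS2 (nbhs_right_gt t) => u tu h.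
  apply/mx_norm_leP => [|i j].
    by rewrite mulr_ge0// ?ltW// subr_gt0.
  by rewrite !mxE ord1; exact: h.
Qed.

End right_derivative2.

(** * The matrix exponential *)

Section matrix_limits.
Variable R : realType.

Lemma cvg_mx_coord (T : Type) (F : set_system T) (FF : Filter F) p q
    (f : T -> 'M[R]_(p, q)) (M : 'M[R]_(p, q)) :
  (forall i j, f x i j @[x --> F] --> M i j) -> f x @[x --> F] --> M.
Proof.
move=> fM; apply/cvgrPdist_lt => e e0.
have : \forall x \near F, forall ij, `|M ij.1 ij.2 - f x ij.1 ij.2| < e / 2.
  apply: (@filter_forall T ('I_p * 'I_q)%type
    (fun ij x => `|M ij.1 ij.2 - f x ij.1 ij.2| < e / 2) F _) => -[i j].
  by have /cvgrPdist_lt/(_ (e / 2)) := fM i j; apply; rewrite divr_gt0.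
apply: filterS => x Fx.
have : `|M - f x| <= e / 2.
  apply/mx_norm_leP => [|i j]; first by rewrite divr_ge0// ltW.
  by rewrite !mxE; exact/ltW/(Fx (i, j)).
by lra.
Qed.

Lemma cvg_sumr (V : normedModType R) (T I : Type) (F : set_system T)
    (FF : Filter F) (s : seq I) (f : I -> T -> V) (l : I -> V) :
  (forall i, f i x @[x --> F] --> l i) ->
  \sum_(i <- s) f i x @[x --> F] --> \sum_(i <- s) l i.
Proof.
move=> fl; elim: s => [|i s IH].
  by rewrite big_nil; under eq_fun do rewrite big_nil; exact: cvg_cst.
by rewrite big_cons; under eq_fun do rewrite big_cons; exact: cvgD.
Qed.

Lemma cvg_mxM (T : Type) (F : set_system T) (FF : Filter F) p q s
    (f : T -> 'M[R]_(p, q)) (g : T -> 'M[R]_(q, s)) (M : 'M[R]_(p, q)) (N : 'M[R]_(q, s)) :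
  f x @[x --> F] --> M -> g x @[x --> F] --> N ->
  f x *m g x @[x --> F] --> M *m N.
Proof.
move=> fM gN; apply: cvg_mx_coord => i j; rewrite mxE.
under eq_fun do rewrite mxE.
apply: cvg_sumr => k; apply: cvgM.
  apply: (@cvg_comp _ _ _ f (fun A : 'M[R]_(p, q) => A i k)); first exact: fM.
  exact: coord_continuous.
apply: (@cvg_comp _ _ _ g (fun A : 'M[R]_(q, s) => A k j)); first exact: gN.
exact: coord_continuous.
Qed.

End matrix_limits.

Section matrix_exponential.
Variables (R : realType) (m : nat).
Implicit Types (A B P : 'M[R]_m) (t : R).

Let C A : R := \sum_i \sum_j `|A i j|.

Let C_ge0 A : 0 <= C A.
Proof. by rewrite sumr_ge0// => l _; rewrite sumr_ge0. Qed.

Let C_row A i : \sum_j `|A i j| <= C A.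
Proof. by rewrite [leRHS](bigD1 i)//= lerDl sumr_ge0// => l _; rewrite sumr_ge0. Qed.

Lemma mx_exp_le A k i j : `|(A ^+ k) i j| <= C A ^+ k.
Proof.
elim: k i j => [|k IH] i j.
  by rewrite !expr0 mxE; case: eqP => _; rewrite ?normr1 ?normr0.
rewrite exprS mxE; apply: le_trans (ler_norm_sum _ _ _) _.
apply: (@le_trans _ _ (\sum_l `|A i l| * C A ^+ k)).
  by apply: ler_sum => l _; rewrite normrM ler_wpM2l.
rewrite -mulr_suml exprS; apply: ler_wpM2r (C_row A i).
by rewrite exprn_ge0// C_ge0.
Qed.

Let cf P A i j k : R := k`!%:R^-1 * (P *m A ^+ k) i j.

Let cf_diffs P A i j : pseries_diffs (cf P A i j) = cf (P *m A) A i j.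
Proof.
apply/funext => k; rewrite /pseries_diffs /cf exprS mulmxA mulrA factS natrM.
by rewrite invfM mulVKf.
Qed.

Let cf_cvg P A i j t : cvgn (pseries (cf P A i j) t).
Proof.
apply: normed_cvg.
apply: (@series_le_cvg _ _ (fun k => (\sum_l `|P i l|) * exp_coeff (C A * `|t|) k)).
- by move=> k /=.
- by move=> k; rewrite mulr_ge0 ?sumr_ge0// exp_coeff_ge0// mulr_ge0// C_ge0.
- move=> k /=; rewrite /cf /exp_coeff/=.
  have h : `|(P *m A ^+ k) i j| <= (\sum_l `|P i l|) * C A ^+ k.
    rewrite mxE mulr_suml; apply: le_trans (ler_norm_sum _ _ _) _.
    by apply: ler_sum => l _; rewrite normrM ler_wpM2l// mx_exp_le.
  rewrite !normrM normfV normrX [`|k`!%:R|]ger0_norm//.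
  have -> : (\sum_l `|P i l|) * ((C A * `|t|) ^+ k / k`!%:R) =
      k`!%:R^-1 * ((\sum_l `|P i l|) * C A ^+ k) * `|t| ^+ k by rewrite exprMn; ring.
  by rewrite ler_wpM2r ?exprn_ge0// ler_wpM2l ?invr_ge0.
- rewrite /series/=; under eq_fun do rewrite -mulr_sumr.
  by apply: is_cvgM; [exact: is_cvg_cst|exact: is_cvg_series_exp_coeff].
Qed.

Let S A t n := series (fun k => k`!%:R^-1 *: (t *: A) ^+ k) n.

Let scale_exp A t k : (t *: A) ^+ k = t ^+ k *: A ^+ k.
Proof.
elim: k => [|k IH]; first by rewrite !expr0 scale1r.
by rewrite !exprS IH -!mulmxE -scalemxAl -scalemxAr scalerA.
Qed.

Let mulS P A t n i j : (P *m S A t n) i j = pseries (cf P A i j) t n.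
Proof.
rewrite /S /pseries /series/= mulmx_sumr summxE; apply: eq_bigr => k _.
by rewrite scale_exp scalerA -scalemxAr mxE /cf mulrAC.
Qed.

Lemma expmx_cvg A t : S A t n @[n --> \oo] --> expmx (t *: A).
Proof.
suff : cvgn (S A t) by [].
apply/cvg_ex; exists (\matrix_(i, j) limn (pseries (cf 1%:M A i j) t)).
apply: cvg_mx_coord => i j; rewrite mxE.
have := @cf_cvg 1%:M A i j t.
rewrite (_ : pseries _ _ = (fun n => S A t n i j))//.
by apply/funext => n; rewrite -mulS mul1mx.
Qed.

Let lim_cf P A t i j : limn (pseries (cf P A i j) t) = (P *m expmx (t *: A)) i j.
Proof.
apply/cvg_lim => //; rewrite -(funext (fun n => mulS P A t n i j)).
apply: (@cvg_comp _ _ _ (fun n => P *m S A t n) (fun M : 'M[R]_m => M i j)).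
  by apply: cvg_mxM; [exact: cvg_cst|exact: expmx_cvg].
exact: coord_continuous.
Qed.

Lemma expmx_comm A t : A *m expmx (t *: A) = expmx (t *: A) *m A.
Proof.
have h1 : A *m S A t n @[n --> \oo] --> A *m expmx (t *: A).
  by apply: cvg_mxM; [exact: cvg_cst|exact: expmx_cvg].
have h2 : S A t n *m A @[n --> \oo] --> expmx (t *: A) *m A.
  by apply: cvg_mxM; [exact: expmx_cvg|exact: cvg_cst].
apply: (cvg_unique _ h1); first exact: norm_hausdorff.
rewrite (_ : (fun n => A *m S A t n) = (fun n => S A t n *m A))//.
apply/funext => n; rewrite /S /series/= mulmx_sumr mulmx_suml.
apply: eq_bigr => k _; rewrite scale_exp !scalerA -scalemxAr -scalemxAl.
by rewrite !mulmxE -exprS exprSr.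
Qed.

Lemma expmx_derive A t i j :
  is_derive t (1 : R) (fun u => expmx (u *: A) i j) ((A *m expmx (t *: A)) i j).
Proof.
rewrite -{2}[A]mul1mx -lim_cf.
rewrite (_ : (fun u => _) = (fun u => limn (pseries (cf 1%:M A i j) u))); last first.
  by apply/funext => u; rewrite lim_cf mul1mx.
rewrite -cf_diffs; apply: (@pseries_snd_diffs _ _ (`|t| + 1)).
- exact: cf_cvg.
- by rewrite cf_diffs; exact: cf_cvg.
- by rewrite !cf_diffs; exact: cf_cvg.
- by rewrite [ltRHS]ger0_norm ?addr_ge0// ltrDl.
Qed.

Lemma expmx0 A : expmx (0 *: A) = 1%:M.
Proof.
apply/matrixP => i j; rewrite -[expmx _]mul1mx -lim_cf.
apply: (@lim_near_cst R) => //; exists 1%N => // -[//|n] _ /=.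
rewrite /pseries /series/= big_nat_recl//= big1 ?addr0.
  by rewrite /cf expr0 fact0 invr1 mul1r mulmx1 mulr1.
by move=> k _; rewrite expr0n mulr0.
Qed.

Lemma expmx_ge0 A t : 0 <= t -> (forall i j, 0 <= A i j) ->
  forall i j, 0 <= expmx (t *: A) i j.
Proof.
move=> t0 A0 i j; rewrite -[expmx _]mul1mx -lim_cf.
apply: limr_ge; first exact: cf_cvg.
apply: nearW => n; rewrite /pseries /series/= sumr_ge0// => k _.
rewrite mulr_ge0// ?exprn_ge0// /cf mulr_ge0 ?invr_ge0// mul1mx.
elim: k i j => [|k IH] i j; first by rewrite expr0 mxE.
by rewrite exprS mxE sumr_ge0// => l _; rewrite mulr_ge0.
Qed.

End matrix_exponential.

Section exponential_flow.
Variables (R : realType) (m : nat).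
Implicit Types (A B : 'M[R]_m) (M : R -> 'M[R]_m).

Let mx_ode A M := forall t i j,
  is_derive t (1 : R) (fun u => M u i j) ((A *m M t) i j).

Let is_derive_aff (f : R -> R) (df a b t : R) :
  is_derive (a * t + b) (1 : R) f df ->
  is_derive t (1 : R) (fun u => f (a * u + b)) (a * df).
Proof.
move=> fd; have gd : is_derive t (1 : R) (fun u : R => a * u + b) a.
  rewrite (_ : (fun u : R => a * u + b) = (a \*: id) + cst b)//.
  by apply: is_derive_eq; rewrite addr0 /GRing.scale/= mulr1.
by rewrite mulrC; exact: (@is_derive1_comp _ f (fun u : R => a * u + b)).
Qed.

Let ode_opp A M t : mx_ode A M -> M 0 = 1%:M ->
  expmx ((- t) *: A) *m M t = 1%:M.
Proof.
move=> ode M0; apply/matrixP => i j.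
pose f u := (expmx ((- u) *: A) *m M u) i j.
have : forall u, is_derive u (1 : R) f 0.
  move=> u.
  pose h l : R -> R := (fun v => expmx ((- v) *: A) i l) * (fun v => M v l j).
  have -> : f = \sum_l h l.
    by apply/funext => v; rewrite /f mxE fct_sumE.
  have dE l : is_derive u (1 : R) (fun v => expmx ((- v) *: A) i l)
      (- (A *m expmx ((- u) *: A)) i l).
    rewrite (_ : (fun v => _) = (fun v => (fun w => expmx (w *: A) i l) (-1 * v + 0))); last first.
      by apply/funext => v; rewrite mulN1r addr0.
    by rewrite -[X in is_derive _ _ _ X]mulN1r; apply: (@is_derive_aff (fun w => expmx (w *: A) i l)); rewrite mulN1r addr0; exact: expmx_derive.
  have dh l : is_derive u (1 : R) (h l)
      (expmx ((- u) *: A) i l * (A *m M u) l j - M u l j * (A *m expmx ((- u) *: A)) i l).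
    have d1 := dE l; have d2 := ode u l j.
    by rewrite /h; apply: is_derive_eq; rewrite /GRing.scale/= mulrN.
  apply: is_derive_eq.
  rewrite sumrB; apply/eqP; rewrite subr_eq0; apply/eqP.
  transitivity ((expmx ((- u) *: A) *m (A *m M u)) i j); first by rewrite [RHS]mxE.
  rewrite mulmxA -expmx_comm mxE; apply: eq_bigr => l _; exact: mulrC.
move=> /(is_derive_0_is_cst t 0); rewrite /f => ->.
by rewrite oppr0 expmx0 mul1mx M0.
Qed.

Lemma expmxN A t : expmx (t *: A) *m expmx ((- t) *: A) = 1%:M.
Proof.
have := @ode_opp A (fun u => expmx (u *: A)) (- t).
by rewrite opprK; apply; [move=> ? ? ?; exact: expmx_derive|exact: expmx0].
Qed.

Let ode_unique A M t : mx_ode A M -> M 0 = 1%:M -> M t = expmx (t *: A).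
Proof.
move=> ode M0.
have -> : M t = (expmx (t *: A) *m expmx ((- t) *: A)) *m M t.
  by rewrite expmxN mul1mx.
by rewrite -mulmxA (ode_opp t ode M0) mulmx1.
Qed.

Lemma expmxD A s t : expmx ((s + t) *: A) = expmx (s *: A) *m expmx (t *: A).
Proof.
have -> : expmx (s *: A) = expmx ((s + t) *: A) *m expmx ((- t) *: A).
  have := @ode_unique A (fun u => expmx ((u + t) *: A) *m expmx ((- t) *: A)) s.
  move=> ->//; last by rewrite add0r expmxN.
  move=> u i j.
  pose h l : R -> R := (expmx ((- t) *: A) l j) \*: (fun v => expmx ((v + t) *: A) i l).
  rewrite (_ : (fun v => _) = \sum_l h l); last first.
    by apply/funext => v; rewrite mxE fct_sumE; apply: eq_bigr => l _; exact: mulrC.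
  have dh l : is_derive u (1 : R) (h l)
      (expmx ((- t) *: A) l j * (A *m expmx ((u + t) *: A)) i l).
    have d1 : is_derive u (1 : R) (fun v => expmx ((v + t) *: A) i l)
        ((A *m expmx ((u + t) *: A)) i l).
      rewrite (_ : (fun v => _) = (fun v => (fun w => expmx (w *: A) i l) (1 * v + t))); last first.
        by apply/funext => v; rewrite mul1r.
      by rewrite -[X in is_derive _ _ _ X]mul1r; apply: (@is_derive_aff (fun w => expmx (w *: A) i l)); rewrite mul1r; exact: expmx_derive.
    by rewrite /h; apply: is_derive_eq.
  apply: is_derive_eq.
  by rewrite mulmxA mxE; apply: eq_bigr => l _; exact: mulrC.
rewrite -mulmxA.
have -> : expmx ((- t) *: A) *m expmx (t *: A) = 1%:M.
  by have := expmxN A (- t); rewrite opprK.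
by rewrite mulmx1.
Qed.

Lemma expmx_quasipositive B t : quasipositive B -> 0 <= t ->
  forall i j, 0 <= expmx (t *: B) i j.
Proof.
move=> qB t0 i j.
pose c : R := \sum_i `|B i i|.
pose A := B + c%:M.
have A0 k l : 0 <= A k l.
  rewrite !mxE; have [<-|kl] := eqVneq k l; last by rewrite addr0 qB.
  rewrite mulr1n -lerBlDl sub0r; apply: le_trans (ler_norm _) _.
  by rewrite normrN /c (bigD1 k)//= lerDl sumr_ge0.
rewrite -(@ode_unique B (fun u => expR (- c * u) *: expmx (u *: A)) t).
- by rewrite mxE mulr_ge0 ?expR_ge0//; exact: expmx_ge0.
- move=> u k l.
  rewrite (_ : (fun v => _) = (fun v => expR (- c * v)) * (fun v => expmx (v *: A) k l)); last first.
    by apply/funext => v; rewrite mxE.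
  have d1 : is_derive u (1 : R) (fun v => expR (- c * v)) (- c * expR (- c * u)).
    rewrite (_ : (fun v => _) = (fun v => expR (- c * v + 0))); last first.
      by apply/funext => v; rewrite addr0.
    by apply: (@is_derive_aff expR); rewrite addr0; exact: is_derive_expR.
  have d2 := expmx_derive A u k l.
  apply: is_derive_eq.
  have -> : (B *m (expR (- c * u) *: expmx (u *: A))) =
     expR (- c * u) *: (A *m expmx (u *: A)) - c *: (expR (- c * u) *: expmx (u *: A)).
    set X := expmx _; rewrite -scalemxAr mulmxDl mul_scalar_mx scalerDr !scalerA.
    by rewrite (mulrC c) addrK.
  by rewrite !mxE /GRing.scale/=; ring.
- by rewrite mulr0 expR0 scale1r expmx0.
Qed.

Lemma expmx_rderiv A t :
  rderiv (fun h : R => expmx (h *: A)) t (A *m expmx (t *: A)).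
Proof.
move=> e e0.
have : \forall u \near t^'+, forall ij : 'I_m * 'I_m,
   `|(fun h => expmx (h *: A) ij.1 ij.2 : R^o) u - expmx (t *: A) ij.1 ij.2
     - (u - t) *: ((A *m expmx (t *: A)) ij.1 ij.2 : R^o)| <= e * (u - t).
  apply: (@filter_forall R ('I_m * 'I_m)%type (fun ij u =>
   `|(fun h => expmx (h *: A) ij.1 ij.2 : R^o) u - expmx (t *: A) ij.1 ij.2
     - (u - t) *: ((A *m expmx (t *: A)) ij.1 ij.2 : R^o)| <= e * (u - t))) => -[i j] /=.
  exact: (is_derive_rderiv (expmx_derive A t i j)).
apply: filterS2 (nbhs_right_gt t) => u tu H.
apply/mx_norm_leP => [|i j]; first by rewrite mulr_ge0// ?ltW// subr_gt0.
by have := H (i, j); rewrite !mxE.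
Qed.

Lemma expmx_rderiv0 A : rderiv (fun h => expmx (h *: A)) 0 A.
Proof. by have := expmx_rderiv A 0; rewrite expmx0 mulmx1. Qed.

Lemma expmx_continuous A : continuous (fun t : R => expmx (t *: A)).
Proof.
move=> t; apply: cvg_mx_coord => i j.
have [d _] := expmx_derive A t i j.
by have /differentiable_continuous := (derivable1_diffP _ _).1 d.
Qed.

Lemma mulmx_norm_le p q s (A : 'M[R]_(p, q)) (N : 'M[R]_(q, s)) :
  `|A *m N| <= q%:R * `|A| * `|N|.
Proof.
apply/mx_norm_leP => [|i j]; first by rewrite !mulr_ge0.
rewrite mxE; apply: le_trans (ler_norm_sum _ _ _) _.
apply: (@le_trans _ _ (\sum_(k < q) `|A| * `|N|)).
  by apply: ler_sum => k _; rewrite normrM ler_pM// mx_norm_coord_le.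
by rewrite sumr_const card_ord -mulrA mulr_natl.
Qed.

Lemma expmx_bounded A (T : R) : exists2 K : R, 0 < K &
  forall t, 0 <= t -> t <= T -> `|expmx (t *: A)| <= K.
Proof.
have : compact ((fun t : R => expmx (t *: A)) @` `[0, T]%classic).
  apply: continuous_compact; last exact: segment_compact.
  by apply: continuous_subspaceT; exact: expmx_continuous.
move=> /compact_bounded[K [Kr KP]].
exists (`|K| + 1); first by rewrite ltr_wpDl.
move=> t t0 tT; apply: (KP (`|K| + 1)).
  by rewrite (le_lt_trans (ler_norm _))// ltrDl.
by exists t => //=; rewrite in_itv/= t0.
Qed.

End exponential_flow.

(** * Differential inequalities *)

Section subsolutions.
Variables (R : realType) (m : nat) (B : 'M[R]_m).
Context (B_quasipos : quasipositive B).
Implicit Types (z : R -> 'cV[R]_m) (a b t : R).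

(* One-sided form of the differential inequality z' >= B z at t. *)
Definition subsol_at z t := forall e, 0 < e -> \forall u \near t^'+,
  forall i, z t i 0 + (u - t) * (B *m z t) i 0 - e * (u - t) <= z u i 0.

Lemma rderiv_subsol z t c : rderiv z t c -> vle (B *m z t) c -> subsol_at z t.
Proof.
move=> zc Bc e e0; apply: filterS2 (nbhs_right_gt t) (zc e e0) => u tu h i.
have := le_trans (mx_norm_coord_le (z u - z t - (u - t) *: c) i 0) h.
rewrite !mxE ler_norml => /andP[+ _].
have : (u - t) * (B *m z t) i 0 <= (u - t) * c i 0.
  by rewrite ler_wpM2l ?subr_ge0 ?(ltW tu)//; exact: Bc.
by rewrite !mxE; lra.
Qed.

Lemma expmx_lip (A : 'M[R]_m) (T : R) : exists2 K : R, 0 < K &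
  forall h, 0 <= h -> h <= T -> `|expmx (h *: A) - 1%:M| <= K * h.
Proof.
have [K K0 KP] := expmx_bounded A T.
exists (m%:R * `|A| * K + 1) => [|h h0 hT].
  by rewrite ltr_wpDl// !mulr_ge0// ltW.
have := @rderiv_mean_le R m m (fun t : R => expmx (t *: A))
  (fun t => A *m expmx (t *: A)) 0 h (m%:R * `|A| * K + 1) 0 h0.
rewrite expmx0 subr0 scaler0 subr0; apply.
- by rewrite addr_ge0// !mulr_ge0// ltW.
- exact: expmx_continuous.
move=> t t0 th; split; first exact: expmx_rderiv.
rewrite subr0; apply: le_trans (mulmx_norm_le _ _) _.
apply: (@le_trans _ _ (m%:R * `|A| * K)); last by rewrite lerDl.
by rewrite ler_wpM2l ?mulr_ge0// KP// (le_trans (ltW th)).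
Qed.

Section pullback.
Variables (z : R -> 'cV[R]_m) (a b : R).
Context (ab : a <= b).
Let h i u : R := (expmx ((b - u) *: B) *m z u) i 0.

Let pullback_dini i t : a <= t -> t < b -> subsol_at z t ->
  forall e, 0 < e -> \forall u \near t^'+, h i t - e * (u - t) <= h i u.
Proof.
move=> at_ tb zt e e0.
have [K K0 KP] := expmx_bounded B (b - a).
pose e1 := e / (m%:R * K + 1).
have mK : 0 < m%:R * K + 1 by rewrite ltr_wpDl// mulr_ge0// ltW.
have e10 : 0 < e1 by rewrite divr_gt0.
pose e2 := e1 / 2 / (m%:R * `|z t| + 1).
have mz : 0 < m%:R * `|z t| + 1 by rewrite ltr_wpDl// mulr_ge0.
have e20 : 0 < e2 by rewrite !divr_gt0.
have /nbhs_ballP[d /= d0 dP] := expmx_rderiv0 B e20.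
have Ed s : 0 < s -> s < d -> `|expmx (s *: B) - 1%:M - s *: B| <= e2 * s.
  move=> s0 sd; have := dP s; rewrite /ball/= sub0r normrN ger0_norm ?(ltW s0)//.
  by move=> /(_ sd s0); rewrite expmx0 subr0.
near=> u.
have tu : t < u by near: u; exact: nbhs_right_gt.
have ub : u <= b by near: u; exact: nbhs_right_le.
have ud : u < t + d by near: u; apply: nbhs_right_lt; rewrite ltrDl.
have zu : forall k, z t k 0 + (u - t) * (B *m z t) k 0 - e1 / 2 * (u - t) <= z u k 0.
  by near: u; apply: zt; rewrite divr_gt0.
have Eb : `|expmx ((u - t) *: B) - 1%:M - (u - t) *: B| <= e2 * (u - t).
  by apply: Ed; lra.
have low k : - (e1 * (u - t)) <= (z u - expmx ((u - t) *: B) *m z t) k 0.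
  have := mulmx_norm_le (expmx ((u - t) *: B) - 1%:M - (u - t) *: B) (z t).
  move=> /(le_trans (mx_norm_coord_le _ k 0)).
  rewrite !mulmxBl mul1mx -scalemxAl.
  have : m%:R * `|expmx ((u - t) *: B) - 1%:M - (u - t) *: B| * `|z t| <= e1 / 2 * (u - t).
    apply: (@le_trans _ _ (m%:R * (e2 * (u - t)) * `|z t|)).
      by rewrite ler_wpM2r// ler_wpM2l.
    have -> : m%:R * (e2 * (u - t)) * `|z t| = e2 * (m%:R * `|z t|) * (u - t) by ring.
    rewrite ler_wpM2r ?subr_ge0 ?(ltW tu)// /e2 mulrAC ler_pdivrMr//.
    by apply: ler_wpM2l; [rewrite divr_ge0// ltW|rewrite lerDl].
  move=> q1 q2; have {q1 q2} := le_trans q2 q1; have := zu k.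
  move: (expmx ((u - t) *: B) *m z t) (B *m z t) => w v.
  by rewrite !mxE ler_norml => q1 /andP[_ q2]; lra.
have -> : h i t = (expmx ((b - u) *: B) *m (expmx ((u - t) *: B) *m z t)) i 0.
  by rewrite mulmxA -expmxD addrA subrK.
rewrite /h; set P := expmx ((b - u) *: B).
have P0 k : 0 <= P i k by apply: expmx_quasipositive => //; rewrite subr_ge0.
have PK k : P i k <= K.
  apply: le_trans (ler_norm _) _; apply: le_trans (mx_norm_coord_le _ _ _) _.
  by apply: KP; lra.
suff : - (e * (u - t)) <= (P *m (z u - expmx ((u - t) *: B) *m z t)) i 0.
  rewrite mulmxBr; move: (P *m z u) (P *m _) => p q.
  by rewrite !mxE; lra.
rewrite mxE; apply: (@le_trans _ _ (\sum_(k < m) - (K * (e1 * (u - t))))).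
  rewrite sumr_const card_ord mulNrn lerN2 -mulr_natl !mulrA.
  rewrite ler_wpM2r ?subr_ge0 ?(ltW tu)// ler_pdivrMr//.
  by rewrite mulrC ler_wpM2l ?(ltW e0)// lerDl.
apply: ler_sum => k _; rewrite -lerN2 opprK -mulrN.
have c0 : 0 <= e1 * (u - t) by apply: mulr_ge0; [exact: ltW|rewrite subr_ge0 ltW].
apply: (@le_trans _ _ (P i k * (e1 * (u - t)))).
  by rewrite ler_wpM2l// lerNl low.
by rewrite ler_wpM2r.
Unshelve. all: by end_near. Qed.

Lemma expmx_subsol : continuous z ->
  (forall t, a <= t -> t < b -> subsol_at z t) ->
  vle (expmx ((b - a) *: B) *m z a) (z b).
Proof.
move=> zc zs i.
have -> : z b i 0 = h i b by rewrite /h subrr expmx0 mul1mx.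
apply: (@dini_ndecr R (h i) a b ab).
  apply: continuous_subspaceT; apply: continuous_coord => u.
  apply: cvg_mxM; last exact: zc.
  apply: (@cvg_comp _ _ _ (fun u : R => b - u) (fun s : R => expmx (s *: B)) _ (nbhs (b - u))).
    by apply: cvgB; [exact: cvg_cst|exact: cvg_id].
  exact: expmx_continuous.
by move=> t at_ tb; apply: pullback_dini => //; exact: zs.
Qed.

Lemma expmx_subsol_ae (L : R) :
  (forall x y, a <= x -> x <= y -> y <= b -> `|z y - z x| <= L * (y - x)) ->
  {ae lebesgue_measure, forall t, a <= t -> t < b -> subsol_at z t} ->
  vle (expmx ((b - a) *: B) *m z a) (z b).
Proof.
move=> zL zs i.
have -> : z b i 0 = h i b by rewrite /h subrr expmx0 mul1mx.
have [K K0 KP] := expmx_bounded B (b - a).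
have [K1 K10 K1P] := expmx_lip B (b - a).
pose Z := `|z a| + `|L| * (b - a).
have zZ x : a <= x -> x <= b -> `|z x| <= Z.
  move=> ax xb; rewrite -[z x](subrKC (z a)); apply: le_trans (ler_normD _ _) _.
  rewrite lerD2l; apply: le_trans (zL a x (lexx _) ax xb) _.
  apply: (@le_trans _ _ (`|L| * (x - a))).
    by rewrite ler_wpM2r ?subr_ge0// ler_norm.
  by rewrite ler_wpM2l// lerB.
apply: (@dini_ndecr_ae R (h i) a b (m%:R * K * (`|L| + m%:R * K1 * Z)) ab).
  move=> x y ax xy yb; rewrite /h; set P := expmx ((b - y) *: B).
  have -> : expmx ((b - x) *: B) = P *m expmx ((y - x) *: B).
    by rewrite -expmxD addrA subrK.
  have -> : (P *m z y) i 0 - (P *m expmx ((y - x) *: B) *m z x) i 0 =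
     (P *m (z y - expmx ((y - x) *: B) *m z x)) i 0.
    rewrite mulmxBr mulmxA.
    by move: (P *m z y) (P *m _ *m _) => p q; rewrite !mxE.
  apply: le_trans (mx_norm_coord_le _ _ _) _.
  apply: le_trans (mulmx_norm_le _ _) _; rewrite -[leRHS]mulrA.
  apply: ler_pM; [by rewrite mulr_ge0|by []|by rewrite ler_wpM2l// KP//; lra|].
  have -> : z y - expmx ((y - x) *: B) *m z x =
    (z y - z x) - (expmx ((y - x) *: B) - 1%:M) *m z x.
    by rewrite mulmxBl mul1mx opprB addrA subrK.
  apply: le_trans (ler_normB _ _) _; rewrite mulrDl; apply: lerD.
    apply: le_trans (zL _ _ ax xy yb) _.
    by rewrite ler_wpM2r ?subr_ge0// ler_norm.
  apply: le_trans (mulmx_norm_le _ _) _; rewrite -!mulrA ler_wpM2l//.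
  rewrite [Z * _]mulrC mulrA ler_pM//; last by apply: zZ => //; lra.
  by apply: K1P; lra.
apply: (@filterS _ _ (ae_filter_ringOfSetsType (@lebesgue_measure R)) _ _ _ zs) => t zt at_ tb.
by apply: pullback_dini => //; exact: zt.
Qed.

End pullback.
End subsolutions.

(** * Histories and the exponential ordering *)

Section histories.
Variables (R : realType) (r : R) (m : nat).
Implicit Types (f g : hist r m) (y z : R -> 'cV[R]_m) (s t : R).

Lemma delay_itvE s : delay_itv r s <-> - r <= s /\ s <= 0.
Proof. by rewrite /delay_itv /= in_itv/=; split => [/andP|[-> ->]]. Qed.

Lemma hist_norm_le f (k : R) : 0 <= k ->
  (forall s, delay_itv r s -> `|f s| <= k) -> `|f| <= k.
Proof. by move=> k0 fk; exact: sup_image_le. Qed.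

Lemma hist_norm_ge f s : delay_itv r s -> `|f s| <= `|f|.
Proof. exact: ler_sup_norm. Qed.

Lemma hist_atE_within y t s : {within [set u | - r <= u], continuous y} ->
  0 <= t -> delay_itv r s -> (hist_at y t : hist r m) s = y (t + s).
Proof.
move=> yc t0 sr; rewrite /hist_at.
suff : exists f : hist r m, forall s, delay_itv r s -> f s = y (t + s).
  by move=> ex; rewrite (xgetPex 0 ex).
pose g s := if `[< delay_itv r s >] then y (t + s) else 0.
have gp : hist_pred r g.
  apply/asboolP; split; last by move=> u ur; rewrite /g asboolF.
  have gE v : delay_itv r v -> g v = y (t + v) by move=> vr; rewrite /g asboolT.
  apply/subspace_continuousP => u ur.
  suff : g x @[x --> within (delay_itv r) (nbhs u)] --> g u by [].
  rewrite (gE u ur).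
  apply: (@cvg_trans _ ((fun v => y (t + v)) x @[x --> within (delay_itv r) (nbhs u)])).
    by apply: fmap_within_eq => v; rewrite inE; exact: gE.
  have /subspace_continuousP/(_ (t + u)) := yc.
  have ut : - r <= t + u by move: ur => /delay_itvE; lra.
  move=> /(_ ut) h; apply: cvg_trans h => /= A.
  move=> /nbhs_ballP[d /= d0 dA]; apply/nbhs_ballP; exists d => //= v uv vr.
  apply: dA; first by move: uv; rewrite /ball/= opprD addrACA subrr add0r.
  by move: vr => /delay_itvE /=; lra.
exists (Hist gp) => u ur /=; rewrite /g; case: asboolP => //.
Qed.

Lemma hist_atE y t s : continuous y -> delay_itv r s ->
  (hist_at y t : hist r m) s = y (t + s).
Proof.
move=> yc sr.
have yc' : continuous (fun u => y (t + u)).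
  move=> u; apply: (@cvg_comp _ _ _ (fun u => t + u) y _ (nbhs (t + u))).
    by apply: cvgD; [exact: cvg_cst|exact: cvg_id].
  exact: yc.
transitivity ((hist_at (fun u => y (t + u)) 0 : hist r m) s).
  rewrite /hist_at; congr (hist_fun (xget 0 _) _); apply/funext => f /=.
  by apply/propext; split => H u ur; rewrite H// add0r.
have := @hist_atE_within (fun u => y (t + u)) 0 s (continuous_subspaceT yc') (lexx 0) sr.
by move=> H; apply: (eq_trans H); rewrite add0r.
Qed.

Lemma eq_hist_at y z t : (forall s, delay_itv r s -> y (t + s) = z (t + s)) ->
  hist_at y t = hist_at z t :> hist r m.
Proof.
move=> yz; rewrite /hist_at; congr (xget 0 _); apply/funext => f /=.
by apply/propext; split => H u ur; rewrite H// yz.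
Qed.

Lemma hist_at_shift y t s : hist_at (fun u => y (u + s)) t = hist_at y (t + s) :> hist r m.
Proof.
rewrite /hist_at; congr (xget 0 _); apply/funext => f /=.
by apply/propext; split => H u ur; rewrite H// addrAC.
Qed.

Lemma hist_at_dist y z t k : continuous y -> continuous z -> 0 <= k ->
  (forall s, t - r <= s -> s <= t -> `|y s - z s| <= k) ->
  `|hist_at y t - hist_at z t : hist r m| <= k.
Proof.
move=> yc zc k0 H; apply: hist_norm_le => // s sr.
rewrite -[X in `|X|]/((hist_at y t : hist r m) s - (hist_at z t : hist r m) s) !hist_atE//.
by move/delay_itvE: sr => ?; apply: H; lra.
Qed.

Lemma hist_at_continuous y : continuous y ->
  continuous (fun t => hist_at y t : hist r m).
Proof.
move=> yc t; apply/cvgrPdist_le => e e0.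
have [d d0 dP] := compact_unif_continuous (@segment_compact _ (t - r) t) yc e0.
apply/nbhs_ballP; exists d => //= u tu.
have yc' : continuous (fun v => y (v + (u - t))).
  move=> v; apply: (@cvg_comp _ _ _ (fun v => v + (u - t)) y _ (nbhs (v + (u - t)))).
    by apply: cvgD; [exact: cvg_id|exact: cvg_cst].
  exact: yc.
have -> : hist_at y u = hist_at (fun v => y (v + (u - t))) t :> hist r m.
  by rewrite hist_at_shift subrKC.
apply: hist_at_dist => //; first exact: ltW.
move=> s ts st; have /dP : `[t - r, t]%classic s by rewrite /= in_itv/= ts st.
move=> H; have : ball (y s) e (y (s + (u - t))).
  by apply: H; rewrite /ball/= opprD addNKr opprB; move: tu; rewrite /ball/=.
by rewrite -ball_normE => /ltW.
Qed.

End histories.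

Section cones.
Variables (R : realType) (r : R) (m : nat) (B : 'M[R]_m).
Context (B_quasipos : quasipositive B) (r_gt0 : 0 < r).
Implicit Types (f g phi psi : hist r m) (y z : R -> 'cV[R]_m) (s t a b : R).

Lemma vle_refl (x : 'cV[R]_m) : vle x x.
Proof. by move=> i. Qed.

Lemma vle_trans (x y z : 'cV[R]_m) : vle x y -> vle y z -> vle x z.
Proof. by move=> xy yz i; exact: le_trans (xy i) (yz i). Qed.

Lemma vle_mulmx (A : 'M[R]_m) (x y : 'cV[R]_m) :
  (forall i j, 0 <= A i j) -> vle x y -> vle (A *m x) (A *m y).
Proof. by move=> A0 xy i; rewrite !mxE ler_sum// => j _; rewrite ler_wpM2l. Qed.

Lemma vle_norm (x y : 'cV[R]_m) : vle 0 x -> vle x y -> `|x| <= `|y|.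
Proof.
move=> x0 xy; apply/mx_norm_leP => // i j; rewrite ord1 ger0_norm.
  apply: le_trans (mx_norm_coord_le y i 0); apply: le_trans (ler_norm _).
  exact: xy.
by have := x0 i; rewrite mxE.
Qed.

Lemma coneB0 : coneB B (0 : hist r m).
Proof.
by split=> [s _|s t _ _ _]; [exact: vle_refl|rewrite -[(0 : hist r m) s]/(0 : 'cV[R]_m) mulmx0; exact: vle_refl].
Qed.

Lemma coneBD phi psi : coneB B phi -> coneB B psi -> coneB B (phi + psi).
Proof.
move=> [p0 pc] [q0 qc]; split=> [s sr i|s t rs st t0 i].
  have := p0 s sr i; have := q0 s sr i.
  rewrite -[(phi + psi) s]/(phi s + psi s) !mxE; lra.
have := pc s t rs st t0 i; have := qc s t rs st t0 i.
rewrite -[(phi + psi) s]/(phi s + psi s) -[(phi + psi) t]/(phi t + psi t) mulmxDr.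
by move: (_ *m phi s) (_ *m psi s) => p q; rewrite !mxE; lra.
Qed.

Lemma coneBZ phi (k : R) : 0 <= k -> coneB B phi -> coneB B (k *: phi).
Proof.
move=> k0 [p0 pc]; split=> [s sr i|s t rs st t0 i].
  have := p0 s sr i; rewrite -[(k *: phi) s]/(k *: phi s) !mxE => ?.
  exact: mulr_ge0.
have := pc s t rs st t0 i.
rewrite -[(k *: phi) s]/(k *: phi s) -[(k *: phi) t]/(k *: phi t) -scalemxAr.
by move: (_ *m phi s) => p; rewrite !mxE => h; rewrite ler_wpM2l.
Qed.

Lemma leB_refl phi : leB B phi phi.
Proof. by rewrite /leB subrr; exact: coneB0. Qed.

Lemma leB_trans phi psi chi : leB B phi psi -> leB B psi chi -> leB B phi chi.
Proof. by move=> h1 h2; rewrite /leB -(subrKA psi); exact: coneBD. Qed.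

Lemma leB0 phi : leB B 0 phi <-> coneB B phi.
Proof. by rewrite /leB subr0. Qed.

Lemma leBZ (k : R) phi psi : 0 <= k -> leB B phi psi -> leB B (k *: phi) (k *: psi).
Proof. by move=> k0; rewrite /leB -scalerBr; exact: coneBZ. Qed.

Lemma leBZr (k l : R) phi : k <= l -> coneB B phi -> leB B (k *: phi) (l *: phi).
Proof. by move=> kl cp; rewrite /leB -scalerBl; apply: coneBZ; rewrite ?subr_ge0. Qed.

Lemma coneB_ge phi psi : coneB B phi -> leB B phi psi -> coneB B psi.
Proof. by move=> /leB0 h1 h2; apply/leB0; exact: leB_trans h2. Qed.

Lemma leB_norm phi psi : coneB B phi -> leB B phi psi -> `|phi| <= `|psi|.
Proof.
move=> [p0 _] [q0 _]; apply: hist_norm_le => // s sr.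
apply: le_trans (hist_norm_ge psi sr); apply: vle_norm; first exact: p0.
by move=> i; have := q0 s sr i; rewrite -[(psi - phi) s]/(psi s - phi s) !mxE; lra.
Qed.

Lemma coneB_closed phi : (forall e, 0 < e -> exists2 psi, coneB B psi & `|phi - psi| <= e) ->
  coneB B phi.
Proof.
move=> H; split=> [s sr i|s t rs st t0 i]; apply/ler_addgt0Pr => e e0.
  have [psi [q0 _] d] := H e e0.
  have := q0 s sr i; have := le_trans (hist_norm_ge (phi - psi) sr) d.
  move=> /(le_trans (mx_norm_coord_le _ i 0)).
  rewrite -[(phi - psi) s]/(phi s - psi s) !mxE ler_norml => /andP[h1 _]; lra.
have sr : delay_itv r s by apply/delay_itvE; split=> //; lra.
have tr : delay_itv r t by apply/delay_itvE; split=> //; lra.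
set E := expmx _.
pose k := m%:R * `|E| + 1.
have k0 : 0 < k by rewrite ltr_wpDl// mulr_ge0.
have [|psi [_ qc] d] := H (e / (k + 1)); first by rewrite divr_gt0// addr_gt0.
have := qc s t rs st t0 i; rewrite -/E.
have h1 : `|phi t - psi t| <= e / (k + 1) by exact: le_trans (hist_norm_ge (phi - psi) tr) d.
have h2 : `|E *m phi s - E *m psi s| <= (k - 1) * (e / (k + 1)).
  rewrite -mulmxBr; apply: le_trans (mulmx_norm_le _ _) _.
  have -> : k - 1 = m%:R * `|E| by rewrite /k; ring.
  by rewrite ler_wpM2l ?mulr_ge0//; exact: le_trans (hist_norm_ge (phi - psi) sr) d.
have := le_trans (mx_norm_coord_le _ i 0) h1.
have := le_trans (mx_norm_coord_le _ i 0) h2.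
move: (E *m phi s) (E *m psi s) => p q; rewrite !mxE !ler_norml.
have : (k - 1) * (e / (k + 1)) + e / (k + 1) <= e.
  have -> : (k - 1) * (e / (k + 1)) + e / (k + 1) = e * (k / (k + 1)).
    by field; lra.
  by apply: ler_piMr; [exact: ltW|rewrite ler_pdivrMr; lra].
by move=> ? /andP[? ?] /andP[? ?] ?; lra.
Qed.

Lemma coneB_hist_at y t : continuous y ->
  coneB B (hist_at y t : hist r m) <->
  (forall s, t - r <= s -> s <= t -> vle 0 (y s)) /\
  (forall s u, t - r <= s -> s <= u -> u <= t ->
    vle (expmx ((u - s) *: B) *m y s) (y u)).
Proof.
move=> yc; split=> -[h1 h2]; split.
- move=> s ts st; have sr : delay_itv r (s - t) by apply/delay_itvE; lra.
  by have := h1 _ sr; rewrite hist_atE// subrKC.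
- move=> s u ts su ut.
  have sr : delay_itv r (s - t) by apply/delay_itvE; lra.
  have ur : delay_itv r (u - t) by apply/delay_itvE; lra.
  have := h2 (s - t) (u - t).
  rewrite !hist_atE// !subrKC opprB addrA subrK; apply; lra.
- move=> s sr; rewrite hist_atE//.
  by move/delay_itvE : sr => ?; apply: h1; lra.
- move=> s u rs su u0.
  have sr : delay_itv r s by apply/delay_itvE; lra.
  have ur : delay_itv r u by apply/delay_itvE; lra.
  rewrite !hist_atE//; have := h2 (t + s) (t + u).
  by rewrite opprD addrACA subrr add0r; apply; lra.
Qed.

Lemma coneB_propagate y a b : a <= b -> continuous y ->
  coneB B (hist_at y a : hist r m) ->
  (forall t, a <= t -> t < b -> subsol_at B y t) ->
  coneB B (hist_at y b : hist r m).
Proof.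
move=> ab yc /(coneB_hist_at _ yc)[h1 h2] ys; apply/coneB_hist_at => //.
have sub s u : a <= s -> s <= u -> u <= b -> vle (expmx ((u - s) *: B) *m y s) (y u).
  move=> as_ su ub; apply: expmx_subsol => // t st tu.
  by apply: ys; [exact: le_trans st|exact: lt_le_trans ub].
have E0 s u : s <= u -> forall i j, 0 <= expmx ((u - s) *: B) i j.
  by move=> su; apply: expmx_quasipositive; rewrite ?subr_ge0.
have all s u : a - r <= s -> s <= u -> u <= b ->
    vle (expmx ((u - s) *: B) *m y s) (y u).
  move=> rs su ub; have [as_|sa] := leP a s; first exact: sub.
  have [ua|au] := leP u a; first by apply: h2; lra.
  have -> : u - s = (u - a) + (a - s) by rewrite addrA subrK.
  rewrite expmxD -mulmxA; apply: vle_trans (sub a u _ _ _); rewrite ?(ltW au)//.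
  by apply: vle_mulmx; [exact/E0/ltW|apply: h2; lra].
split=> [s bs sb|s u bs su ub]; last by apply: all => //; lra.
have [sa|as_] := leP s a; first by apply: h1; lra.
apply: vle_trans (all a s _ _ _); try lra.
rewrite -[X in vle X _](mulmx0 _ (expmx ((s - a) *: B))).
by apply: vle_mulmx; [exact/E0/ltW|apply: h1; lra].
Qed.

End cones.

Section interior.
Variables (R : realType) (r : R) (m : nat) (B : 'M[R]_m).
Context (B_quasipos : quasipositive B) (r_gt0 : 0 < r).
Implicit Types (phi psi eta : lipHist r m) (s t : R).

Lemma lip_norm_sup eta : `|eta : hist r m| <= `|eta|.
Proof. by rewrite lerDl; apply: sup_image_ge0 => p _; exact: slope_ge0. Qed.

Lemma lip_norm_at eta s : delay_itv r s -> `|eta s| <= `|eta|.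
Proof. by move=> sr; exact: le_trans (hist_norm_ge eta sr) (lip_norm_sup eta). Qed.

Lemma lip_norm_slope eta s t : delay_itv r s -> delay_itv r t ->
  `|eta t - eta s| <= `|eta| * `|t - s|.
Proof.
move=> sr tr; have [->|nts] := eqVneq t s.
  by rewrite !subrr !normr0 mulr0.
rewrite -ler_pdivrMr ?normr_gt0 ?subr_eq0//.
apply: (@le_trans _ _ (sup [set slope eta p | p in slope_dom r])).
  exact: (le_sup_image (lip_bdd eta) (x := (t, s))).
by rewrite lerDr; exact: sup_norm_ge0.
Qed.

Lemma lip_norm_le eta (k l : R) : 0 <= k -> 0 <= l ->
  (forall s, delay_itv r s -> `|eta s| <= k) ->
  (forall s t, delay_itv r s -> delay_itv r t -> s <= t ->
     `|eta t - eta s| <= l * (t - s)) -> `|eta| <= k + l.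
Proof.
move=> k0 l0 hk hl; apply: lerD; first exact: hist_norm_le.
apply: sup_image_le => // -[s t] [/= sr tr st].
rewrite /slope/= ler_pdivrMr ?normr_gt0 ?subr_eq0//.
have [st'|ts'] := leP t s.
  by rewrite [X in _ * X]ger0_norm ?subr_ge0// hl.
by rewrite distrC [`|s - t|]distrC [X in _ * X]ger0_norm ?subr_ge0 ?(ltW ts')// hl// ltW.
Qed.

Lemma derivable_rderiv (V : normedModType R) (f : R -> V) t : derivable f t 1 ->
  rderiv f t ('D_1 f t).
Proof. by move=> /derivableP; exact: is_derive_rderiv. Qed.

Lemma intConeB_quantitative psi : intConeB B psi -> exists2 d : R, 0 < d &
  (forall s i, delay_itv r s -> d <= psi s i 0) /\
  (forall s t i, - r <= s -> s <= t -> t <= 0 ->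
     (expmx ((t - s) *: B) *m psi s) i 0 + d * (t - s) <= psi t i 0).
Proof.
move=> [p0 [e e0 pd]].
have [d0 d00 d0P] : exists2 d : R, 0 < d & forall s i, delay_itv r s -> d <= psi s i 0.
  have mi i : exists d : R, 0 < d /\ forall s, delay_itv r s -> d <= psi s i 0.
    have [] := @EVT_min R (fun s => psi s i 0) (- r) 0; first by rewrite oppr_le0 ltW.
      move=> x; apply: (@cvg_comp _ _ _ (psi : R -> 'cV[R]_m) (fun M : 'cV[R]_m => M i 0) _ (nbhs (psi x))).
        exact: hist_continuous.
      exact: coord_continuous.
    move=> c cr cmin; exists (psi c i 0); split.
      by have := p0 c _ i; rewrite mxE; apply.
    by move=> s sr; apply: cmin.
  have [dd ddP] := choice mi.
  have : \forall d \near (0:R)^'+, forall i, d <= dd i.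
    by apply: (@filter_forall R 'I_m (fun i d => d <= dd i)) => i; apply: nbhs_right_le; exact: (ddP i).1.
  move=> /(filterI (nbhs_right_gt 0)) /filter_ex [d [/= d0 dle]].
  by exists d => // s i sr; exact: le_trans (dle i) ((ddP i).2 s sr).
pose d1 := e / (1 + r * (m%:R * `|B|)).
have b0 : 0 <= m%:R * `|B| by rewrite mulr_ge0.
have den0 : 0 < 1 + r * (m%:R * `|B|) by rewrite ltr_pwDl// mulr_ge0// ltW.
have d10 : 0 < d1 by rewrite divr_gt0.
exists (Num.min d0 d1); first by rewrite lt_min d00.
split=> [s i sr|s t i rs st t0].
  by apply: le_trans (d0P s i sr); rewrite ge_min lexx.
pose z u : 'cV[R]_m := psi u - (u - s) *: const_mx d1.
have itv (u : R) : s <= u -> u <= t -> delay_itv r u.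
  by move=> su ut; apply/delay_itvE; split; lra.
have zb : vle (expmx ((t - s) *: B) *m z s) (z t).
  apply: (@expmx_subsol_ae R m B B_quasipos z s t st (`|psi| + d1)).
    move=> x y sx xy yt; rewrite /z.
    have -> : psi y - (y - s) *: const_mx d1 - (psi x - (x - s) *: const_mx d1) =
       (psi y - psi x) - (y - x) *: const_mx d1 :> 'cV[R]_m.
      by apply/matrixP => a b; rewrite !mxE; ring.
    apply: le_trans (ler_normB _ _) _; rewrite mulrDl; apply: lerD.
      rewrite -[X in _ <= _ * X](@ger0_norm _ (y - x)) ?subr_ge0//.
      by apply: lip_norm_slope; apply: itv => //; lra.
    rewrite normrZ ger0_norm ?subr_ge0// mulrC ler_wpM2r ?subr_ge0//.
    by apply/mx_norm_leP => [|a b]; [exact: ltW|rewrite mxE ger0_norm// ltW].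
  apply: (@filterS _ _ (ae_filter_ringOfSetsType (@lebesgue_measure R)) _ _ _ pd) => u0.
  suff key (u : R) : (delay_itv r u -> derivable (psi : R -> 'cV[R]_m) u 1 /\
      vle (const_mx e) ('D_1 (psi : R -> 'cV[R]_m) u - B *m psi u)) ->
      s <= u -> u < t -> subsol_at B z u by exact: key.
  move=> pu su ut; have [pdu pBu] := pu (itv u su (ltW ut)).
  apply: (@rderiv_subsol R m B z u ('D_1 (psi : R -> 'cV[R]_m) u - const_mx d1)).
    have h1 := derivable_rderiv pdu.
    have h2 : rderiv (fun u : R => (u - s) *: (const_mx d1 : 'cV[R]_m)) u (const_mx d1).
      move=> e' e'0; apply: filterS (nbhs_right_gt u) => v uv.
      rewrite -scalerBl -scalerBl opprB addrA subrK subrr scale0r normr0.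
      by rewrite mulr_ge0// ?ltW// subr_gt0.
    exact: rderivB h1 h2.
  move=> k; have := pBu k; rewrite /z mulmxBr -scalemxAr.
  have : (u - s) * (B *m const_mx d1 : 'cV[R]_m) k 0 >= - (r * (m%:R * `|B| * d1)).
    have h : `|(B *m const_mx d1 : 'cV[R]_m) k 0| <= m%:R * `|B| * d1.
      apply: le_trans (mx_norm_coord_le _ _ _) _; apply: le_trans (mulmx_norm_le _ _) _.
      rewrite ler_wpM2l//.
      by apply/mx_norm_leP => [|a b]; [exact: ltW|rewrite mxE ger0_norm// ltW].
    rewrite -[X in X <= _]mulrN; move: h; rewrite ler_norml => /andP[h _].
    apply: (@le_trans _ _ ((u - s) * - (m%:R * `|B| * d1))).
      have ur : u - s <= r by lra.
      by rewrite !mulrN lerN2; apply: ler_wpM2r ur; rewrite mulr_ge0// ltW.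
    by rewrite ler_wpM2l ?subr_ge0.
  have : d1 + r * (m%:R * `|B| * d1) = e.
    by rewrite /d1; field; lra.
  move: ('D_1 (psi : R -> 'cV[R]_m) u) (B *m psi u) (B *m const_mx d1 : 'cV[R]_m) => D x w.
  by rewrite !mxE; lra.
have := zb i; rewrite /z subrr scale0r subr0.
have : Num.min d0 d1 * (t - s) <= d1 * (t - s).
  by rewrite ler_wpM2r ?subr_ge0// ge_min lexx orbT.
move: (_ *m psi s) => v; rewrite !mxE; lra.
Qed.

Lemma intConeB_order_unit psi : intConeB B psi -> exists2 c : R, 0 < c &
  forall eta, coneB B ((c * `|eta|) *: (psi : hist r m) + eta).
Proof.
move=> /intConeB_quantitative[d d0 [pd pc]].
have [K K0 KP] := expmx_lip B r.
have mK : 0 <= m%:R * K by rewrite mulr_ge0// ltW.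
exists ((1 + m%:R * K) / d); first by rewrite divr_gt0// ltr_pwDl.
move=> eta; set c := _ / d.
have cd : c * d = 1 + m%:R * K by rewrite /c divfK// gt_eqF.
have ceta : 0 <= c * `|eta| by rewrite mulr_ge0// divr_ge0// ?ltW// ltr_pwDl.
have cdeta : c * `|eta| * d = `|eta| + m%:R * K * `|eta| by rewrite mulrAC cd; ring.
set phi : hist r m := _ + _.
have phiE (u : R) : phi u = (c * `|eta|) *: psi u + eta u by [].
split=> [s sr i|s t rs st t0 i].
  rewrite phiE !mxE.
  have := le_trans (mx_norm_coord_le (eta s) i 0) (lip_norm_at eta sr).
  have := ler_wpM2l ceta (pd s i sr).
  have : 0 <= m%:R * K * `|eta| by rewrite mulr_ge0.
  by rewrite ler_norml => ? ? /andP[]; lra.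
have sr : delay_itv r s by apply/delay_itvE; lra.
have tr : delay_itv r t by apply/delay_itvE; lra.
rewrite !phiE.
have h1 := ler_wpM2l ceta (pc s t i rs st t0).
have h2 : (t - s) * (c * `|eta| * d) = (t - s) * `|eta| + (t - s) * (m%:R * K * `|eta|).
  by rewrite cdeta mulrDr.
have h3 : `|eta t - eta s| <= (t - s) * `|eta|.
  by rewrite mulrC -[X in _ * X](@ger0_norm _ (t - s)) ?subr_ge0//; exact: lip_norm_slope.
have h4 : `|(expmx ((t - s) *: B) - 1%:M) *m eta s| <= (t - s) * (m%:R * K * `|eta|).
  apply: le_trans (mulmx_norm_le _ _) _.
  have -> : (t - s) * (m%:R * K * `|eta|) = m%:R * (K * (t - s)) * `|eta| by ring.
  apply: ler_pM; [by rewrite mulr_ge0|by []| |exact: lip_norm_at].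
  by rewrite ler_wpM2l// KP//; lra.
have := le_trans (mx_norm_coord_le _ i 0) h3.
have := le_trans (mx_norm_coord_le _ i 0) h4.
rewrite mulmxBl mul1mx mulmxDr -scalemxAr.
move: h1; move: (_ *m psi s) (_ *m eta s) => v w; rewrite !mxE !ler_norml.
by move=> ? /andP[? ?] /andP[? ?]; lra.
Qed.

End interior.

Section interior_upper.
Variables (R : realType) (r : R) (m : nat) (B : 'M[R]_m).
Context (r_gt0 : 0 < r).
Implicit Types (phi psi : lipHist r m) (s t : R).

Lemma coneB_rderiv (chi : hist r m) s (D : 'cV[R]_m) : coneB B chi ->
  - r <= s -> s < 0 -> rderiv chi s D -> vle (B *m chi s) D.
Proof.
move=> [_ cc] rs s0 chiD i; apply/ler_addgt0Pr => e e0.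
pose e1 := e / (m%:R * `|chi s| + 1 + 1).
have mc : 0 <= m%:R * `|chi s| by rewrite mulr_ge0.
have e10 : 0 < e1 by rewrite divr_gt0//; lra.
have /nbhs_ballP[d /= d0 dP] := expmx_rderiv0 B e10.
near (s : R)^'+ => u.
have su : s < u by near: u; exact: nbhs_right_gt.
have u0 : u <= 0 by near: u; exact: nbhs_right_le.
have ud : u < s + d by near: u; apply: nbhs_right_lt; rewrite ltrDl.
have h1 : `|chi u - chi s - (u - s) *: D| <= e1 * (u - s) by near: u; exact: chiD.
have h2 : `|expmx ((u - s) *: B) - 1%:M - (u - s) *: B| <= e1 * (u - s).
  have := dP (u - s); rewrite /ball/= sub0r normrN ger0_norm ?subr_ge0 ?(ltW su)//.
  rewrite subr0 expmx0; apply; first by lra.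
  by rewrite subr_gt0.
have h3 := cc s u rs (ltW su) u0 i.
have h4 : `|(expmx ((u - s) *: B) - 1%:M - (u - s) *: B) *m chi s| <=
    m%:R * `|chi s| * e1 * (u - s).
  apply: le_trans (mulmx_norm_le _ _) _.
  have -> : m%:R * `|chi s| * e1 * (u - s) = m%:R * (e1 * (u - s)) * `|chi s| by ring.
  by rewrite ler_wpM2r// ler_wpM2l.
have {}h1 := le_trans (mx_norm_coord_le _ i 0) h1.
have {}h4 := le_trans (mx_norm_coord_le _ i 0) h4.
have us : 0 < u - s by rewrite subr_gt0.
rewrite -(ler_pM2l us); move: h1 h3 h4.
rewrite !mulmxBl mul1mx -scalemxAl.
move: (expmx _ *m chi s) (B *m chi s) => v w.
rewrite !mxE !ler_norml => /andP[h1 h1'] h3 /andP[h4 h4'].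
have : m%:R * `|chi s| * e1 * (u - s) + e1 * (u - s) + e1 * (u - s) = (u - s) * e.
  by rewrite /e1; field; lra.
have : 0 < e1 * (u - s) by rewrite mulr_gt0.
by rewrite mulrDr; lra.
Unshelve. all: by end_near. Qed.

Lemma ae_neq (a : R) : {ae lebesgue_measure, forall s : R, s != a}.
Proof.
exists [set a]; split; [exact: measurable_set1|exact: lebesgue_measure_set1|].
by move=> s /= /negP; rewrite negbK => /eqP.
Qed.

Lemma intConeB_ge psi phi (k : R) : intConeB B psi -> 0 < k ->
  leB B (k *: (psi : hist r m)) phi ->
  (forall s, - r < s -> s < 0 -> derivable (phi : R -> 'cV[R]_m) s 1) ->
  intConeB B phi.
Proof.
move=> [p0 [e e0 pd]] k0 kphi phid; rewrite /leB in kphi.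
set chi : hist r m := _ - _ in kphi.
have chiE (u : R) : chi u = phi u - k *: psi u by [].
split.
  move=> s sr i; rewrite mxE.
  have := p0 s sr i; rewrite mxE => /(mulr_gt0 k0).
  have := (kphi.1 s sr) i.
  by rewrite chiE !mxE; lra.
exists (k * e); first exact: mulr_gt0.
pose aeF := ae_filter_ringOfSetsType (@lebesgue_measure R).
have := @filterI _ _ aeF _ _ (@filterI _ _ aeF _ _ (ae_neq (- r)) (ae_neq 0)) pd.
apply: (@filterS _ _ aeF) => s0; case=> -[].
suff key (s : R) : s != - r -> s != 0 ->
    (delay_itv r s -> derivable (psi : R -> 'cV[R]_m) s 1 /\
      vle (const_mx e) ('D_1 (psi : R -> 'cV[R]_m) s - B *m psi s)) ->
    delay_itv r s -> derivable (phi : R -> 'cV[R]_m) s 1 /\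
      vle (const_mx (k * e)) ('D_1 (phi : R -> 'cV[R]_m) s - B *m phi s) by exact: key.
move=> sr s0' ps sitv; have [dpsi Bpsi] := ps sitv.
have /delay_itvE[rs sle] := sitv.
have rs' : - r < s by rewrite lt_neqAle rs eq_sym sr.
have s0'' : s < 0 by rewrite lt_neqAle s0' sle.
have dphi := phid s rs' s0''; split=> //.
have chiD : rderiv chi s
    ('D_1 (phi : R -> 'cV[R]_m) s - k *: 'D_1 (psi : R -> 'cV[R]_m) s).
  have h1 := derivable_rderiv dphi.
  have h2 := rderivZ k (derivable_rderiv dpsi).
  exact: rderivB h1 h2.
have := coneB_rderiv kphi rs s0'' chiD.
rewrite chiE mulmxBr -scalemxAr.
move: Bpsi ('D_1 (phi : R -> 'cV[R]_m) s) (B *m phi s).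
move: ('D_1 (psi : R -> 'cV[R]_m) s) (B *m psi s) => D v h D' v' h' i.
have := h i; have := h' i; rewrite !mxE => q1 /(ler_wpM2l (ltW k0)).
by rewrite mulrDr mulrN; lra.
Qed.

End interior_upper.

(** * Uniqueness for the delay equation *)

Section local_lipschitz.
Context {R : realType} {r : R} {m : nat} {Omega : metricType R}.
Variable F : Omega -> hist r m -> 'cV[R]_m.
Context (F_C1 : C1_snd F).

Lemma differentiable_rderiv_line (V : normedModType R) (f : V -> 'cV[R]_m) (x v : V) (s : R) :
  (forall z, differentiable f z) ->
  rderiv (fun u : R => f (x + u *: v)) s ('d f (x + s *: v) v).
Proof.
move=> df; apply: is_derive_rderiv.
have dfs := @diff_derivable _ _ _ f (x + s *: v) v (df _).
have E : (fun h : R => h^-1 *: (((fun u : R => f (x + u *: v)) \o shift s) (h *: 1) - f (x + s *: v)))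
   = (fun h : R => h^-1 *: ((f \o shift (x + s *: v)) (h *: v) - f (x + s *: v))).
  apply/funext => h /=; congr (_ *: (f _ - _)).
  by rewrite [h *: 1]mulr1 scalerDl addrCA.
split; first by rewrite /derivable E.
by rewrite /derive E -deriveE.
Qed.

Lemma C1_snd_locally_lipschitz (w : Omega) (phi : hist r m) :
  exists L, exists2 d : R, 0 < d & 0 < L /\ forall w' psi1 psi2,
    ball w d w' -> ball phi d psi1 -> ball phi d psi2 ->
    `|F w' psi2 - F w' psi1| <= L * `|psi2 - psi1|.
Proof.
have [dF dFc] := F_C1.
have [k k0 kP] : exists2 k : R, 0 < k & forall v, `|'d (F w) phi v| <= k * `|v|.
  exact: linear_lipschitz (diff_continuous (dF w phi)).
have [[U V] /= [wU phiV] UV] := dFc w phi 1 ltr01.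
move: wU phiV => /nbhs_ballP[d1 /= d10 d1U] /nbhs_ballP[d2 /= d20 d2V].
exists (k + 1), (Num.min d1 d2); first by rewrite lt_min d10.
split=> [|w' psi1 psi2 ww' h1 h2]; first by rewrite addr_gt0.
have Uw' : U w' by apply: d1U; apply: le_ball ww'; rewrite ge_min lexx.
set v := psi2 - psi1.
have seg s : 0 <= s -> s <= 1 -> V (psi1 + s *: v).
  move=> s0 s1; apply: d2V; apply: (@le_ball _ _ _ (Num.min d1 d2)); first by rewrite ge_min lexx orbT.
  move: h1 h2; rewrite -!ball_normE /= => h1 h2.
  have -> : phi - (psi1 + s *: v) = (1 - s) *: (phi - psi1) + s *: (phi - psi2).
    rewrite scalerBl scale1r -[RHS]addrA [- _ + _]addrC -scalerBr opprB.
    by rewrite [phi - psi2 + _]addrC subrKA opprD addrA /v -scalerN opprB.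
  apply: le_lt_trans (ler_normD _ _) _; rewrite !normrZ !ger0_norm ?subr_ge0//.
  have [->|sn] := eqVneq s 1; first by rewrite subrr mul0r add0r mul1r.
  have s1' : s < 1 by rewrite lt_neqAle sn.
  by nra.
have := @rderiv_mean_le R m 1 (fun s : R => F w' (psi1 + s *: v))
  (fun s => 'd (F w') (psi1 + s *: v) v) 0 1 ((k + 1) * `|v|) 0 ler01.
rewrite scale1r scale0r addr0 scaler0 !subr0 mulr1 {1}/v subrKC; apply.
- by rewrite mulr_ge0// addr_ge0// ltW.
- move=> s; apply: (@cvg_comp _ _ _ (fun s : R => psi1 + s *: v) (F w') _ (nbhs (psi1 + s *: v))).
    by apply: cvgD; [exact: cvg_cst|apply: cvgZr_tmp; exact: cvg_id].
  exact: differentiable_continuous.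
move=> s s0 s1; split; first exact: differentiable_rderiv_line.
rewrite subr0 -['d (F w') _ _](subrK ('d (F w) phi v)).
apply: le_trans (ler_normD _ _) _; rewrite mulrDl addrC; apply: lerD => //.
by apply: (UV (w', psi1 + s *: v)); split=> //=; apply: seg => //; exact: ltW.
Qed.

End local_lipschitz.

Lemma cvg_to_pair (I : Type) (T U : topologicalType) (G : set_system I)
    (FG : Filter G) (f : I -> T) (g : I -> U) (x : T) (y : U) :
  f i @[i --> G] --> x -> g i @[i --> G] --> y ->
  (f i, g i) @[i --> G] --> (x, y).
Proof. by move=> fx gy; exact: (@cvg_pair _ _ _ G (nbhs x) (nbhs y)). Qed.

Lemma continuous_near_ball (R : realType) (X : topologicalType)
    (Y : pseudoMetricType R) (f : X -> Y) : continuous f ->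
  forall x d, 0 < d -> \forall t \near x, ball (f x) d (f t).
Proof. by move=> fc x d d0; apply: fc; exact: nbhsx_ballx. Qed.

Section solutions.
Context {R : realType} {r : R} {m : nat} {Omega : metricType R}.
Variables (sigma : R -> Omega -> Omega) (F : Omega -> hist r m -> 'cV[R]_m).
Context (r_gt0 : 0 < r) (sigma_flow : is_flow sigma)
  (F_cont : continuous (fun p : Omega * hist r m => F p.1 p.2)).
Implicit Types (w : Omega) (y z : R -> 'cV[R]_m) (phi : hist r m) (a b t : R).

Definition solves w y a := continuous y /\
  forall t, a <= t -> rderiv y t (F (sigma t w) (hist_at y t)).

Lemma flow_continuous w : continuous (fun t => sigma t w).
Proof.
move=> t; have [sc _ _] := sigma_flow.
apply: (@cvg_comp _ _ _ (fun t => (t, w)) (fun p : R * Omega => sigma p.1 p.2) _ (nbhs (t, w))).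
  by apply: cvg_to_pair; [exact: cvg_id|exact: cvg_cst].
exact: (sc (t, w)).
Qed.

Lemma cvg_rhs (I : Type) (G : set_system I) (FG : Filter G) (f : I -> Omega)
    (g : I -> hist r m) w phi :
  f i @[i --> G] --> w -> g i @[i --> G] --> phi ->
  F (f i) (g i) @[i --> G] --> F w phi.
Proof.
move=> fw gphi; have fg := cvg_to_pair FG fw gphi.
have Fc : {for (w, phi), continuous (fun p : Omega * hist r m => F p.1 p.2)}.
  exact: F_cont.
by move=> A /Fc /fg.
Qed.

Lemma rhs_continuous w y : continuous y ->
  continuous (fun t => F (sigma t w) (hist_at y t)).
Proof.
by move=> yc t; apply: cvg_rhs; [exact: flow_continuous|exact: hist_at_continuous].
Qed.

Lemma hist0 : delay_itv r 0.
Proof. by apply/delay_itvE; split=> //; rewrite oppr_le0 ltW. Qed.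

Lemma solves_unique_step (F_C1 : C1_snd F) w y z c : solves w y c -> solves w z c ->
  (forall s, c - r <= s -> s <= c -> y s = z s) ->
  exists2 d : R, 0 < d & forall s, c <= s -> s <= c + d -> y s = z s.
Proof.
move=> [yc yd] [zc zd] yz.
have yzc : y c = z c by apply: yz => //; rewrite lerBlDr lerDl ltW.
have yzh : hist_at y c = hist_at z c :> hist r m.
  by apply: eq_hist_at => s /delay_itvE ?; apply: yz; lra.
have [L [d d0 [L0 LP]]] := C1_snd_locally_lipschitz F_C1 (sigma c w) (hist_at y c).
have /nbhs_ballP[d1 /= d10 d1P] : \forall t \near c, [/\ ball (sigma c w) d (sigma t w),
    ball (hist_at y c : hist r m) d (hist_at y t) & ball (hist_at y c : hist r m) d (hist_at z t)].
  have n1 := continuous_near_ball (@flow_continuous w) c d0.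
  have n2 := continuous_near_ball (hist_at_continuous (r := r) yc) c d0.
  have n3 := continuous_near_ball (hist_at_continuous (r := r) zc) c d0.
  move: n1 n2 n3; rewrite -yzh.
  exact: filterS3.
pose e := Num.min (d1 / 2) (2 * L)^-1.
have e0 : 0 < e by rewrite lt_min divr_gt0//= invr_gt0 mulr_gt0.
have ed1 : e < d1.
  by apply: (@le_lt_trans _ _ (d1 / 2)); [rewrite ge_min lexx|lra].
have eL : L * e <= 2^-1.
  have : e <= (2 * L)^-1 by rewrite ge_min lexx orbT.
  by move=> /(ler_wpM2l (ltW L0)); rewrite invfM mulrCA divff ?mulr1// gt_eqF.
have cce : c <= c + e by rewrite lerDl ltW.
have dc : continuous (y \- z) by move=> u; apply: cvgB; [exact: yc|exact: zc].
have [u0 u0c umax] := @EVT_max R (fun u => `|y u - z u|) c (c + e) cce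
   (continuous_subspaceT (fun u => cvg_norm (dc u))).
pose N := `|y u0 - z u0|.
have [cu0 u0e] : c <= u0 /\ u0 <= c + e by move: u0c; rewrite in_itv/= => /andP.
have umax' u : c <= u -> u <= c + e -> `|y u - z u| <= N.
  by move=> cu ue; apply: umax; rewrite in_itv/= cu.
have hN t : c <= t -> t <= c + e -> `|hist_at y t - hist_at z t : hist r m| <= N.
  move=> ct te; apply: hist_at_dist => //; first exact: normr_ge0.
  move=> s ts st; have [sc|/ltW cs] := leP s c.
    by rewrite yz ?subrr ?normr0 ?normr_ge0//; lra.
  by apply: umax' => //; lra.
have : N <= L * N * (u0 - c).
  have := @rderiv_mean_le R m 1 (y \- z)
    (fun t => F (sigma t w) (hist_at y t) - F (sigma t w) (hist_at z t)) c u0 (L * N) 0 cu0.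
  rewrite /= yzc subrr scaler0 !subr0; apply => //.
    by apply: mulr_ge0; [exact: ltW|exact: normr_ge0].
  move=> t ct tu0; split; first by apply: rderivB; [exact: yd|exact: zd].
  have tc : ball c d1 t.
    by rewrite /ball/= distrC ger0_norm ?subr_ge0//; lra.
  have [h1 h2 h3] := d1P t tc.
  rewrite subr0; apply: le_trans (LP _ _ _ h1 h3 h2) _.
  by rewrite ler_wpM2l ?(ltW L0)// hN//; lra.
have N0 : 0 <= N by exact: normr_ge0.
have : L * N * (u0 - c) <= N * 2^-1.
  rewrite [L * N]mulrC -mulrA ler_wpM2l//; apply: le_trans eL.
  by rewrite ler_wpM2l ?(ltW L0)//; lra.
move=> h1 h2; have {}N0 : N = 0 by lra.
exists e => // s cs se; apply/eqP; rewrite -subr_eq0 -normr_le0 -N0.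
exact: umax'.
Qed.

Lemma solves_unique (F_C1 : C1_snd F) w y z a : solves w y a -> solves w z a ->
  (forall s, a - r <= s -> s <= a -> y s = z s) ->
  forall t, a - r <= t -> y t = z t.
Proof.
move=> ys zs yz t art; apply: contrapT => nyz.
pose S := [set u | a <= u /\ forall s, a - r <= s -> s <= u -> y s = z s].
have Sa : S a by split.
have St u : S u -> u <= t.
  by move=> [au us]; rewrite leNgt; apply/negP => tu; apply: nyz; apply: us => //; exact: ltW.
have hsS : has_sup S by split; [exists a|exists t => u; exact: St].
pose c := sup S.
have ac : a <= c by apply: sup_ubound => //; exact: hsS.2.
have lt_c s : a - r <= s -> s < c -> y s = z s.
  move=> ars sc; have [u [au us] su] := sup_gt (ex_intro _ a Sa) sc.
  by apply: us => //; exact: ltW.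
have eq_c : y c = z c.
  have [->|nca] := eqVneq c a; first by apply: yz => //; rewrite lerBlDr lerDl ltW.
  have {nca}ac' : a < c by rewrite lt_neqAle eq_sym nca.
  have dc : continuous (y \- z).
    by move=> u; apply: cvgB; [exact: ys.1|exact: zs.1].
  apply/eqP; rewrite -subr_eq0 -normr_le0; apply/ler_addgt0Pr => e e0; rewrite add0r.
  have /cvgrPdist_le/(_ e e0)/nbhs_ballP[d /= d0 dP] := dc c.
  have [u [uc cdu au]] : exists u, [/\ u < c, c - d / 2 <= u & a <= u].
    exists (Num.max a (c - d / 2)); split.
    - by rewrite gt_max ac'/= ltrBlDr ltrDl divr_gt0.
    - by rewrite le_max lexx orbT.
    - by rewrite le_max lexx.
  have bu : ball c d u by rewrite /ball/= ger0_norm ?subr_ge0 ?(ltW uc)//; lra.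
  have yzu : y u = z u by apply: lt_c => //; have := r_gt0; lra.
  by have := dP u bu; rewrite /= yzu subrr subr0.
have le_c s : a - r <= s -> s <= c -> y s = z s.
  by move=> ars; rewrite le_eqVlt => /orP[/eqP->//|]; exact: lt_c.
have restr x : solves w x a -> solves w x c.
  by move=> [xc xd]; split=> // u cu; apply: xd; exact: le_trans cu.
have [|d d0 dP] := solves_unique_step F_C1 (restr _ ys) (restr _ zs).
  by move=> s crs sc; apply: le_c => //; lra.
have /(sup_ubound hsS.2) : S (c + d).
  split=> [|s ars scd]; first by lra.
  by have [sc|/ltW cs] := leP s c; [exact: le_c|exact: dP].
by rewrite -/c; lra.
Qed.

End solutions.

Section solution_operator.
Context {R : realType} {r : R} {m : nat} {Omega : metricType R}.
Variables (sigma : R -> Omega -> Omega) (F : Omega -> hist r m -> 'cV[R]_m).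
Context (r_gt0 : 0 < r) (sigma_flow : is_flow sigma)
  (F_cont : continuous (fun p : Omega * hist r m => F p.1 p.2)) (F_C1 : C1_snd F).
Implicit Types (w : Omega) (y z : R -> 'cV[R]_m) (phi : hist r m) (a b t : R).

Lemma solves_is_solution w phi y : solves sigma F w y 0 ->
  (forall s, delay_itv r s -> y s = phi s) -> is_solution sigma F w phi y.
Proof.
move=> [yc yd] yphi; split=> // [|t t0]; first exact: continuous_subspaceT.
apply/cvgrPdist_le => e e0.
have gc : continuous (fun t => F (sigma t w) (hist_at y t)) 
  by exact: (@rhs_continuous _ _ _ _ _ _ sigma_flow F_cont w y yc).
have := @rderiv_expand R m y (fun t => F (sigma t w) (hist_at y t)) 0 t yc gc yd t0 e e0.
move=> /nbhs_ballP[d /= d0 dP].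
apply/nbhs_ballP; exists d => //= u ud ut u0.
have ut' : u - t != 0 by rewrite subr_eq0.
have h := dP u ud u0.
have p0 : 0 < `|u - t| by rewrite normr_gt0.
rewrite -(ler_pM2l p0) -normrZ scalerBr scalerA divff// scale1r -normrN opprB.
by rewrite mulrC.
Qed.

Lemma is_solution_solves w phi y : is_solution sigma F w phi y ->
  solves sigma F w (fun u => y (Num.max u (- r))) 0.
Proof.
move=> [yc _ yd]; split.
  move=> x; set v := Num.max x (- r).
  have vr : - r <= v by rewrite le_max lexx orbT.
  have /subspace_continuousP/(_ v vr) yv := yc.
  have maxc : {for x, continuous (fun u : R => Num.max u (- r))}.
    by apply: (@continuous_max _ _ (fun x : R => x : R^o) (cst (- r))); [exact: cvg_id|exact: cvg_cst].
  move=> A /yv; rewrite /= /within/= => /maxc.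
  rewrite /= => h; apply: (@filterS _ (nbhs x) _ _ _ _ h) => u /=; apply.
  by rewrite le_max lexx orbT.
move=> t t0.
have maxE u : 0 <= u -> Num.max u (- r) = u.
  by move=> u0; rewrite max_l// (le_trans _ u0)// oppr_le0 ltW.
have -> : hist_at (fun u => y (Num.max u (- r))) t = hist_at y t :> hist r m.
  by apply: eq_hist_at => s /delay_itvE ?; rewrite max_l//; lra.
move=> e e0; have /cvgrPdist_le/(_ e e0) := yd t t0.
move=> /nbhs_ballP[d /= d0 dP].
near=> u.
have tu : t < u by near: u; exact: nbhs_right_gt.
have ud : u < t + d by near: u; apply: nbhs_right_lt; rewrite ltrDl.
have u0 : 0 <= u by rewrite (le_trans t0)// ltW.
have := dP u; rewrite /ball/= ltr_norml => /(_ _ _ u0) h.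
rewrite !maxE//.
have ut' : u - t != 0 by rewrite subr_eq0 gt_eqF.
have p0 : 0 < `|u - t| by rewrite normr_gt0.
have {}h : `|F (sigma t w) (hist_at y t) - (u - t)^-1 *: (y u - y t)| <= e.
  by apply: h; [lra|rewrite gt_eqF].
rewrite -(ler_pM2l p0) -normrZ scalerBr scalerA divff// scale1r -normrN opprB mulrC in h.
by rewrite [X in _ * X]gtr0_norm ?subr_gt0 in h.
Unshelve. all: by end_near. Qed.

Lemma sol_eq w phi y : solves sigma F w y 0 ->
  (forall s, delay_itv r s -> y s = phi s) ->
  forall t, - r <= t -> sol sigma F w phi t = y t.
Proof.
move=> ys yphi t rt.
have solP : is_solution sigma F w phi (sol sigma F w phi).
  exact: (xgetPex (cst 0) (ex_intro _ y (solves_is_solution ys yphi))).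
have ss := is_solution_solves solP.
have := @solves_unique R r m Omega sigma F r_gt0 sigma_flow F_C1 w
  (fun u => sol sigma F w phi (Num.max u (- r))) y 0 ss ys _ t.
rewrite sub0r max_l//; apply=> // s rs s0.
have sr : delay_itv r s by apply/delay_itvE.
by rewrite max_l// yphi//; case: solP => _ -> .
Qed.

Lemma sol_hist_eq w phi y : solves sigma F w y 0 ->
  (forall s, delay_itv r s -> y s = phi s) ->
  forall t, 0 <= t -> sol_hist sigma F t w phi = hist_at y t.
Proof.
move=> ys yphi t t0; apply: eq_hist_at => s /delay_itvE ?.
by apply: (sol_eq ys yphi); lra.
Qed.

End solution_operator.

(** * Existence and comparison by monotone iteration *)

Section linear_equation.
Variable R : realType.

Lemma rderivM p q s (P : R -> 'M[R]_(p, q)) (v : R -> 'M[R]_(q, s)) t P' v' :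
  rderiv P t P' -> rderiv v t v' ->
  rderiv (fun u => P u *m v u) t (P' *m v t + P t *m v').
Proof.
move=> PP' vv' e e0.
pose S : R := `|v t| + (`|P t| + 1 + `|P'|) + (1 + `|P'|) * `|v'|.
have S0 : 0 <= S by rewrite !addr_ge0// mulr_ge0// addr_ge0.
pose e1 : R := Num.min 1 (e / (q%:R * S + 1)).
have qS0 : 0 < q%:R * S + 1 by rewrite ltr_wpDl// mulr_ge0.
have e10 : 0 < e1 by rewrite lt_min ltr01 divr_gt0.
have e11 : e1 <= 1 by rewrite ge_min lexx.
have e1S : e1 * (q%:R * S) <= e.
  have : e1 <= e / (q%:R * S + 1) by rewrite ge_min lexx orbT.
  rewrite ler_pdivlMr// mulrDr mulr1; lra.
near=> u.
have tu : t < u by near: u; exact: nbhs_right_gt.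
have ue1 : u < t + e1 by near: u; apply: nbhs_right_lt; rewrite ltrDl.
have h1 : `|P u - P t - (u - t) *: P'| <= e1 * (u - t) by near: u; exact: PP'.
have h2 : `|v u - v t - (u - t) *: v'| <= e1 * (u - t) by near: u; exact: vv'.
have h0 : 0 <= u - t by lra.
have hP : `|P u - P t| <= (1 + `|P'|) * (u - t).
  rewrite -[P u - P t](subrK ((u - t) *: P')) mulrDl mul1r.
  apply: le_trans (ler_normD _ _) _; apply: lerD.
    by apply: le_trans h1 _; rewrite ler_piMl.
  by rewrite normrZ ger0_norm// mulrC.
have hPu : `|P u| <= `|P t| + 1 + `|P'|.
  rewrite -[P u](subrKC (P t)) -addrA; apply: le_trans (ler_normD _ _) _.
  rewrite lerD2l; apply: le_trans hP _; rewrite ler_piMr ?addr_ge0//; lra.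
have -> : P u *m v u - P t *m v t - (u - t) *: (P' *m v t + P t *m v') =
   (P u - P t - (u - t) *: P') *m v t + P u *m (v u - v t - (u - t) *: v')
   + (u - t) *: ((P u - P t) *m v').
  rewrite !mulmxBl !mulmxBr scalerBr -!scalemxAl -!scalemxAr scalerDr.
  by apply/matrixP => i j; rewrite !mxE; ring.
have q0 : 0 <= q%:R :> R by [].
apply: le_trans (ler_normD _ _) _.
apply: (@le_trans _ _ (e1 * (q%:R * S) * (u - t))); last by rewrite ler_wpM2r.
have -> : e1 * (q%:R * S) * (u - t) =
   (q%:R * (e1 * (u - t)) * `|v t| + q%:R * (`|P t| + 1 + `|P'|) * (e1 * (u - t))) +
   (u - t) * (q%:R * ((1 + `|P'|) * e1) * `|v'|) by rewrite /S; ring.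
apply: lerD.
  apply: le_trans (ler_normD _ _) _; apply: lerD.
    apply: le_trans (mulmx_norm_le _ _) _.
    by rewrite ler_wpM2r// ler_wpM2l.
  apply: le_trans (mulmx_norm_le _ _) _.
  by apply: ler_pM; rewrite ?mulr_ge0// ler_wpM2l.
rewrite normrZ ger0_norm// ler_wpM2l//.
apply: le_trans (mulmx_norm_le _ _) _; rewrite ler_wpM2r// ler_wpM2l//.
by apply: le_trans hP _; rewrite ler_wpM2l ?addr_ge0//; lra.
Unshelve. all: by end_near. Qed.

Lemma hist_clamp_continuous (r : R) m (phi : hist r m) : 0 < r ->
  continuous (fun t : R => phi (Num.min (Num.max t (- r)) 0)).
Proof.
move=> r0 x; pose v : R := Num.min (Num.max x (- r)) 0.
have vr (u : R) : delay_itv r (Num.min (Num.max u (- r)) 0).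
  apply/delay_itvE; split; last by rewrite ge_min lexx orbT.
  by rewrite le_min oppr_le0 (ltW r0) le_max lexx orbT.
have /subspace_continuousP/(_ v (vr x)) phic := @hist_continuous _ _ _ phi.
have maxc : {for x, continuous (fun u : R => Num.min (Num.max u (- r)) 0)}.
  apply: (@continuous_min _ _ (fun u : R => Num.max u (- r) : R^o) (cst 0)); last exact: cvg_cst.
  by apply: (@continuous_max _ _ (fun x : R => x : R^o) (cst (- r))); [exact: cvg_id|exact: cvg_cst].
move=> A /phic; rewrite /= /within/= => /maxc.
rewrite /= => h; apply: (@filterS _ (nbhs x) _ _ _ _ h) => u /=; apply.
exact: vr.
Qed.

Lemma linear_solve (r : R) m (B : 'M[R]_m) (phi : hist r m) (g : R -> 'cV[R]_m) :
  0 < r -> continuous g -> exists z : R -> 'cV[R]_m, [/\ continuous z,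
    forall t, t <= 0 -> z t = phi (Num.max t (- r)) &
    forall t, 0 <= t -> rderiv z t (B *m z t + g t)].
Proof.
move=> r0 gc.
have mE : continuous (fun t : R => expmx ((- t) *: B) *m g t).
  move=> t; apply: cvg_mxM; last exact: gc.
  apply: (@cvg_comp _ _ _ (fun u : R => - u) (fun s : R => expmx (s *: B)) _ (nbhs (- t))).
    by apply: cvgN; exact: cvg_id.
  exact: expmx_continuous.
have [W [Wc W0 Wd]] := continuous_primitive mE.
pose p t := phi (Num.min (Num.max t (- r)) 0).
have max0c x : {for x, continuous (fun u : R => Num.max u 0)}.
  by apply: (@continuous_max _ _ (fun x : R => x : R^o) (cst 0)); [exact: cvg_id|exact: cvg_cst].
have pE t : 0 <= t -> p t = phi 0.
  by move=> t0; rewrite /p min_r// le_max t0.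
exists (fun t => expmx (Num.max t 0 *: B) *m (p t + W (Num.max t 0))); split.
- move=> x; apply: cvg_mxM.
    apply: (@cvg_comp _ _ _ (fun u : R => Num.max u 0) (fun s : R => expmx (s *: B)) _ (nbhs (Num.max x 0))).
      exact: max0c.
    exact: expmx_continuous.
  apply: cvgD; first exact: hist_clamp_continuous.
  apply: (@cvg_comp _ _ _ (fun u : R => Num.max u 0) W _ (nbhs (Num.max x 0))).
    exact: max0c.
  exact: Wc.
- move=> t t0; rewrite (max_r t0) expmx0 mul1mx W0 addr0 /p min_l//.
  by rewrite ge_max t0 oppr_le0 ltW.
- move=> t t0.
  have zd : rderiv (fun u : R => expmx (u *: B) *m (phi 0 + W u)) t
     (B *m expmx (t *: B) *m (phi 0 + W t) + expmx (t *: B) *m (expmx ((- t) *: B) *m g t)).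
    apply: rderivM; first exact: expmx_rderiv.
    move=> e e0; apply: filterS (Wd t t0 e e0) => u.
    by rewrite opprD addrACA subrr add0r.
  rewrite !mulmxA expmxN mul1mx in zd.
  rewrite (max_l t0) pE// mulmxA.
  move=> e e0; apply: filterS2 (nbhs_right_gt t) (zd e e0) => u tu.
  have u0 : 0 <= u by rewrite (le_trans t0)// ltW.
  by rewrite (max_l u0) (max_l t0) !pE.
Qed.

End linear_equation.

Section hist_at_algebra.
Context {R : realType} {r : R} {m : nat}.
Implicit Types (y z : R -> 'cV[R]_m).

Lemma hist_atB y z t (k : R) : continuous y -> continuous z ->
  hist_at (fun u => y u - k *: z u) t = hist_at y t - k *: hist_at z t :> hist r m.
Proof.
move=> yc zc; apply: histP => s sr.
have c : continuous (fun u => y u - k *: z u).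
  by move=> u; apply: cvgB; [exact: yc|apply: cvgZl_tmp; exact: zc].
rewrite hist_atE//.
rewrite -[RHS]/((hist_at y t : hist r m) s - k *: (hist_at z t : hist r m) s).
by rewrite !hist_atE.
Qed.

Lemma hist_at_now y t : 0 < r -> continuous y -> (hist_at y t : hist r m) 0 = y t.
Proof.
by move=> r0 yc; rewrite hist_atE ?addr0//; apply/delay_itvE; rewrite oppr_le0 ltW.
Qed.

Lemma bounded_set_hist_at (y : R -> 'cV[R]_m) (M T : R) : continuous y ->
  (forall t, t <= T -> `|y t| <= M) -> 0 <= M ->
  forall t, t <= T -> `|hist_at y t : hist r m| <= M.
Proof.
move=> yc yM M0 t tT; apply: hist_norm_le => // s sr; rewrite hist_atE//.
by move/delay_itvE : sr => ?; apply: yM; lra.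
Qed.

End hist_at_algebra.

Section iteration.
Context {R : realType} {r : R} {m : nat} {Omega : metricType R}.
Variables (sigma : R -> Omega -> Omega) (B : 'M[R]_m)
  (F : Omega -> hist r m -> 'cV[R]_m).
Context (r_gt0 : 0 < r) (sigma_flow : is_flow sigma)
  (B_quasipos : quasipositive B)
  (F_cont : continuous (fun p : Omega * hist r m => F p.1 p.2))
  (F_bdd : forall X1 : set (hist r m), bounded_set X1 ->
     bounded_set [set F p.1 p.2 | p in [set: Omega] `*` X1])
  (F_mono : forall (w : Omega) (phi psi : hist r m), leB B phi psi ->
     vle (B *m (psi 0 - phi 0)) (F w psi - F w phi))
  (F_sublin : forall (w : Omega) (psi : hist r m) (l : R),
     leB B 0 psi -> 0 <= l -> l <= 1 ->
     vle (l *: F w psi) (F w (l *: psi))).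
Implicit Types (w : Omega) (y z : R -> 'cV[R]_m) (phi chi psi : hist r m) (t : R).

Definition lin_sol phi (g : R -> 'cV[R]_m) : R -> 'cV[R]_m :=
  xget (cst 0) [set z | [/\ continuous z,
    forall t, t <= 0 -> z t = phi (Num.max t (- r)) &
    forall t, 0 <= t -> rderiv z t (B *m z t + g t)]].

Lemma lin_solP phi g : continuous g -> [/\ continuous (lin_sol phi g),
    forall t, t <= 0 -> lin_sol phi g t = phi (Num.max t (- r)) &
    forall t, 0 <= t -> rderiv (lin_sol phi g) t (B *m lin_sol phi g t + g t)].
Proof. by move=> gc; exact: (xgetPex (cst 0) (linear_solve B phi r_gt0 gc)). Qed.

(* The inhomogeneity F y_n - B y_n increases with y_n in the order <=_B, so that
   the iterates increase; no Lipschitz bound on F is needed for existence. *)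
Fixpoint iter_sol w phi (n : nat) : R -> 'cV[R]_m :=
  if n is k.+1 then lin_sol phi (fun t =>
    F (sigma t w) (hist_at (iter_sol w phi k) t) - B *m iter_sol w phi k t)
  else lin_sol phi (cst 0).

Definition iter_rhs w phi n : R -> 'cV[R]_m :=
  if n is k.+1 then fun t =>
    F (sigma t w) (hist_at (iter_sol w phi k) t) - B *m iter_sol w phi k t
  else cst 0.

Lemma iter_rhs_continuous w phi n : continuous (iter_rhs w phi n).
Proof.
elim: n => [|n IH]; first by move=> t; exact: cvg_cst.
have yc : continuous (iter_sol w phi n).
  by case: n IH => [|n] IH; have [] := lin_solP phi IH.
move=> t; apply: cvgB; first exact: (@rhs_continuous _ _ _ _ _ _ sigma_flow F_cont w _ yc).
by apply: cvg_mxM; [exact: cvg_cst|exact: yc].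
Qed.

Lemma iter_solP w phi n : [/\ continuous (iter_sol w phi n),
    forall t, t <= 0 -> iter_sol w phi n t = phi (Num.max t (- r)) &
    forall t, 0 <= t ->
      rderiv (iter_sol w phi n) t (B *m iter_sol w phi n t + iter_rhs w phi n t)].
Proof.
have := lin_solP phi (@iter_rhs_continuous w phi n).
by case: n.
Qed.

Lemma iter_sol_continuous w phi n : continuous (iter_sol w phi n).
Proof. by have [] := iter_solP w phi n. Qed.

Lemma iter_sol_rderiv w phi n t : 0 <= t ->
  rderiv (iter_sol w phi n) t (B *m iter_sol w phi n t + iter_rhs w phi n t).
Proof. by have [_ _] := iter_solP w phi n; exact. Qed.

Lemma iter_sol_init w phi n : hist_at (iter_sol w phi n) 0 = phi :> hist r m.
Proof.
apply: histP => s sr; rewrite hist_atE//; last exact: iter_sol_continuous.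
have [_ h _] := iter_solP w phi n.
by have /delay_itvE[rs s0] := sr; rewrite add0r h// max_l.
Qed.

Lemma coneB_nonneg_rhs w psi : coneB B psi -> vle 0 (F w psi - B *m psi 0).
Proof.
move=> cpsi i.
have := F_mono w ((leB0 B psi).2 cpsi) i.
have := @F_sublin w 0 0 (leB_refl B 0) (lexx _) ler01 i.
rewrite scale0r scaler0 [(0 : hist r m) 0]/(0 : 'cV[R]_m) subr0.
by move: (B *m psi 0) => v; rewrite !mxE; lra.
Qed.

Lemma linear_cone phi y (g : R -> 'cV[R]_m) : continuous y ->
  (forall t, 0 <= t -> rderiv y t (B *m y t + g t)) ->
  hist_at y 0 = phi -> coneB B phi -> (forall t, 0 <= t -> vle 0 (g t)) ->
  forall t, 0 <= t -> coneB B (hist_at y t : hist r m).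
Proof.
move=> yc yd y0 cphi g0 t t0.
apply: (coneB_propagate B_quasipos t0 yc); first by rewrite y0.
move=> s s0 _; apply: rderiv_subsol (yd s s0) _ => i.
have := g0 s s0 i; move: (B *m y s) (g s) => v u; rewrite !mxE; lra.
Qed.

Lemma linear_compare phi chi l y z (g h : R -> 'cV[R]_m) :
  continuous y -> continuous z ->
  (forall t, 0 <= t -> rderiv y t (B *m y t + g t)) ->
  (forall t, 0 <= t -> rderiv z t (B *m z t + h t)) ->
  hist_at y 0 = phi -> hist_at z 0 = chi -> leB B (l *: phi) chi ->
  (forall t, 0 <= t -> vle (l *: g t) (h t)) ->
  forall t, 0 <= t -> leB B (l *: hist_at y t) (hist_at z t : hist r m).
Proof.
move=> yc zc yd zd y0 z0 lphichi gh t t0.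
have zyc : continuous (fun u => z u - l *: y u).
  by move=> u; apply: cvgB; [exact: zc|apply: cvgZl_tmp; exact: yc].
rewrite /leB -hist_atB//.
apply: (@linear_cone (chi - l *: phi) _ (fun t => h t - l *: g t)) => //.
- move=> s s0.
  have <- : B *m z s + h s - l *: (B *m y s + g s) =
      B *m (z s - l *: y s) + (h s - l *: g s).
    by rewrite mulmxBr -scalemxAr scalerDr opprD addrACA.
  exact: rderivB (zd s s0) (rderivZ l (yd s s0)).
- by rewrite hist_atB// y0 z0.
- move=> s s0 i; have := gh s s0 i; move: (g s) (h s) => v u; rewrite !mxE; lra.
Qed.

Lemma iter_sol_compare w phi chi l n : coneB B phi ->
  0 <= l -> l <= 1 -> leB B (l *: phi) chi -> forall t, 0 <= t ->
  coneB B (hist_at (iter_sol w phi n) t : hist r m) /\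
  leB B (l *: hist_at (iter_sol w phi n) t) (hist_at (iter_sol w chi n) t : hist r m).
Proof.
move=> cphi l0 l1 lphichi.
have cone_y k : (forall t, 0 <= t -> vle 0 (iter_rhs w phi k t)) ->
    forall t, 0 <= t -> coneB B (hist_at (iter_sol w phi k) t : hist r m).
  exact: (linear_cone (@iter_sol_continuous w phi k) (@iter_sol_rderiv w phi k)
    (iter_sol_init w phi k) cphi).
have cmp k : (forall t, 0 <= t -> vle (l *: iter_rhs w phi k t) (iter_rhs w chi k t)) ->
    forall t, 0 <= t -> leB B (l *: hist_at (iter_sol w phi k) t)
      (hist_at (iter_sol w chi k) t : hist r m).
  exact: (linear_compare (@iter_sol_continuous w phi k) (@iter_sol_continuous w chi k)
    (@iter_sol_rderiv w phi k) (@iter_sol_rderiv w chi k)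
    (iter_sol_init w phi k) (iter_sol_init w chi k) lphichi).
elim: n => [|n IH] t t0.
  split; [apply: cone_y|apply: cmp] => // s _ i; first by [].
  by rewrite /iter_rhs /= scaler0.
have yE s : (hist_at (iter_sol w phi n) s : hist r m) 0 = iter_sol w phi n s.
  by apply: hist_at_now => //; exact: iter_sol_continuous.
have zE s : (hist_at (iter_sol w chi n) s : hist r m) 0 = iter_sol w chi n s.
  by apply: hist_at_now => //; exact: iter_sol_continuous.
split; [apply: cone_y|apply: cmp] => // s s0 i.
  have [cy _] := IH s s0; have := coneB_nonneg_rhs (sigma s w) cy i.
  by rewrite yE.
have [cy lyz] := IH s s0.
have := F_mono (sigma s w) lyz i.
have := F_sublin (sigma s w) ((leB0 B _).2 cy) l0 l1 i.
rewrite /iter_rhs -yE -zE.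
move: (hist_at (iter_sol w phi n) s) (hist_at (iter_sol w chi n) s) => p q.
rewrite -[(l *: p : hist r m) 0]/(l *: p 0) mulmxBr -scalemxAr.
move: (F _ p) (F _ (l *: p)) (F _ q) (B *m p 0) (B *m q 0) => f1 f2 f3 v1 v2.
by rewrite !mxE; lra.
Qed.

End iteration.

Section iteration_bounds.
Context {R : realType} {r : R} {m : nat} {Omega : metricType R}.
Variables (sigma : R -> Omega -> Omega) (B : 'M[R]_m)
  (F : Omega -> hist r m -> 'cV[R]_m).
Context (r_gt0 : 0 < r) (sigma_flow : is_flow sigma)
  (B_quasipos : quasipositive B)
  (F_cont : continuous (fun p : Omega * hist r m => F p.1 p.2))
  (F_bdd : forall X1 : set (hist r m), bounded_set X1 ->
     bounded_set [set F p.1 p.2 | p in [set: Omega] `*` X1])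
  (F_mono : forall (w : Omega) (phi psi : hist r m), leB B phi psi ->
     vle (B *m (psi 0 - phi 0)) (F w psi - F w phi))
  (F_sublin : forall (w : Omega) (psi : hist r m) (l : R),
     leB B 0 psi -> 0 <= l -> l <= 1 ->
     vle (l *: F w psi) (F w (l *: psi))).
Implicit Types (w : Omega) (y z : R -> 'cV[R]_m) (phi chi psi : hist r m) (t : R).
Local Notation it := (iter_sol sigma B F).

Lemma F_bounded_ball (M : R) : exists2 C : R, 0 < C &
  forall w psi, `|psi| <= M -> `|F w psi| <= C.
Proof.
have := @F_bdd [set psi | `|psi| <= M].
case.
  by exists M; split; [exact: num_real|move=> N MN psi /= /le_trans; apply; exact: ltW].
move=> C [Cr CP]; exists (`|C| + 1); first by rewrite ltr_wpDl.
move=> w psi pM; apply: (CP (`|C| + 1)).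
  by rewrite (le_lt_trans (ler_norm _))// ltrDl.
by exists (w, psi).
Qed.

Lemma F_linear_growth : exists2 C : R, 0 < C &
  forall w psi, coneB B psi -> forall i, F w psi i 0 <= C * (1 + `|psi|).
Proof.
have [C C0 CP] := F_bounded_ball 1.
exists C => // w psi cpsi i.
have coord psi' : `|psi'| <= 1 -> F w psi' i 0 <= C.
  move=> h; apply: le_trans (ler_norm _) _.
  by apply: le_trans (mx_norm_coord_le _ _ _) _; exact: CP.
have [p1|p1] := leP `|psi| 1.
  apply: le_trans (coord _ p1) _.
  by rewrite ler_peMr ?(ltW C0)// lerDl.
have p0 : 0 < `|psi| by apply: lt_trans p1.
have := @F_sublin w psi `|psi|^-1 ((leB0 B psi).2 cpsi).
rewrite invr_ge0 normr_ge0 invf_le1// (ltW p1) => /(_ isT isT i).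
have := coord (`|psi|^-1 *: psi).
rewrite normrZ ger0_norm ?invr_ge0// mulVf ?gt_eqF// => /(_ (lexx _)) h1.
rewrite mxE => h2; have := le_trans h2 h1.
rewrite mulrC ler_pdivrMr// => /le_trans; apply.
by rewrite ler_wpM2l ?(ltW C0)// lerDr.
Qed.

Lemma linear_upper_bound (k b D : R) y (g : R -> 'cV[R]_m) :
  0 <= k -> m%:R * `|B| <= b -> 0 <= D -> continuous y ->
  (forall t, 0 <= t -> rderiv y t (B *m y t + g t)) -> `|y 0| <= D ->
  forall t, 0 <= t ->
  (forall s, 0 <= s -> s < t -> forall i, g s i 0 <= (k - b) * (D * expR (k * s))) ->
  forall i, y t i 0 <= D * expR (k * t).
Proof.
move=> k0 bB D0 yc yd y0 t t0 gM i.
pose M t := D * expR (k * t).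
have M0 s : 0 <= M s by rewrite mulr_ge0// expR_ge0.
have Md s : rderiv (fun u => M u : R^o) s (k * M s).
  apply: is_derive_rderiv; rewrite /M.
  have d : is_derive s (1 : R) (fun u : R => expR (k * u)) (expR (k * s) * k).
    apply: (@is_derive1_comp _ expR (fun u : R => k * u)).
    have -> : (fun u : R => k * u) = k \*: (id : R -> R^o) by [].
    by apply: is_derive_eq; rewrite /GRing.scale/= mulr1.
  have -> : (fun u : R => D * expR (k * u)) = D \*: (fun u : R => expR (k * u) : R^o) by [].
  by apply: is_derive_eq; rewrite /GRing.scale/=; ring.
have Mc : continuous (fun u : R => M u).
  move=> s; apply: cvgM; first exact: cvg_cst.
  apply: (@cvg_comp _ _ _ (fun u : R => k * u) expR _ (nbhs (k * s))).
    by apply: cvgM; [exact: cvg_cst|exact: cvg_id].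
  exact: continuous_expR.
have Mvd u : rderiv (fun u => const_mx (M u) : 'cV[R]_m) u (const_mx (k * M u)).
  move=> e e0; apply: filterS2 (nbhs_right_gt u) (Md u e e0) => v uv h.
  apply/mx_norm_leP => [|j l]; last by rewrite !mxE.
  by rewrite mulr_ge0 ?(ltW e0)// subr_ge0 ltW.
have Mvc : continuous (fun u => const_mx (M u) : 'cV[R]_m).
  by move=> u; apply: cvg_mx_coord => j l; rewrite mxE; under eq_fun do rewrite mxE; exact: Mc.
pose z u : 'cV[R]_m := const_mx (M u) - y u.
have zc : continuous z by move=> u; apply: cvgB; [exact: Mvc|exact: yc].
have zd u : 0 <= u -> u < t -> subsol_at B z u.
  move=> u0 ut; apply: rderiv_subsol (rderivB (Mvd u) (yd u u0)) _ => j.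
  have : (B *m const_mx (M u) : 'cV[R]_m) j 0 <= b * M u.
    apply: le_trans (ler_norm _) _; apply: le_trans (mx_norm_coord_le _ _ _) _.
    apply: le_trans (mulmx_norm_le _ _) _; apply: ler_pM => //.
    by apply/mx_norm_leP => // ? ?; rewrite mxE ger0_norm.
  have := gM u u0 ut j; rewrite -/(M u) /z mulmxBr.
  move: (B *m y u) (B *m const_mx (M u) : 'cV[R]_m) => v v'.
  by rewrite !mxE mulrBl; lra.
have := expmx_subsol B_quasipos t0 zc zd i.
have : 0 <= (expmx ((t - 0) *: B) *m z 0) i 0.
  rewrite mxE sumr_ge0// => j _; rewrite mulr_ge0//.
    by apply: expmx_quasipositive; rewrite ?subr0.
  rewrite !mxE subr_ge0 /M mulr0 expR0 mulr1; apply: le_trans y0.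
  by apply: le_trans (ler_norm _) _; exact: mx_norm_coord_le.
by move: (_ *m z 0) => v; rewrite /z !mxE -/(M t); lra.
Qed.

Lemma iter_sol_past w phi n t : t <= 0 -> `|it w phi n t| <= `|phi|.
Proof.
move=> t0; have [_ h _] := iter_solP B r_gt0 sigma_flow F_cont w phi n.
rewrite h//; apply: hist_norm_ge; apply/delay_itvE; split.
  by rewrite le_max lexx orbT.
by rewrite ge_max t0 oppr_le0 ltW.
Qed.

Lemma iter_sol_bounded w phi (T : R) : coneB B phi -> exists2 M : R, 0 <= M &
  forall n t, t <= T -> `|it w phi n t| <= M.
Proof.
move=> cphi; have [C C0 CP] := F_linear_growth.
pose b := m%:R * `|B|.
have b0 : 0 <= b by rewrite mulr_ge0.
pose k := 2 * C + 2 * b.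
have k0 : 0 <= k by rewrite addr_ge0 ?mulr_ge0// ltW.
pose D := `|phi| + 1.
have D1 : 1 <= D by rewrite lerDr.
have D0 : 0 <= D by apply: le_trans D1.
have Dphi : `|phi| <= D by rewrite lerDl.
have Mmono s t : s <= t -> D * expR (k * s) <= D * expR (k * t).
  by move=> st; rewrite ler_wpM2l// ler_expR ler_wpM2l.
have MD t : 0 <= t -> D <= D * expR (k * t).
  by move=> t0; have := Mmono _ _ t0; rewrite mulr0 expR0 mulr1.
have yc n : continuous (it w phi n) by exact: iter_sol_continuous.
have cone n t : 0 <= t -> coneB B (hist_at (it w phi n) t : hist r m).
  have c0 : leB B (0 *: phi) phi by rewrite scale0r; exact/leB0.
  by move=> /(iter_sol_compare r_gt0 sigma_flow B_quasipos F_cont F_mono F_sublin w n cphi (lexx 0) ler01 c0)[].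
have norm_le n t : 0 <= t -> (forall i, it w phi n t i 0 <= D * expR (k * t)) ->
    `|it w phi n t| <= D * expR (k * t).
  move=> t0 H; apply/mx_norm_leP => [|i j]; first by rewrite mulr_ge0 ?expR_ge0.
  rewrite ord1 ger0_norm//.
  have [h _] := cone n t t0; have := h 0 (hist0 r_gt0) i.
  by rewrite hist_at_now// mxE.
have main n t : 0 <= t -> `|it w phi n t| <= D * expR (k * t).
  elim: n t => [|n IH] t t0; apply: norm_le => //.
    apply: (@linear_upper_bound k b D (it w phi 0) (iter_rhs sigma B F w phi 0)) => //.
    - by move=> s s0; exact: iter_sol_rderiv.
    - by apply: le_trans Dphi; exact: iter_sol_past.
    - move=> s s0 _ i; rewrite /iter_rhs /cst mxE mulr_ge0//.
        by rewrite /k; lra.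
      by rewrite mulr_ge0// expR_ge0.
  apply: (@linear_upper_bound k b D (it w phi n.+1) (iter_rhs sigma B F w phi n.+1)) => //.
  - by move=> s s0; exact: iter_sol_rderiv.
  - by apply: le_trans Dphi; exact: iter_sol_past.
  - move=> s s0 st i; rewrite /iter_rhs.
    set N := D * expR (k * s).
    have N1 : 1 <= N by apply: le_trans D1 _; exact: MD.
    have hN : `|hist_at (it w phi n) s : hist r m| <= N.
      apply: bounded_set_hist_at (lexx s) => //; last by apply: le_trans N1.
      move=> u us; have [u0|/ltW u0] := leP u 0.
        apply: le_trans (iter_sol_past _ _ _ u0) _; apply: le_trans Dphi _; exact: MD.
      by apply: le_trans (IH u u0) _; exact: Mmono.
    have h1 := CP (sigma s w) _ (cone n s s0) i.
    have h2 : `|(B *m it w phi n s) i 0| <= b * N.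
      apply: le_trans (mx_norm_coord_le _ _ _) _; apply: le_trans (mulmx_norm_le _ _) _.
      by rewrite ler_wpM2l//; exact: IH.
    have h3 : C * (1 + `|hist_at (it w phi n) s : hist r m|) <= C * (N + N).
      by rewrite ler_wpM2l ?(ltW C0)//; lra.
    move: h1 h2 h3; move: (F _ _) (B *m it w phi n s) => f v h1.
    rewrite !mxE ler_norml => /andP[h2 _] h3.
    have -> : (k - b) * N = C * (N + N) + b * N by rewrite /k; ring.
    by lra.
exists (D * expR (k * Num.max T 0)); first by rewrite mulr_ge0// expR_ge0.
move=> n t tT; have [t0|/ltW t0] := leP t 0.
  apply: le_trans (iter_sol_past _ _ _ t0) _; apply: le_trans Dphi _.
  by apply: MD; rewrite le_max lexx orbT.
by apply: le_trans (main n t t0) _; apply: Mmono; rewrite le_max tT.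
Qed.

End iteration_bounds.

Lemma equilip_cvg_uniform (R : realType) (V : normedModType R) (u : nat -> R -> V)
    (Y : R -> V) (K T : R) : 0 <= K ->
  (forall n s t, 0 <= s -> s <= t -> t <= T -> `|u n t - u n s| <= K * (t - s)) ->
  (forall t, u n t @[n --> \oo] --> Y t) ->
  forall e, 0 < e -> \forall n \near \oo,
    forall t, 0 <= t -> t <= T -> `|Y t - u n t| <= e.
Proof.
move=> K0 uK uY e e0.
have uK' n s t : `[0, T]%classic s -> `[0, T]%classic t ->
    `|u n t - u n s| <= K * `|t - s|.
  rewrite /= !in_itv/= => /andP[s0 sT] /andP[t0 tT]; have [st|/ltW ts] := leP s t.
    by rewrite [X in _ * X]ger0_norm ?subr_ge0// uK.
  by rewrite distrC [`|t - s|]distrC [X in _ * X]ger0_norm ?subr_ge0// uK.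
have YK s t : `[0, T]%classic s -> `[0, T]%classic t -> `|Y t - Y s| <= K * `|t - s|.
  move=> sT tT.
  have h : `|u n t - u n s| @[n --> \oo] --> `|Y t - Y s|.
    by apply: cvg_norm; apply: cvgB; exact: uY.
  rewrite -(cvg_lim _ h)//; apply: limr_le; first by apply/cvg_ex; exists `|Y t - Y s|.
  by apply: nearW => n; exact: uK'.
have /compact_near_coveringP/near_covering_withinP cT := @segment_compact _ (0:R) T.
have d0 : 0 < e / (3 * (K + 1)) by rewrite divr_gt0// mulr_gt0// ltr_wpDl.
have Kd x : x < e / (3 * (K + 1)) -> K * x <= e / 3.
  move=> xd; apply: (@le_trans _ _ (K * (e / (3 * (K + 1))))).
    by rewrite ler_wpM2l// ltW.
  rewrite mulrA ler_pdivrMr ?mulr_gt0// ?ltr_wpDl//.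
  have -> : e / 3 * (3 * (K + 1)) = K * e + e by field.
  by rewrite lerDl ltW.
have /cT H : forall x, `[0, T]%classic x -> \forall x' \near x & n \near \oo,
    `[0, T]%classic x' -> `|Y x' - u n x'| <= e.
  move=> x xT.
  have /cvgrPdist_le/(_ (e / 3)) := uY x; rewrite divr_gt0// => /(_ isT) Nx.
  exists (ball x (e / (3 * (K + 1))), [set n | `|Y x - u n x| <= e / 3]).
    by split=> //; exact: nbhsx_ballx.
  move=> [x' n] [/= xx' h] x'T.
  have h1 : `|Y x' - Y x| <= e / 3.
    by apply: le_trans (YK _ _ xT x'T) _; rewrite distrC; exact: Kd.
  have h2 : `|u n x - u n x'| <= e / 3.
    by apply: le_trans (uK' n _ _ x'T xT) _; exact: Kd.
  have -> : Y x' - u n x' = (Y x' - Y x) + (Y x - u n x) + (u n x - u n x').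
    by rewrite !addrA !subrK.
  apply: le_trans (ler_normD _ _) _.
  have := ler_normD (Y x' - Y x) (Y x - u n x); lra.
apply: filterS H => n Hn t t0 tT; apply: Hn.
by rewrite /= in_itv/= t0.
Qed.

Section iteration_limit.
Context {R : realType} {r : R} {m : nat} {Omega : metricType R}.
Variables (sigma : R -> Omega -> Omega) (B : 'M[R]_m)
  (F : Omega -> hist r m -> 'cV[R]_m).
Context (r_gt0 : 0 < r) (sigma_flow : is_flow sigma)
  (B_quasipos : quasipositive B)
  (F_cont : continuous (fun p : Omega * hist r m => F p.1 p.2))
  (F_bdd : forall X1 : set (hist r m), bounded_set X1 ->
     bounded_set [set F p.1 p.2 | p in [set: Omega] `*` X1])
  (F_mono : forall (w : Omega) (phi psi : hist r m), leB B phi psi ->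
     vle (B *m (psi 0 - phi 0)) (F w psi - F w phi))
  (F_sublin : forall (w : Omega) (psi : hist r m) (l : R),
     leB B 0 psi -> 0 <= l -> l <= 1 ->
     vle (l *: F w psi) (F w (l *: psi))).
Implicit Types (w : Omega) (y z : R -> 'cV[R]_m) (phi chi psi : hist r m) (t : R).
Local Notation it := (iter_sol sigma B F).

Lemma iter_sol_cone w phi n t : coneB B phi -> 0 <= t ->
  coneB B (hist_at (it w phi n) t : hist r m).
Proof.
move=> cphi.
have c0 : leB B (0 *: phi) phi by rewrite scale0r; exact/leB0.
by move=> /(iter_sol_compare r_gt0 sigma_flow B_quasipos F_cont F_mono F_sublin w n cphi (lexx 0) ler01 c0)[].
Qed.

Lemma iter_sol_incr w phi n t : coneB B phi -> 0 <= t ->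
  leB B (hist_at (it w phi n) t) (hist_at (it w phi n.+1) t : hist r m).
Proof.
move=> cphi.
have nowE k s : (hist_at (it w phi k) s : hist r m) 0 = it w phi k s.
  by apply: hist_at_now => //; exact: iter_sol_continuous.
have cmp k : (forall t, 0 <= t ->
      vle (1 *: iter_rhs sigma B F w phi k t) (iter_rhs sigma B F w phi k.+1 t)) ->
    forall t, 0 <= t -> leB B (1 *: hist_at (it w phi k) t)
      (hist_at (it w phi k.+1) t : hist r m).
  apply: (linear_compare B_quasipos (phi := phi) (chi := phi)).
  - exact: iter_sol_continuous.
  - exact: iter_sol_continuous.
  - by move=> s; exact: iter_sol_rderiv.
  - by move=> s; exact: iter_sol_rderiv.
  - exact: iter_sol_init.
  - exact: iter_sol_init.
  - by rewrite scale1r; exact: leB_refl.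
elim: n t => [|n IH] t t0; rewrite -[X in leB _ X]scale1r; apply: cmp => // s s0 i; rewrite scale1r.
  have := coneB_nonneg_rhs F_mono F_sublin (sigma s w) (iter_sol_cone w 0 cphi s0) i.
  by rewrite nowE.
have := F_mono (sigma s w) (IH s s0) i; rewrite !nowE /iter_rhs mulmxBr.
move: (F _ _) (F _ _) (B *m _) (B *m _) => f1 f2 v1 v2; rewrite !mxE; lra.
Qed.

Lemma iter_sol_lip w phi (T : R) : coneB B phi -> exists2 K : R, 0 <= K &
  forall n s t, 0 <= s -> s <= t -> t <= T ->
    `|it w phi n t - it w phi n s| <= K * (t - s).
Proof.
move=> cphi.
have [M M0 MP] := iter_sol_bounded r_gt0 sigma_flow B_quasipos F_cont F_bdd F_mono F_sublin w T cphi.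
have [C C0 CP] := F_bounded_ball F_bdd M.
pose b := m%:R * `|B|.
have b0 : 0 <= b by rewrite mulr_ge0.
have BM n t : t <= T -> `|B *m it w phi n t| <= b * M.
  by move=> tT; apply: le_trans (mulmx_norm_le _ _) _; rewrite ler_wpM2l// MP.
have bM0 : 0 <= b * M by rewrite mulr_ge0.
exists (b * M + (C + b * M)); first by rewrite !addr_ge0// ltW.
move=> n s t s0 st tT.
have := @rderiv_mean_le R m 1 (it w phi n)
  (fun u => B *m it w phi n u + iter_rhs sigma B F w phi n u) s t (b * M + (C + b * M)) 0 st.
rewrite scaler0 subr0; apply.
- by rewrite !addr_ge0// ltW.
- exact: iter_sol_continuous.
move=> u su ut; have u0 := le_trans s0 su; have uT := le_trans (ltW ut) tT.
split; first exact: iter_sol_rderiv.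
rewrite subr0; apply: le_trans (ler_normD _ _) _; apply: lerD; first exact: BM.
case: n => [|n]; first by rewrite normr0 addr_ge0// ltW.
apply: le_trans (ler_normB _ _) _; apply: lerD; last exact: BM.
apply: CP; apply: bounded_set_hist_at uT => //; first exact: iter_sol_continuous.
by move=> v; exact: MP.
Qed.

Definition iter_lim w phi t : 'cV[R]_m := \col_i limn (fun n => it w phi n t i 0).

Lemma iter_sol_cvg w phi t : coneB B phi -> it w phi n t @[n --> \oo] --> iter_lim w phi t.
Proof.
move=> cphi; apply: cvg_mx_coord => i j; rewrite ord1 mxE {j}.
have [M M0 MP] := iter_sol_bounded r_gt0 sigma_flow B_quasipos F_cont F_bdd F_mono F_sublin w t cphi.
apply: nondecreasing_is_cvgn; last first.
  exists M => _ [n _ <-]; apply: le_trans (ler_norm _) _.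
  by apply: le_trans (mx_norm_coord_le _ _ _) _; exact: MP.
apply/nondecreasing_seqP => n.
have [t0|/ltW t0] := leP t 0.
  have h k : it w phi k t = phi (Num.max t (- r)).
    by have [_ -> //] := iter_solP B r_gt0 sigma_flow F_cont w phi k.
  by rewrite !h.
have [h _] := iter_sol_incr w n cphi t0.
have := h 0 (hist0 r_gt0) i.
rewrite -[(_ - _ : hist r m) 0]/((hist_at (it w phi n.+1) t : hist r m) 0 - (hist_at (it w phi n) t : hist r m) 0).
by rewrite !hist_at_now//; [rewrite !mxE subr_ge0|exact: iter_sol_continuous..].
Qed.

Lemma iter_lim_past w phi t : coneB B phi -> t <= 0 -> iter_lim w phi t = phi (Num.max t (- r)).
Proof.
move=> cphi t0; have := @iter_sol_cvg w phi t cphi.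
have -> : (fun n => it w phi n t) = cst (phi (Num.max t (- r))).
  apply/funext => k.
  by have [_ -> //] := iter_solP B r_gt0 sigma_flow F_cont w phi k.
move=> h; apply: (cvg_unique _ h); first exact: norm_hausdorff.
exact: cvg_cst.
Qed.

Lemma iter_lim_uniform w phi (T e : R) : coneB B phi -> 0 < e -> \forall n \near \oo,
  forall t, t <= T -> `|iter_lim w phi t - it w phi n t| <= e.
Proof.
move=> cphi e0; have [K K0 KP] := iter_sol_lip w T cphi.
have := equilip_cvg_uniform K0 KP (fun t => @iter_sol_cvg w phi t cphi) e0.
apply: filterS => n H t tT; have [t0|/ltW t0] := leP t 0; last exact: H.
rewrite iter_lim_past//.
have [_ -> //] := iter_solP B r_gt0 sigma_flow F_cont w phi n.
by rewrite subrr normr0 ltW.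
Qed.

Lemma iter_lim_continuous w phi : coneB B phi -> continuous (iter_lim w phi).
Proof.
move=> cphi t; apply/cvgrPdist_le => e e0.
have e30 : 0 < e / 3 by rewrite divr_gt0.
have [n Hn] := filter_ex (iter_lim_uniform w (t + 1) cphi e30).
have /cvgrPdist_le/(_ _ e30) := @iter_sol_continuous _ _ _ _ sigma B F r_gt0 sigma_flow F_cont w phi n t.
move=> /nbhs_ballP[d /= d0 dP].
apply/nbhs_ballP; exists (Num.min d 1); first by rewrite /= lt_min d0 ltr01.
move=> u; rewrite /ball/= lt_min => /andP[ud u1].
have ut : u <= t + 1 by move: u1; rewrite ltr_norml; lra.
have h1 := Hn u ut; have h2 := Hn t (_ : t <= t + 1).
have {}h2 := h2 (ltW (ltr_pwDr ltr01 (lexx t))).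
have h3 := dP u ud.
have -> : iter_lim w phi t - iter_lim w phi u =
   (iter_lim w phi t - it w phi n t) + (it w phi n t - it w phi n u) + (it w phi n u - iter_lim w phi u).
  by rewrite !addrA !subrK.
apply: le_trans (ler_normD _ _) _; rewrite distrC in h1.
have := ler_normD (iter_lim w phi t - it w phi n t) (it w phi n t - it w phi n u); lra.
Qed.

End iteration_limit.

Section existence.
Context {R : realType} {r : R} {m : nat} {Omega : metricType R}.
Variables (sigma : R -> Omega -> Omega) (B : 'M[R]_m)
  (F : Omega -> hist r m -> 'cV[R]_m).
Context (r_gt0 : 0 < r) (sigma_flow : is_flow sigma)
  (B_quasipos : quasipositive B)
  (F_cont : continuous (fun p : Omega * hist r m => F p.1 p.2))
  (F_C1 : C1_snd F)
  (F_bdd : forall X1 : set (hist r m), bounded_set X1 ->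
     bounded_set [set F p.1 p.2 | p in [set: Omega] `*` X1])
  (F_mono : forall (w : Omega) (phi psi : hist r m), leB B phi psi ->
     vle (B *m (psi 0 - phi 0)) (F w psi - F w phi))
  (F_sublin : forall (w : Omega) (psi : hist r m) (l : R),
     leB B 0 psi -> 0 <= l -> l <= 1 ->
     vle (l *: F w psi) (F w (l *: psi))).
Implicit Types (w : Omega) (y z : R -> 'cV[R]_m) (phi chi psi : hist r m) (t : R).
Local Notation it := (iter_sol sigma B F).
Local Notation lim_it := (iter_lim sigma B F).

Let itc w phi n : continuous (it w phi n).
Proof. exact: iter_sol_continuous. Qed.

Let limc w phi : coneB B phi -> continuous (lim_it w phi).
Proof. exact: iter_lim_continuous. Qed.

Let lim_unif w phi (T e : R) : coneB B phi -> 0 < e -> exists N : nat,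
  forall n, (N <= n)%N -> forall t, t <= T -> `|lim_it w phi t - it w phi n t| <= e.
Proof.
move=> cphi e0.
have [N _ HN] := iter_lim_uniform r_gt0 sigma_flow B_quasipos F_cont F_bdd F_mono F_sublin w T cphi e0.
by exists N.
Qed.

Let lim_hist_unif w phi (T e : R) : coneB B phi -> 0 < e -> exists N : nat,
  forall n, (N <= n)%N -> forall t, t <= T ->
  `|hist_at (lim_it w phi) t - hist_at (it w phi n) t : hist r m| <= e.
Proof.
move=> cphi e0; have [N HN] := @lim_unif w phi T e cphi e0.
exists N => n Nn t tT; apply: hist_at_dist => //; [exact: limc|exact: ltW|].
by move=> s _ st; apply: HN => //; exact: le_trans st tT.
Qed.

Let rhs_unif w phi (T e : R) : coneB B phi -> 0 < e -> exists N : nat,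
  forall n, (N <= n)%N -> forall t, 0 <= t -> t <= T ->
  `|F (sigma t w) (hist_at (it w phi n) t) - F (sigma t w) (hist_at (lim_it w phi) t)| <= e.
Proof.
move=> cphi e0.
pose K := (fun t => (sigma t w, hist_at (lim_it w phi) t : hist r m)) @` `[0, T]%classic.
have cK : compact K.
  apply: continuous_compact; last exact: segment_compact.
  apply: continuous_subspaceT => t; apply: cvg_to_pair; first exact: flow_continuous.
  by apply: hist_at_continuous; exact: limc.
have [d d0 dP] := compact_unif_continuous cK F_cont e0.
have d20 : 0 < d / 2 by rewrite divr_gt0.
have [N HN] := @lim_hist_unif w phi T (d / 2) cphi d20.
exists N => n Nn t t0 tT.
have Kt : K (sigma t w, hist_at (lim_it w phi) t) by exists t => //=; rewrite in_itv/= t0.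
have := dP _ (sigma t w, hist_at (it w phi n) t) Kt.
have bt : ball (sigma t w, hist_at (lim_it w phi) t : hist r m) d
    (sigma t w, hist_at (it w phi n) t).
  split; first exact: ballxx.
  rewrite -ball_normE /=; apply: le_lt_trans (HN n Nn t tT) _; lra.
by move=> /(_ bt) /=; rewrite -ball_normE /= distrC => /ltW.
Qed.

Lemma iter_lim_solves w phi : coneB B phi -> solves sigma F w (lim_it w phi) 0.
Proof.
move=> cphi; split=> [|t t0]; first exact: limc.
set Y := lim_it w phi.
pose g s := F (sigma s w) (hist_at Y s).
have gc : continuous g := @rhs_continuous _ _ _ _ _ _ sigma_flow F_cont w Y (@limc w phi cphi).
move=> e e0.
have e40 : 0 < e / 4 by rewrite divr_gt0.
have /cvgrPdist_le/(_ _ e40)/nbhs_ballP[d /= d0 dP] := gc t.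
have [N1 HN1] := @rhs_unif w phi (t + 1) (e / 4) cphi e40.
pose b := m%:R * `|B| + 1.
have b0 : 0 < b by rewrite ltr_wpDl// mulr_ge0.
have eb0 : 0 < e / 8 / b by rewrite !divr_gt0.
have [N2 HN2] := @lim_unif w phi (t + 1) (e / 8 / b) cphi eb0.
near=> u.
have tu : t < u by near: u; exact: nbhs_right_gt.
have ud : u < t + d by near: u; apply: nbhs_right_lt; rewrite ltrDl.
have u1 : u < t + 1 by near: u; apply: nbhs_right_lt; rewrite ltrDl.
apply/ler_addgt0Pr => eta eta0.
have eta20 : 0 < eta / 2 by rewrite divr_gt0.
have [N3 HN3] := @lim_unif w phi (t + 1) (eta / 2) cphi eta20.
pose n := maxn N1 (maxn N2 N3).
have n1 : (N1 <= n)%N by rewrite leq_maxl.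
have n2 : (N2 <= n)%N by rewrite /n maxnCA leq_maxl.
have n3 : (N3 <= n)%N by rewrite /n maxnA leq_maxr.
have BN k s : (N2 <= k)%N -> s <= t + 1 -> `|B *m (it w phi k s - Y s)| <= e / 8.
  move=> Nk st; apply: le_trans (mulmx_norm_le _ _) _.
  apply: (@le_trans _ _ (b * (e / 8 / b))).
    apply: ler_pM; rewrite ?mulr_ge0//; first by rewrite lerDl.
    by rewrite distrC HN2.
  by rewrite mulrCA divff ?mulr1// gt_eqF.
have key : `|it w phi n.+1 u - it w phi n.+1 t - (u - t) *: g t| <= e * (u - t).
  apply: (@rderiv_mean_le R m 1 (it w phi n.+1)
    (fun s => B *m it w phi n.+1 s + iter_rhs sigma B F w phi n.+1 s) t u e (g t)
    (ltW tu) (ltW e0) (@itc w phi n.+1)).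
  move=> s ts su; have s0 := le_trans t0 ts.
  split; first exact: iter_sol_rderiv.
  have s1 : s <= t + 1 by lra.
  have h1 : `|g t - g s| <= e / 4 by apply: dP; rewrite /ball/= distrC ger0_norm; lra.
  have h2 := HN1 n n1 s s0 s1.
  have h3 := BN n.+1 s (leqW n2) s1.
  have h4 := BN n s n2 s1.
  have -> : B *m it w phi n.+1 s + iter_rhs sigma B F w phi n.+1 s - g t =
     (F (sigma s w) (hist_at (it w phi n) s) - g s) - (g t - g s) +
     (B *m (it w phi n.+1 s - Y s) - B *m (it w phi n s - Y s)).
    rewrite /iter_rhs /= !mulmxBr.
    move: (F _ _) (g s) (g t) (B *m it w phi n s) (B *m _) (B *m Y s) => f a c p q v.
    by apply/matrixP => i j; rewrite !mxE; ring.
  have q1 := ler_normB (F (sigma s w) (hist_at (it w phi n) s) - g s) (g t - g s).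
  have q2 := ler_normB (B *m (it w phi n.+1 s - Y s)) (B *m (it w phi n s - Y s)).
  apply: le_trans (ler_normD _ _) _.
  by rewrite -/(g s) in h2; lra.
have k1 := HN3 n.+1 (leqW n3) u (ltW u1).
have k2 : `|Y t - it w phi n.+1 t| <= eta / 2 by apply: HN3; [exact: leqW|lra].
rewrite -/(g t).
have -> : Y u - Y t - (u - t) *: g t = (Y u - it w phi n.+1 u) - (Y t - it w phi n.+1 t)
   + (it w phi n.+1 u - it w phi n.+1 t - (u - t) *: g t).
  by apply/matrixP => i j; rewrite !mxE; ring.
apply: le_trans (ler_normD _ _) _.
have := ler_normB (Y u - it w phi n.+1 u) (Y t - it w phi n.+1 t).
by rewrite -/Y in k1; lra.
Unshelve. all: by end_near. Qed.

Lemma iter_lim_init w phi s : coneB B phi -> delay_itv r s -> lim_it w phi s = phi s.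
Proof.
move=> cphi /delay_itvE[rs s0].
rewrite (iter_lim_past r_gt0 sigma_flow B_quasipos F_cont F_bdd F_mono F_sublin)//.
by rewrite max_l.
Qed.

Let sol_hist_lim w phi t : coneB B phi -> 0 <= t ->
  sol_hist sigma F t w phi = hist_at (lim_it w phi) t.
Proof.
move=> cphi t0.
apply: (sol_hist_eq r_gt0 sigma_flow F_cont F_C1 (iter_lim_solves w cphi)) => //.
by move=> s; exact: iter_lim_init.
Qed.

Lemma sol_hist_cone w phi t : coneB B phi -> 0 <= t ->
  coneB B (sol_hist sigma F t w phi).
Proof.
move=> cphi t0.
rewrite sol_hist_lim//.
apply: coneB_closed => e e0; have [N HN] := @lim_hist_unif w phi t e cphi e0.
exists (hist_at (it w phi N) t); last exact: HN.
exact: iter_sol_cone.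
Qed.

(* Monotonicity (l = 1) and sublinearity (chi = l *: phi) in a single statement. *)
Lemma sol_hist_compare w phi chi l t : coneB B phi -> coneB B chi ->
  0 <= l -> l <= 1 -> leB B (l *: phi) chi -> 0 <= t ->
  leB B (l *: sol_hist sigma F t w phi) (sol_hist sigma F t w chi).
Proof.
move=> cphi cchi l0 l1 lphichi t0.
rewrite !sol_hist_lim//.
apply: coneB_closed => e e0.
have e20 : 0 < e / 2 by rewrite divr_gt0.
have [N1 HN1] := @lim_hist_unif w phi t (e / 2) cphi e20.
have [N2 HN2] := @lim_hist_unif w chi t (e / 2) cchi e20.
pose n := maxn N1 N2.
exists (hist_at (it w chi n) t - l *: hist_at (it w phi n) t).
  by have [] := iter_sol_compare r_gt0 sigma_flow B_quasipos F_cont F_mono F_sublin w n cphi l0 l1 lphichi t0.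
have h1 := HN1 n (leq_maxl _ _) t (lexx t).
have h2 := HN2 n (leq_maxr _ _) t (lexx t).
move: h1 h2; move: (hist_at (lim_it w phi) t : hist r m) (hist_at (it w phi n) t : hist r m).
move: (hist_at (lim_it w chi) t : hist r m) (hist_at (it w chi n) t : hist r m) => A a P p h1 h2.
have -> : A - l *: P - (a - l *: p) = (A - a) - l *: (P - p).
  by rewrite scalerBr !opprD !opprK addrACA.
apply: le_trans (ler_normB _ _) _; rewrite normrZ (ger0_norm l0).
have : l * `|P - p| <= `|P - p| by rewrite ler_piMl.
by lra.
Qed.

Lemma sol_solves w phi : coneB B phi -> exists y, [/\ solves sigma F w y 0,
  forall s, delay_itv r s -> y s = phi s &
  forall t, t <= - r -> y t = phi (- r)].
Proof.
move=> cphi; exists (lim_it w phi); split.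
- exact: iter_lim_solves.
- by move=> s; exact: iter_lim_init.
move=> t tr; rewrite (iter_lim_past r_gt0 sigma_flow B_quasipos F_cont F_bdd F_mono F_sublin)//.
  by rewrite max_r.
by rewrite (le_trans tr)// oppr_le0 ltW.
Qed.

End existence.

(** * Fiberwise contractions over a minimal base *)

Lemma cluster_ultra (I : Type) (T : topologicalType) (F : set_system I)
    (FF : ProperFilter F) (f : I -> T) (p : T) : cluster (f @ F) p ->
  exists U : set_system I, [/\ UltraFilter U, F `<=` U & f @ U --> p].
Proof.
move=> fp.
pose G : set_system I := [set A | exists B V, [/\ F B, nbhs p V & B `&` f @^-1` V `<=` A]].
have GP : ProperFilter G.
  split; last split.
  - case=> B [V [FB pV BV]].
    have /fp/(_ pV)[_ [[i Bi <-] Vi]] : (f @ F) (f @` B).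
      by apply: (@filterS _ F _ B) => // i Bi; exists i.
    exact: (BV i).
  - by exists setT, setT; split=> //; exact: filterT.
  - move=> A A' [B [V [FB pV BV]]] [B' [V' [FB' pV' BV']]].
    exists (B `&` B'), (V `&` V'); split; [exact: filterI|exact: filterI|].
    by move=> i [[? ?] [? ?]]; split; [exact: BV|exact: BV'].
  - by move=> A A' AA' [B [V [FB pV BV]]]; exists B, V; split=> // i /BV /AA'.
have [U [UU GU]] := ultraFilterLemma GP.
exists U; split=> //.
  by move=> A FA; apply: GU; exists A, setT; split; [|exact: filterT|move=> i []].
by move=> V pV; apply: GU; exists setT, V; split; [exact: filterT| |move=> i []].
Qed.

Lemma fmap_ultra (I T : Type) (f : I -> T) (U : set_system I) :
  UltraFilter U -> UltraFilter (f @ U).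
Proof.
move=> UU; split; first exact: fmap_proper_filter.
move=> G GP UG; apply/seteqP; split=> // A GA.
have [//|UnA] := in_ultra_setVsetC (f @^-1` A) UU.
have /UG GnA : (f @ U) (~` A) by exact: UnA.
by have [x []] := filter_ex (filterI GA GnA).
Qed.

Lemma ultra_limit_map (I : Type) (X T : topologicalType) (K : set T) (U : set_system I)
    (UU : UltraFilter U) (D : set X) (s : I -> X -> T) : compact K ->
  (forall x i, D x -> K (s i x)) ->
  exists h : X -> T, forall x, D x -> K (h x) /\ s i x @[i --> U] --> h x.
Proof.
move=> cK sK.
have H (x : X) : exists y, D x -> K y /\ s i x @[i --> U] --> y.
  have [Dx|nDx] := pselect (D x); last first.
    have [i0 _] := filter_ex (@filterT _ U _).
    by exists (s i0 x) => /nDx.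
  have cK' := cK; rewrite compact_ultra in cK'.
  have [||y [Ky sy]] := cK' (s^~ x @ U); last by exists y.
    exact: fmap_ultra.
  by apply: (@filterE _ U) => i; exact: (sK x i Dx).
have [h hP] := choice H.
by exists h.
Qed.

Section fiber_dynamics.
Variables (R : realType) (T : topologicalType) (Omega : topologicalType).
Variables (K : set T) (S : R -> T -> T) (p : T -> Omega) (sigma : R -> Omega -> Omega).
Variable d : T -> T -> R.
Context (K_compact : compact K) (Omega_hausdorff : hausdorff_space Omega)
  (p_continuous : continuous p)
  (S_K : forall t x, K x -> K (S t x))
  (S_add : forall s t x, S (s + t) x = S s (S t x)) (S_0 : forall x, S 0 x = x)
  (p_S : forall t x, p (S t x) = sigma t (p x))
  (sigma_forward : forall w w', cluster (sigma t w @[t --> +oo]) w')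
  (sigma_backward : forall w w', cluster (sigma (- t) w @[t --> +oo]) w')
  (d_sym : forall x y, K x -> K y -> d x y = d y x)
  (d_triangle : forall x y z, K x -> K y -> K z -> d x z <= d x y + d y z)
  (d_near : forall x, K x -> forall e, 0 < e -> \forall y \near x, K y -> d x y < e).

Let fiber w := [set x | K x /\ p x = w].

Let d_limit (I : Type) (U : set_system I) (UF : ProperFilter U) (f g : I -> T) x y e :
  (forall i, K (f i)) -> (forall i, K (g i)) -> K x -> K y ->
  f i @[i --> U] --> x -> g i @[i --> U] --> y -> 0 < e ->
  \forall i \near U, `|d (f i) (g i) - d x y| < e.
Proof.
move=> Kf Kg Kx Ky fx gy e0.
have e20 : 0 < e / 2 by rewrite divr_gt0.
have n1 : \forall i \near U, K (f i) -> d x (f i) < e / 2 := fx _ (d_near Kx e20).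
have n2 : \forall i \near U, K (g i) -> d y (g i) < e / 2 := gy _ (d_near Ky e20).
apply: filterS2 n1 n2 => i /(_ (Kf i)) h1 /(_ (Kg i)) h2.
have t1 := d_triangle (Kf i) Kx (Kg i); have t2 := d_triangle Kx Ky (Kg i).
have t3 := d_triangle Kx (Kf i) Ky; have t4 := d_triangle (Kf i) (Kg i) Ky.
rewrite (d_sym (Kf i) Kx) in t1; rewrite (d_sym (Kg i) Ky) in t4.
by rewrite ltr_norml; apply/andP; split; lra.
Qed.

Let recurrence (D : set T) (f : T -> T) x y e : D `<=` K ->
  (forall x, D x -> D (f x)) ->
  (forall x y, D x -> D y -> d x y <= d (f x) (f y)) ->
  D x -> D y -> 0 < e ->
  exists k, d x (iter k.+1 f x) < e /\ d y (iter k.+1 f y) < e.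
Proof.
move=> DK fw fd wx wy e0.
have it n z : D z -> D (iter n f z).
  by move=> wz; elim: n => //= n; exact: fw.
have itd n z z' : D z -> D z' -> d z z' <= d (iter n f z) (iter n f z').
  move=> wz wz'; elim: n => //= n IH; apply: le_trans IH _.
  by apply: fd; exact: it.
have GK : \forall n \near \oo, (K `*` K) (iter n f x, iter n f y).
  by apply: nearW => n; split; [exact: (DK _ (it n x wx))|exact: (DK _ (it n y wy))].
have [[a b] [[/= Ka Kb] cab]] := @compact_setX _ _ _ _ K_compact K_compact
  ((fun n => (iter n f x, iter n f y)) @ \oo) _ GK.
have e20 : 0 < e / 2 by rewrite divr_gt0.
have nab : nbhs (a, b) [set q | (K q.1 -> d a q.1 < e / 2) /\ (K q.2 -> d b q.2 < e / 2)].
  exists ([set z | K z -> d a z < e / 2], [set z | K z -> d b z < e / 2]).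
    by split; exact: d_near.
  by move=> [q1 q2].
have visit N : exists2 n, (N <= n)%N & d a (iter n f x) < e / 2 /\ d b (iter n f y) < e / 2.
  have [|_ [[n /= Nn <-] [h1 h2]]] := cab ((fun n => (iter n f x, iter n f y)) @` [set n | (N <= n)%N]) _ _ nab.
    by exists N => // n Nn; exists n.
  by exists n => //; split; [apply: h1; exact: (DK _ (it n x wx))|apply: h2; exact: (DK _ (it n y wy))].
have [n1 _ [a1 b1]] := visit 0%N.
have [n2 n12 [a2 b2]] := visit n1.+1.
exists (n2 - n1.+1)%N.
have close z c : D z -> K c -> d c (iter n1 f z) < e / 2 ->
    d c (iter n2 f z) < e / 2 -> d z (iter (n2 - n1.+1).+1 f z) < e.
  move=> wz Kc h1 h2; apply: le_lt_trans (itd n1 _ _ wz (it _ _ wz)) _.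
  rewrite -iterD subnSK// addnC subnK; last exact: ltnW.
  have := d_triangle (DK _ (it n1 _ wz)) Kc (DK _ (it n2 _ wz)).
  by rewrite (d_sym (DK _ (it n1 _ wz)) Kc); lra.
by split; [exact: close Ka a1 a2|exact: close Kb b1 b2].
Qed.

(* Along an ultrafilter of recurrence times of w, the maps S (- t) converge on the
   fiber over w to a self-map h that expands d at least as much as each of them;
   by recurrence an expanding self-map of a relatively compact set is isometric. *)
Lemma fiber_isometry : (forall t x y, 0 <= t -> K x -> K y -> p x = p y ->
    d (S t x) (S t y) <= d x y) ->
  forall t x y, K x -> K y -> p x = p y -> d (S t x) (S t y) = d x y.
Proof.
move=> S_nonexp.
have SN t x : S t (S (- t) x) = x by rewrite -S_add subrr S_0.
have NS t x : S (- t) (S t x) = x by rewrite -S_add addNr S_0.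
have back s t x y : 0 <= s -> s <= t -> K x -> K y -> p x = p y ->
    d (S (- s) x) (S (- s) y) <= d (S (- t) x) (S (- t) y).
  move=> s0 st Kx Ky pxy.
  have -> : - s = (t - s) + (- t) by rewrite addrAC subrr add0r.
  rewrite !(S_add (t - s)); apply: S_nonexp; rewrite ?subr_ge0//; try exact: S_K.
  by rewrite !p_S pxy.
have iso_back t x y : 0 <= t -> K x -> K y -> p x = p y ->
    d (S (- t) x) (S (- t) y) = d x y.
  move=> t0 Kx Ky pxy; set w := p x.
  have [U [UU FU Uw]] := cluster_ultra _ (@sigma_backward w w).
  have [h hP] := ultra_limit_map UU K_compact (fun x t (wx : fiber w x) => S_K (- t) wx.1).
  have hw z : fiber w z -> fiber w (h z).
    move=> wz; have [Kh hz] := hP z wz; split=> //.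
    have h1 : p (S (- t) z) @[t --> U] --> p (h z).
      by apply: (cvg_comp _ _ hz); exact: p_continuous.
    have h2 : p (S (- t) z) @[t --> U] --> w.
      by under eq_fun do rewrite p_S wz.2.
    exact: (@cvg_unique _ Omega_hausdorff (p (S (- t) z) @[t --> U])) h1 h2.
  have hd s z z' : 0 <= s -> fiber w z -> fiber w z' ->
      d (S (- s) z) (S (- s) z') <= d (h z) (h z').
    move=> s0 wz wz'; apply/ler_addgt0Pr => e e0.
    have [Kh hz] := hP z wz; have [Kh' hz'] := hP z' wz'.
    have lim := d_limit (@ultra_proper _ _ UU) (fun i => S_K (- i) wz.1) (fun i => S_K (- i) wz'.1) Kh Kh' hz hz' e0.
    have large : \forall t \near U, s <= t by apply: FU; apply: nbhs_pinfty_ge; exact: num_real.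
    have [t' [/= st' lt']] := @filter_ex _ U _ _ (@filterI _ U _ _ _ large lim).
    have := back s t' z z' s0 st' wz.1 wz'.1 (etrans wz.2 (esym wz'.2)).
    by move: lt'; rewrite ltr_norml => /andP[]; lra.
  have hd0 z z' : fiber w z -> fiber w z' -> d z z' <= d (h z) (h z').
    by move=> wz wz'; have := hd 0 z z' (lexx _) wz wz'; rewrite oppr0 !S_0.
  have wx : fiber w x by [].
  have wy : fiber w y by split.
  apply/eqP; rewrite eq_le; apply/andP; split; last first.
    by have := back 0 t x y (lexx _) t0 Kx Ky pxy; rewrite oppr0 !S_0.
  apply/ler_addgt0Pr => e e0.
  have e20 : 0 < e / 2 by rewrite divr_gt0.
  have [k [kx ky]] := recurrence (D := fiber w) (fun z wz => wz.1) hw hd0 wx wy e20.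
  have it n z : fiber w z -> fiber w (iter n h z).
    by move=> wz; elim: n => //= n; exact: hw.
  have itd n z z' : fiber w z -> fiber w z' -> d z z' <= d (iter n h z) (iter n h z').
    move=> wz wz'; elim: n => //= n IH; apply: le_trans IH _.
    by apply: hd0; exact: it.
  apply: le_trans (hd t x y t0 wx wy) _.
  apply: le_trans (itd k _ _ (hw _ wx) (hw _ wy)) _.
  rewrite -!iterSr.
  have Kkx := (it k.+1 _ wx).1; have Kky := (it k.+1 _ wy).1.
  have t1 := d_triangle Kkx Kx Kky; have t2 := d_triangle Kx Ky Kky.
  by rewrite (d_sym Kkx Kx) in t1; lra.
move=> t x y Kx Ky pxy.
have [t0|/ltW t0] := leP 0 t; last by rewrite -[t]opprK iso_back// oppr_ge0.
rewrite -[in RHS](NS t x) -[in RHS](NS t y) iso_back//; try exact: S_K.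
by rewrite !p_S pxy.
Qed.

(* S t converges along G to a map h from the fiber of N over w to the fiber over
   p b, and k is a limit in the opposite direction.  As h \o k is isometric, b is
   recurrent for it, hence close to the range of h. *)
Lemma fiber_approximation (N : set T) (w : Omega) (G : set_system R) (GU : UltraFilter G)
    (b : T) (e : R) :
  (forall t x y, K x -> K y -> p x = p y -> d (S t x) (S t y) = d x y) ->
  N `<=` K -> compact N -> (forall t x, N x -> N (S t x)) -> N b ->
  sigma t w @[t --> G] --> p b -> 0 < e ->
  exists x, [/\ N x, p x = w & \forall t \near G, d b (S t x) < e].
Proof.
move=> iso NK cN S_N Nb Gw e0.
pose nf v := [set x | N x /\ p x = v].
have lim_map v v' (U : set_system R) : UltraFilter U -> sigma t v @[t --> U] --> v' ->
    exists h : T -> T, forall x, nf v x -> nf v' (h x) /\ S t x @[t --> U] --> h x.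
  move=> UU Uv.
  have [h hP] := ultra_limit_map UU cN (fun x t (wx : nf v x) => S_N t x wx.1).
  exists h => x wx; have [Nh hx] := hP x wx; split=> //; split=> //.
  have h1 : p (S t x) @[t --> U] --> p (h x).
    by apply: (cvg_comp _ _ hx); exact: p_continuous.
  have h2 : p (S t x) @[t --> U] --> v'.
    by under eq_fun do rewrite p_S wx.2.
  exact: (@cvg_unique _ Omega_hausdorff (p (S t x) @[t --> U])) h1 h2.
have lim_iso v v' (U : set_system R) (UU : UltraFilter U) (h : T -> T) :
    (forall x, nf v x -> nf v' (h x) /\ S t x @[t --> U] --> h x) ->
    forall x y, nf v x -> nf v y -> d (h x) (h y) = d x y.
  move=> hP x y vx vy; apply/eqP; rewrite -subr_eq0 -normr_le0.
  apply/ler_addgt0Pr => eta eta0; rewrite add0r.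
  have [[Nhx _] hx] := hP x vx; have [[Nhy _] hy] := hP y vy.
  have Kx := NK _ vx.1; have Ky := NK _ vy.1.
  have lim := d_limit (@ultra_proper _ _ UU) (fun i => S_K i Kx) (fun i => S_K i Ky) (NK _ Nhx) (NK _ Nhy) hx hy eta0.
  have [t] := filter_ex lim.
  by rewrite iso// ?(etrans vx.2 (esym vy.2))// distrC => /ltW.
have [h hP] := lim_map w (p b) G GU Gw.
have [U [UU _ Uw]] := cluster_ultra _ (@sigma_forward (p b) w).
have [k kP] := lim_map (p b) w U UU Uw.
pose f := h \o k.
have fb x : nf (p b) x -> nf (p b) (f x).
  by move=> bx; apply: (hP _ _).1; exact: (kP _ bx).1.
have fd x y : nf (p b) x -> nf (p b) y -> d (f x) (f y) = d x y.
  move=> bx by_; rewrite /f /= (lim_iso _ _ _ GU h hP).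
  - exact: (lim_iso _ _ _ UU k kP).
  - exact: (kP _ bx).1.
  - exact: (kP _ by_).1.
have nb : nf (p b) b by [].
have nK : nf (p b) `<=` K by move=> x [/NK].
have fdle x y : nf (p b) x -> nf (p b) y -> d x y <= d (f x) (f y).
  by move=> bx by_; rewrite fd.
have [j [bj _]] := recurrence nK fb fdle nb nb e0.
pose x := k (iter j f b).
have it n : nf (p b) (iter n f b) by elim: n => //= n; exact: fb.
have wx : nf w x by exact: (kP _ (it j)).1.
have [Nhx hx] := hP x wx.
exists x; split; [exact: wx.1|exact: wx.2|].
have gap : 0 < e - d b (h x) by rewrite subr_gt0.
have lim := d_limit (@ultra_proper _ _ GU) (fun=> NK _ Nb) (fun i => S_K i (NK _ wx.1))
  (NK _ Nb) (NK _ Nhx.1) (cvg_cst b) hx gap.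
apply: (@filterS _ G _ _ _ _ (lim _)) => t /=; rewrite ltr_norml => /andP[]; lra.
Qed.

End fiber_dynamics.

(** * Whole trajectories *)

Section trajectory_space.
Context {R : realType} {m : nat}.
Local Notation traj := {ptws R -> 'cV[R]_m}.

Lemma point_eval_continuous (t : R) : continuous (fun y : traj => y t : 'cV[R]_m).
Proof.
move=> y; have : {ptws, nbhs (y : traj) --> (y : R -> 'cV[R]_m)} by exact: cvg_id.
by move=> /pointwise_cvgP; exact.
Qed.

Lemma trmx_continuous p q : continuous (fun A : 'M[R]_(p, q) => A^T).
Proof.
move=> A; apply: (@cvg_mx_coord R _ (nbhs A) _) => i j; rewrite mxE.
under eq_fun do rewrite mxE.
exact: coord_continuous.
Qed.

Lemma compact_col_ball (M : R) : compact [set v : 'cV[R]_m | `|v| <= M].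
Proof.
have c : compact [set v : 'rV[R]_m | `|v| <= M].
  apply: bounded_closed_compact.
    by exists M; split; [exact: num_real|move=> N MN v /= /le_trans; apply; exact: ltW].
  apply: (@closed_comp _ R (fun v : 'rV[R]_m => `|v|) [set x | x <= M]).
    by move=> v _; exact: norm_continuous.
  exact: closed_le.
rewrite (_ : [set v : 'cV[R]_m | `|v| <= M] = trmx @` [set v : 'rV[R]_m | `|v| <= M]).
  by apply: continuous_compact => //; apply: continuous_subspaceT; exact: trmx_continuous.
have trn p q (v : 'M[R]_(p, q)) : `|v^T| <= `|v|.
  by apply/mx_norm_leP => // i j; rewrite mxE mx_norm_coord_le.
apply/seteqP; split=> [v vM|_ [v vM <-]]; last exact: le_trans (trn _ _ v) vM.
by exists v^T; rewrite ?trmxK//=; exact: le_trans (trn _ _ v) vM.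
Qed.

Lemma compact_bounded_traj (M : R) :
  compact [set y : traj | forall t : R, `|(y t : 'cV[R]_m)| <= M].
Proof. exact: (@tychonoff R (fun=> 'cV[R]_m) _ (fun=> @compact_col_ball M)). Qed.

Definition lip_traj (L : R) (y : R -> 'cV[R]_m) :=
  forall s t, `|y s - y t| <= L * `|s - t|.

Lemma lip_traj_continuous L y : lip_traj L y -> continuous y.
Proof.
move=> yL t; apply/cvgrPdist_le => e e0.
have L0 : 0 < `|L| + 1 by rewrite ltr_wpDl.
apply/nbhs_ballP; exists (e / (`|L| + 1)) => /=; first by rewrite divr_gt0.
move=> u; rewrite /ball/= ltr_pdivlMr// => h; apply: le_trans (yL _ _) _.
apply: le_trans (ltW h); rewrite mulrC ler_wpM2l//.
by have := ler_norm L; lra.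
Qed.

Lemma lip_traj_near L y (a b e : R) : lip_traj L y -> 0 < e ->
  \forall z \near (y : traj), lip_traj L z ->
    forall s, a <= s -> s <= b -> `|(z s : 'cV[R]_m) - y s| <= e.
Proof.
move=> yL e0.
have /compact_near_coveringP/near_covering_withinP c := @segment_compact _ a b.
have L0 : 0 < `|L| + 1 by rewrite ltr_wpDl.
pose d := e / 3 / (`|L| + 1).
have d0 : 0 < d by rewrite !divr_gt0.
have Ld x : `|x| < d -> L * `|x| <= e / 3.
  rewrite /d ltr_pdivlMr// => h; apply: le_trans (ltW h); rewrite mulrC ler_wpM2l//.
  by have := ler_norm L; lra.
have H : forall x, `[a, b]%classic x -> \forall x' \near x & z \near (y : traj),
    `[a, b]%classic x' -> lip_traj L z -> `|(z x' : 'cV[R]_m) - y x'| <= e.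
  move=> x _.
  have e30 : 0 < e / 3 by rewrite divr_gt0.
  have yx := @point_eval_continuous x (y : traj) _ (nbhsx_ballx (y x) _ e30).
  exists (ball x d, (fun z : traj => z x) @^-1` ball (y x) (e / 3)).
    by split=> //; exact: nbhsx_ballx.
  move=> [x' z] [/= xx' zx] _ zL.
  have h1 : `|(z x' : 'cV[R]_m) - z x| <= e / 3.
    by apply: le_trans (zL _ _) _; apply: Ld; rewrite distrC.
  have h2 : `|y x - y x'| <= e / 3 by apply: le_trans (yL _ _) _; exact: Ld.
  have h3 : `|(z x : 'cV[R]_m) - y x| <= e / 3.
    by move: zx; rewrite -ball_normE /= distrC => /ltW.
  have -> : (z x' : 'cV[R]_m) - y x' = (z x' - z x) + (z x - y x) + (y x - y x').
    by rewrite !addrA !subrK.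
  apply: le_trans (ler_normD _ _) _.
  have := ler_normD ((z x' : 'cV[R]_m) - z x) (z x - y x); lra.
have G := c _ (nbhs (y : traj)) (fun (z : traj) x' => lip_traj L z -> `|(z x' : 'cV[R]_m) - y x'| <= e) _ H.
apply: (@filterS _ (nbhs (y : traj)) _ _ _ _ (G _)) => z Hz zL s as_ sb; apply: Hz => //.
by rewrite /= in_itv/= as_.
Qed.

End trajectory_space.

Section orbit_space.
Context {R : realType} {r : R} {m : nat} {Omega : metricType R}.
Context {sigma : R -> Omega -> Omega} {F : Omega -> hist r m -> 'cV[R]_m} {B : 'M[R]_m}.
Context (r_gt0 : 0 < r) (sigma_flow : is_flow sigma)
  (F_cont : continuous (fun p : Omega * hist r m => F p.1 p.2)).
Local Notation traj := {ptws R -> 'cV[R]_m}.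
Local Notation space := (Omega * traj)%type.
Implicit Types (x : space) (s t : R).

Definition time_shift t x : space := (sigma t x.1, (fun s => x.2 (s + t)) : traj).

Definition rhs x t : 'cV[R]_m := F (sigma t x.1) (hist_at x.2 t).

Lemma time_shift0 x : time_shift 0 x = x.
Proof.
have [_ s0 _] := sigma_flow; case: x => w y; congr pair => /=; first exact: s0.
by apply/funext => s; rewrite addr0.
Qed.

Lemma time_shiftD s t x : time_shift (s + t) x = time_shift s (time_shift t x).
Proof.
have [_ _ sD] := sigma_flow; congr pair => /=; first exact: sD.
by apply/funext => u; rewrite addrA.
Qed.

Lemma rhs_shift s t x : rhs (time_shift s x) t = rhs x (t + s).
Proof.
have [_ _ sD] := sigma_flow.
by rewrite /rhs /= -sD hist_at_shift.
Qed.

Lemma lip_traj_shift L t x : lip_traj L x.2 -> lip_traj L (time_shift t x).2.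
Proof.
move=> xL u v; apply: le_trans (xL _ _) _.
by rewrite opprD addrACA subrr addr0.
Qed.

Lemma rhs_near x L (a b e : R) : lip_traj L x.2 -> 0 < e ->
  \forall x' \near x, lip_traj L x'.2 -> forall s, a <= s -> s <= b ->
    `|rhs x' s - rhs x s| <= e.
Proof.
move=> xL e0.
have xc := lip_traj_continuous xL.
have e20 : 0 < e / 2 by rewrite divr_gt0.
have /compact_near_coveringP/near_covering_withinP c := @segment_compact _ a b.
have H : forall s, `[a, b]%classic s -> \forall s' \near s & x' \near x,
    `[a, b]%classic s' -> lip_traj L x'.2 -> `|rhs x' s' - rhs x s'| <= e.
  move=> s _.
  pose G := within [set q : R * space | lip_traj L q.2.2] (nbhs (s, x)).
  have GF : Filter G by exact: within_filter.
  have G1 : (fun q : R * space => q.1) @ G --> s.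
    by apply: cvg_within_filter; exact: cvg_fst.
  have G2 : (fun q : R * space => q.2) @ G --> x.
    by apply: cvg_within_filter; exact: cvg_snd.
  have G21 : (fun q : R * space => q.2.1) @ G --> x.1.
    by apply: (cvg_comp _ _ G2); exact: cvg_fst.
  have cs : (fun q : R * space => sigma q.1 q.2.1) @ G --> sigma s x.1.
    have [sc _ _] := sigma_flow.
    exact: (cvg_comp _ _ (cvg_to_pair GF G1 G21) (sc (s, x.1))).
  have ch : (fun q : R * space => hist_at q.2.2 q.1 : hist r m) @ G --> (hist_at x.2 s : hist r m).
    apply/cvgrPdist_le => d d0.
    have d20 : 0 < d / 2 by rewrite divr_gt0.
    have n1 : \forall q \near G, `|hist_at x.2 s - hist_at x.2 q.1 : hist r m| <= d / 2.
      have /cvgrPdist_le/(_ _ d20) := @hist_at_continuous _ r m _ xc s.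
      exact: G1.
    have n2 : \forall q \near G, ball s 1 q.1 by exact: (G1 _ (nbhsx_ballx s 1 ltr01)).
    have n3 : \forall q \near G, lip_traj L q.2.2 ->
        forall u, s - 1 - r <= u -> u <= s + 1 -> `|(q.2.2 u : 'cV[R]_m) - x.2 u| <= d / 2.
      have n := lip_traj_near (s - 1 - r) (s + 1) xL d20.
      have G22 : (fun q : R * space => q.2.2) @ G --> x.2.
        by apply: (cvg_comp _ _ G2); exact: cvg_snd.
      exact: (G22 _ n).
    have n4 : \forall q \near G, lip_traj L q.2.2 by exact: withinT.
    apply: (@filterS _ G _ _ _ _ (filterI (filterI n1 n2) (filterI n3 n4))) => q [[h1 h2] [h3 h4]].
    move: h2; rewrite /ball/= ltr_norml => /andP[h5 h6].
    have h7 : `|hist_at x.2 q.1 - hist_at q.2.2 q.1 : hist r m| <= d / 2.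
      apply: hist_at_dist => //; [exact: lip_traj_continuous h4|exact: ltW|].
      by move=> u u1 u2; rewrite distrC; apply: h3 => //; lra.
    have -> : hist_at x.2 s - hist_at q.2.2 q.1 = (hist_at x.2 s - hist_at x.2 q.1) + (hist_at x.2 q.1 - hist_at q.2.2 q.1) :> hist r m.
      by rewrite addrA subrK.
    by apply: le_trans (ler_normD _ _) _; lra.
  have /cvgrPdist_le/(_ _ e20) n1 := cvg_rhs F_cont GF cs ch.
  have cr := @rhs_continuous _ _ _ _ _ _ sigma_flow F_cont x.1 x.2 xc s.
  have /cvgrPdist_le/(_ _ e20) n2 := cvg_comp _ _ G1 cr.
  have n3 : G [set q | `|rhs q.2 q.1 - rhs x q.1| <= e].
    apply: (@filterS _ G _ _ _ _ (@filterI _ G GF _ _ n1 n2)) => q [h1 h2] /=.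
    apply: le_trans (ler_distD (F (sigma s x.1) (hist_at x.2 s)) _ _) _.
    by rewrite [e]splitr lerD// distrC.
  by case: n3 => -[U V] [/= nU nV] UV; exists (U, V) => // -[s' x'] UV' _; exact: (UV (s', x') UV').
have G := c _ (nbhs x) (fun x' s' => lip_traj L x'.2 -> `|rhs x' s' - rhs x s'| <= e) _ H.
apply: (@filterS _ (nbhs x) _ _ _ _ (G _)) => x' Hx xL' s as_ sb; apply: Hx => //.
by rewrite /= in_itv/= as_.
Qed.
End orbit_space.

Arguments time_shift {R m Omega} sigma t x.
Arguments rhs {R r m Omega} sigma F x t.

Section orbit_space.
Context {R : realType} {r : R} {m : nat} {Omega : metricType R}.
Context {sigma : R -> Omega -> Omega} {F : Omega -> hist r m -> 'cV[R]_m} {B : 'M[R]_m}.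
Context (r_gt0 : 0 < r) (sigma_flow : is_flow sigma)
  (F_cont : continuous (fun p : Omega * hist r m => F p.1 p.2)).
Local Notation traj := {ptws R -> 'cV[R]_m}.
Local Notation space := (Omega * traj)%type.
Local Notation tshift := (time_shift sigma).
Local Notation vf := (rhs sigma F).
Implicit Types (x : space) (s t : R).
Context (M L : R) (psi1 : hist r m).

(* Points are pairs of a base point and a function on the whole line; the equation
   is required only from time a on, which is the case a = - t of a solution on
   [0, +oo[ shifted by t. *)
Definition orbits (a : R) : set space := [set x | [/\ forall s, `|x.2 s : 'cV[R]_m| <= M,
  lip_traj L x.2, forall t, a <= t -> rderiv (x.2 : R -> 'cV[R]_m) t (vf x t) &
  forall t, a <= t -> leB B psi1 (hist_at x.2 t)]].

Lemma orbits_subset a b : a <= b -> orbits a `<=` orbits b.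
Proof.
by move=> ab x [xM xL xd xp]; split=> // t bt; [apply: xd|apply: xp]; exact: le_trans bt.
Qed.

Lemma rderiv_shift (V : normedModType R) (y : R -> V) s t c :
  rderiv y (t + s) c -> rderiv (fun u => y (u + s)) t c.
Proof.
move=> yc e e0; have := yc e e0; rewrite !near_withinE => /nbhs_ballP[d /= d0 dP].
apply/nbhs_ballP; exists d => //= u tu ltu.
have -> : u - t = (u + s) - (t + s) by rewrite opprD addrACA subrr addr0.
by apply: dP; [move: tu; rewrite /ball/= opprD addrACA subrr addr0|rewrite ltrD2r].
Qed.

Lemma orbits_shift a t x : orbits a x -> orbits (a - t) (tshift t x).
Proof.
move=> [xM xL xd xp]; split=> [s||s|s]; rewrite ?lerBlDr.
- exact: xM.
- exact: (@lip_traj_shift _ _ _ sigma L t x xL).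
- by move=> ats; rewrite (rhs_shift sigma_flow); apply: rderiv_shift; exact: xd.
- by move=> ats; rewrite hist_at_shift; exact: xp.
Qed.

Let cvg_at_snd x : (fun x' : space => x'.2) @ nbhs x --> x.2.
Proof. by case: x => w y; exact: cvg_snd. Qed.

Lemma eval_near x s (e : R) : 0 < e -> \forall x' \near x, `|(x'.2 s : 'cV[R]_m) - x.2 s| <= e.
Proof.
move=> e0.
have c : (fun x' : space => x'.2 s : 'cV[R]_m) @ nbhs x --> (x.2 s : 'cV[R]_m).
  exact: (cvg_comp _ _ (@cvg_at_snd x) (@point_eval_continuous _ _ s x.2)).
move/cvgrPdist_le : c => /(_ _ e0); apply: filterS => x'.
by rewrite distrC.
Qed.

Lemma orbits_closed a : closed (orbits a).
Proof.
move=> x xc.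
have approx (P : set space) : (\forall x' \near x, P x') -> exists2 x', orbits a x' & P x'.
  by move=> /xc[x' [? ?]]; exists x'.
have xL : lip_traj L x.2.
  move=> s t; apply/ler_addgt0Pr => e e0.
  have e20 : 0 < e / 2 by rewrite divr_gt0.
  have [x' [_ x'L _ _] [h1 h2]] := approx _ (filterI (eval_near x s e20) (eval_near x t e20)).
  have h3 := x'L s t.
  have t1 := ler_distD (x'.2 s : 'cV[R]_m) (x.2 s) (x.2 t).
  have t2 := ler_distD (x'.2 t : 'cV[R]_m) (x'.2 s) (x.2 t).
  by rewrite distrC in h1; lra.
have xcont := lip_traj_continuous xL.
split=> //.
- move=> s; apply/ler_addgt0Pr => e e0.
  have [x' [x'M _ _ _] h] := approx _ (eval_near x s e0).
  have := x'M s; have := ler_distD (x'.2 s : 'cV[R]_m) (x.2 s) 0; rewrite !subr0.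
  by rewrite distrC in h; lra.
- move=> t at_ e e0.
  have e20 : 0 < e / 2 by rewrite divr_gt0.
  have /cvgrPdist_le/(_ _ e20)/nbhs_ballP[d /= d0 dP] :=
    @rhs_continuous _ _ _ _ _ _ sigma_flow F_cont x.1 x.2 xcont t.
  rewrite near_withinE; apply/nbhs_ballP; exists d => //= u tu ltu.
  have ut : u - t < d by move: tu; rewrite /ball/= ltr_norml => /andP[]; lra.
  apply/ler_addgt0Pr => eta eta0.
  have eta20 : 0 < eta / 2 by rewrite divr_gt0.
  have [x' [_ x'L x'd _] [[h1 h2] /(_ x'L) h3]] := approx _ (filterI (filterI (eval_near x t eta20)
     (eval_near x u eta20)) (rhs_near sigma_flow F_cont t u xL e20)).
  have := @rderiv_mean_le _ _ _ (x'.2 : R -> 'cV[R]_m) (vf x') t u e (vf x t) (ltW ltu) (ltW e0)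
    (lip_traj_continuous x'L).
  have H : forall s : R, t <= s -> s < u ->
      rderiv (x'.2 : R -> 'cV[R]_m) s (vf x' s) /\ `|vf x' s - vf x t| <= e.
    move=> s ts su; split; first by apply: x'd; exact: le_trans ts.
    apply: le_trans (ler_distD (vf x s) _ _) _; rewrite [e]splitr lerD//.
      by apply: h3 => //; exact: ltW.
    by rewrite distrC; apply: dP; rewrite /ball/= ltr_norml; apply/andP; split; lra.
  move=> /(_ H); move: h1 h2; move: (vf x t) => c.
  move: (x'.2 t : 'cV[R]_m) (x'.2 u : 'cV[R]_m) (x.2 t : 'cV[R]_m) (x.2 u : 'cV[R]_m) => p' q' p q h1 h2 h4.
  have -> : q - p - (u - t) *: c = (q' - p' - (u - t) *: c) + ((p' - p) - (q' - q)).
    by apply/matrixP => i j; rewrite !mxE; ring.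
  apply: le_trans (ler_normD _ _) _.
  by have := ler_normB (p' - p) (q' - q); lra.
- move=> t at_; apply: coneB_closed => e e0.
  have [x' [_ x'L _ x'p] /(_ x'L) h] := approx _ (cvg_at_snd (lip_traj_near (t - r) t xL e0)).
  exists (hist_at x'.2 t - psi1); first exact: x'p.
  have -> : hist_at x.2 t - psi1 - (hist_at x'.2 t - psi1) = hist_at x.2 t - hist_at x'.2 t :> hist r m.
    by rewrite opprB addrA subrK.
  apply: hist_at_dist => //; [exact: lip_traj_continuous x'L|exact: ltW|].
  by move=> s s1 s2; rewrite distrC; exact: h.
Qed.

Lemma orbits_compact a : compact [set: Omega] -> compact (orbits a).
Proof.
move=> cO; apply: (subclosed_compact (orbits_closed (a := a)) (compact_setX cO (@compact_bounded_traj _ m M))).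
by move=> x [xM _ _ _]; split.
Qed.

Definition lip_at (y : R -> 'cV[R]_m) : lipHist r m :=
  xget 0 [set psi : lipHist r m | psi = hist_at y 0 :> hist r m].

Lemma lip_atE y : lip_traj L y -> lip_at y = hist_at y 0 :> hist r m.
Proof.
move=> yL.
suff lp : hist_at y 0 \in @lip_pred R r m.
  exact: (@xgetPex _ 0 [set psi : lipHist r m | psi = hist_at y 0 :> hist r m] (ex_intro _ (LipHist lp) erefl)).
apply/asboolP/slope_bddP; exists L => -[s t] [/= sr tr st].
rewrite /slope /= ler_pdivrMr ?normr_gt0 ?subr_eq0//.
have yc := lip_traj_continuous yL.
rewrite !hist_atE// !add0r; exact: yL.
Qed.

Definition emb x : Omega * lipHist r m := (x.1, lip_at x.2).

End orbit_space.

Arguments orbits {R r m Omega} sigma F B M L psi1 a.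

Section embedding.
Context {R : realType} {r : R} {m : nat} {Omega : metricType R}.
Context {sigma : R -> Omega -> Omega} {F : Omega -> hist r m -> 'cV[R]_m} {B : 'M[R]_m}.
Context (r_gt0 : 0 < r) (sigma_flow : is_flow sigma)
  (F_cont : continuous (fun p : Omega * hist r m => F p.1 p.2)) (F_C1 : C1_snd F).
Local Notation traj := {ptws R -> 'cV[R]_m}.
Local Notation space := (Omega * traj)%type.
Local Notation tshift := (time_shift sigma).
Local Notation vf := (rhs sigma F).
Implicit Types (x : space) (s t : R).

Lemma time_shift_cvg (I : Type) (G : set_system I) (FG : Filter G) (t_ : I -> R)
    (x_ : I -> space) t x L :
  (\forall i \near G, lip_traj L (x_ i).2) ->
  t_ @ G --> t -> x_ @ G --> x -> tshift (t_ i) (x_ i) @[i --> G] --> tshift t x.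
Proof.
move=> GL tt xx.
have x1 : (fun i => (x_ i).1) @ G --> x.1 by apply: (cvg_comp _ _ xx); exact: cvg_fst.
have x2 : (fun i => (x_ i).2) @ G --> x.2 by apply: (cvg_comp _ _ xx); exact: cvg_snd.
apply: (cvg_to_pair FG).
  have [sc _ _] := sigma_flow.
  exact: (cvg_comp _ _ (cvg_to_pair FG tt x1) (sc (t, x.1))).
have pw : {ptws, (fun i => ((fun s => (x_ i).2 (s + t_ i)) : R -> 'cV[R]_m)) @ G --> (fun s => x.2 (s + t))}.
  apply/pointwise_cvgP => s.
  apply/cvgrPdist_le => e e0.
  have e20 : 0 < e / 2 by rewrite divr_gt0.
  have L0 : 0 < `|L| + 1 by rewrite ltr_wpDl.
  have d0 : 0 < e / 2 / (`|L| + 1) by rewrite divr_gt0.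
  have /cvgrPdist_le/(_ _ e20) h1 := cvg_comp _ _ x2 (@point_eval_continuous _ _ (s + t) x.2).
  have /cvgrPdist_le/(_ _ d0) h2 := tt.
  apply: (@filterS _ G _ _ _ _ (@filterI _ G FG _ _ (@filterI _ G FG _ _ h1 h2) GL)) => i [[k1 k2] k3].
  apply: le_trans (ler_distD ((x_ i).2 (s + t) : 'cV[R]_m) _ _) _.
  rewrite [e]splitr lerD//; apply: le_trans (k3 _ _) _.
  rewrite opprD addrACA subrr add0r.
  move: k2; rewrite ler_pdivlMr// => k2; apply: le_trans k2; rewrite mulrC ler_wpM2l//.
  by have := ler_norm L; lra.
exact: pw.
Qed.

Lemma time_shift_continuous t : continuous (tshift t : space -> space).
Proof.
move=> x.
have c2 : (fun x' : space => x'.2) @ nbhs x --> x.2 by case: x => w y; exact: cvg_snd.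
have c1 : (fun x' : space => x'.1) @ nbhs x --> x.1 by case: x {c2} => w y; exact: cvg_fst.
apply: (cvg_to_pair (nbhs_filter x)).
  have [sc _ _] := sigma_flow.
  exact: (cvg_comp _ _ (cvg_to_pair (nbhs_filter x) (cvg_cst t) c1) (sc (t, x.1))).
have pw : {ptws, (fun x' : space => ((fun s => x'.2 (s + t)) : R -> 'cV[R]_m)) @ nbhs x --> (fun s => x.2 (s + t))}.
  apply/pointwise_cvgP => s.
  exact: (cvg_comp _ _ c2 (@point_eval_continuous _ _ (s + t) x.2)).
exact: pw.
Qed.

Lemma semiflow_emb L x t : lip_traj L x.2 ->
  (forall s, 0 <= s -> rderiv (x.2 : R -> 'cV[R]_m) s (vf x s)) -> 0 <= t ->
  semiflow sigma F t (emb x) = emb (tshift t x).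
Proof.
move=> xL xd t0; rewrite /semiflow /emb /=; congr pair.
have yc := lip_traj_continuous xL.
have h : sol_hist sigma F t x.1 (lip_at x.2) = hist_at x.2 t.
  apply: (sol_hist_eq r_gt0 sigma_flow F_cont F_C1 (y := x.2)) => //.
  by move=> s sr; rewrite (lip_atE xL) hist_atE// add0r.
rewrite /sol_lip h /lip_at; congr (xget 0 _); apply/funext => psi /=.
by rewrite hist_at_shift add0r.
Qed.

Context (M L : R) (psi1 : hist r m).
Local Notation orb := (orbits sigma F B M L psi1).

Lemma lip_at_near x (e : R) : orb (- r) x -> 0 < e -> \forall x' \near x, orb (- r) x' ->
  `|(lip_at x.2 : lipHist r m) - lip_at x'.2| <= e.
Proof.
move=> [xM xL xd xp] e0.
have e20 : 0 < e / 2 by rewrite divr_gt0.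
have c2 : (fun x' : space => x'.2) @ nbhs x --> x.2 by case: (x) => w y; exact: cvg_snd.
have n1 : nbhs x [set x' | lip_traj L x'.2 -> forall s, - r <= s -> s <= 0 ->
    `|(x'.2 s : 'cV[R]_m) - x.2 s| <= e / 2].
  exact: (c2 _ (lip_traj_near (- r) 0 xL e20)).
have n2 : nbhs x [set x' | lip_traj L x'.2 -> forall s, - r <= s -> s <= 0 ->
    `|vf x' s - vf x s| <= e / 2] := rhs_near sigma_flow F_cont (- r) 0 xL e20.
apply: filterS2 n1 n2 => x' h1 h2 [_ xL' xd' _].
have {}h1 := h1 xL'; have {}h2 := h2 xL'.
have yc := lip_traj_continuous xL; have yc' := lip_traj_continuous xL'.
have E s : delay_itv r s -> (lip_at x.2 - lip_at x'.2 : lipHist r m) s = x.2 s - x'.2 s.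
  move=> sr; rewrite -[LHS]/((lip_at x.2 : hist r m) s - (lip_at x'.2 : hist r m) s).
  by rewrite (lip_atE xL) (lip_atE xL') !hist_atE// !add0r.
rewrite [e]splitr; apply: lip_norm_le; rewrite ?ltW//.
  move=> s sr; rewrite E//; move/delay_itvE : sr => [s1 s2].
  by rewrite distrC; exact: h1.
move=> s t sr tr st; rewrite !E//; move/delay_itvE : sr => [s1 s2]; move/delay_itvE : tr => [t1 t2].
have := @rderiv_mean_le _ _ _ ((x.2 : R -> 'cV[R]_m) \- x'.2) (fun u => vf x u - vf x' u) s t (e / 2) 0 st (ltW e20).
rewrite /= scaler0 subr0; apply.
  by move=> u; apply: cvgB; [exact: yc|exact: yc'].
move=> u su ut; split.
  by apply: rderivB; [apply: xd|apply: xd']; lra.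
by rewrite subr0 distrC; apply: h2 => //; lra.
Qed.

Lemma emb_cvg (I : Type) (G : set_system I) (FG : Filter G) (x_ : I -> space) x :
  (\forall i \near G, orb (- r) (x_ i)) -> orb (- r) x -> x_ @ G --> x ->
  (emb (x_ i) : Omega * lipHist r m) @[i --> G] --> (emb x : Omega * lipHist r m).
Proof.
move=> Go xo xx; apply: (cvg_to_pair FG).
  by apply: (cvg_comp _ _ xx); exact: cvg_fst.
apply/cvgrPdist_le => e e0.
have h1 := xx _ (lip_at_near xo e0).
by apply: (@filterS _ G _ _ _ _ (@filterI _ G FG _ _ h1 Go)) => i [h Goi]; exact: h.
Qed.

Lemma lip_at_derivable x s : orb (- r) x -> - r < s -> s < 0 ->
  derivable ((lip_at x.2 : lipHist r m) : R -> 'cV[R]_m) s 1.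
Proof.
move=> [xM xL xd xp] rs s0.
have yc := lip_traj_continuous xL.
have near0 : \forall h \near (0 : R), - r < h + s /\ h + s < 0.
  have d0 : 0 < Num.min (s + r) (- s) by rewrite lt_min; apply/andP; split; lra.
  apply/nbhs_ballP; exists (Num.min (s + r) (- s)) => //= h.
  by rewrite /ball/= sub0r normrN ltr_norml lt_min => /andP[]; rewrite ltrNl lt_min => /andP[? ?] /andP[? ?]; split; lra.
have eqL u : - r < u -> u < 0 -> (lip_at x.2 : lipHist r m) u = x.2 u.
  by move=> u1 u2; rewrite (lip_atE xL) hist_atE ?add0r//; apply/delay_itvE; split; exact: ltW.
apply/cvg_ex; exists (vf x s); apply/cvgrPdist_le => e e0.
have ex := rderiv_expand yc (@rhs_continuous _ _ _ _ _ _ sigma_flow F_cont x.1 x.2 yc) xd (ltW rs) e0.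
have sh : (fun h : R => h + s) @ (0 : R)^' --> s.
  rewrite -[X in _ --> X]add0r; apply: cvgD; last exact: cvg_cst.
  exact: (cvg_within).
have n1 : \forall h \near (0 : R)^', - r <= h + s ->
  `|x.2 (h + s) - x.2 s - (h + s - s) *: vf x s : 'cV[R]_m| <= e * `|h + s - s| := sh _ ex.
have n2 : \forall h \near (0 : R)^', - r < h + s /\ h + s < 0 := cvg_within _ near0.
near=> h.
have h0 : h != 0 by near: h; exact: nbhs_dnbhs_neq.
have [h1 h2] : - r < h + s /\ h + s < 0 by near: h; exact: n2.
have : `|x.2 (h + s) - x.2 s - (h + s - s) *: vf x s : 'cV[R]_m| <= e * `|h + s - s|.
  by have /(_ (ltW h1)) : - r <= h + s -> `|x.2 (h + s) - x.2 s - (h + s - s) *: vf x s : 'cV[R]_m| <= e * `|h + s - s| by near: h.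
have h1s : h *: 1 = h :> R by rewrite /GRing.scale/= mulr1.
rewrite /= h1s !eqL// addrK => h3.
have -> : vf x s - h^-1 *: (x.2 (h + s) - x.2 s) = - (h^-1 *: (x.2 (h + s) - x.2 s - h *: vf x s)).
  by rewrite [in RHS]scalerBr scalerA mulVf// scale1r opprB.
by rewrite normrN normrZ normfV mulrC ler_pdivrMr ?normr_gt0.
Unshelve. all: by end_near. Qed.

End embedding.

(** * The part metric *)

Section part_metric.
Context {R : realType} {r : R} {m : nat} {B : 'M[R]_m}.
Context (r_gt0 : 0 < r).
Implicit Types (phi psi chi : hist r m) (a b : R).

Definition part_le a phi psi :=
  [/\ 0 <= a, leB B (expR (- a) *: phi) psi & leB B (expR (- a) *: psi) phi].

(* The part metric of the cone; junk (namely 0) when no a is admissible. *)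
Definition part_dist phi psi := inf [set a | part_le a phi psi].

Lemma part_le_sym a phi psi : part_le a phi psi -> part_le a psi phi.
Proof. by case. Qed.

Lemma part_le_trans a b phi psi chi :
  part_le a phi psi -> part_le b psi chi -> part_le (a + b) phi chi.
Proof.
move=> [a0 h1 h2] [b0 h3 h4]; split; first exact: addr_ge0.
  rewrite opprD expRD mulrC -scalerA; apply: leB_trans h3.
  by apply: leBZ => //; exact: expR_ge0.
rewrite opprD expRD -scalerA; apply: leB_trans h2.
by apply: leBZ => //; exact: expR_ge0.
Qed.

Lemma part_le_mono a b phi psi : coneB B phi -> coneB B psi -> a <= b ->
  part_le a phi psi -> part_le b phi psi.
Proof.
move=> cphi cpsi ab [a0 h1 h2]; split; first exact: le_trans ab.
  by apply: leB_trans h1; apply: leBZr => //; rewrite ler_expR lerN2.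
by apply: leB_trans h2; apply: leBZr => //; rewrite ler_expR lerN2.
Qed.

Lemma part_le_norm a phi psi : coneB B phi -> part_le a phi psi ->
  `|phi - psi| <= 2 * (expR a - expR (- a)) * `|phi|.
Proof.
move=> cphi [a0 h1 h2].
have e1 : 1 <= expR a by rewrite -expR0 ler_expR.
have e2 : expR (- a) <= 1 by rewrite -expR0 ler_expR oppr_le0.
have h3 : leB B psi (expR a *: phi).
  have := leBZ (expR_ge0 a) h2.
  by rewrite scalerA -expRD subrr expR0 scale1r.
have h4 : `|psi - expR (- a) *: phi| <= (expR a - expR (- a)) * `|phi|.
  rewrite -[X in X * _]ger0_norm ?subr_ge0 ?(le_trans e2)// -normrZ.
  apply: leB_norm; first exact: h1.
  by rewrite /leB scalerBl opprB addrA subrK.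
have -> : phi - psi = (1 - expR (- a)) *: phi - (psi - expR (- a) *: phi).
  by rewrite scalerBl scale1r opprB addrA subrK.
apply: le_trans (ler_normB _ _) _.
rewrite normrZ [`|1 - _|]ger0_norm ?subr_ge0//.
have : (1 - expR (- a)) * `|phi| <= (expR a - expR (- a)) * `|phi|.
  by rewrite ler_wpM2r// lerD2r.
by lra.
Qed.

Lemma part_le_norm_small (M e : R) : 0 < e -> exists2 a : R, 0 < a &
  forall phi psi, coneB B phi -> `|phi| <= M -> part_le a phi psi -> `|phi - psi| <= e.
Proof.
move=> e0; pose f (a : R) := 2 * (expR a - expR (- a)) * M.
have fc : continuous f.
  move=> a; apply: cvgMl; apply: cvgMr; apply: cvgB; first exact: continuous_expR.
  by apply: (@cvg_comp _ _ _ (@GRing.opp R) expR _ (nbhs (- a : R))); [exact: opp_continuous|exact: continuous_expR].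
have f0 : f 0 = 0 by rewrite /f oppr0 subrr mulr0 mul0r.
have c1 : f @ (0 : R)^'+ --> f 0 by exact: cvg_at_right_filter (fc 0).
rewrite f0 in c1.
have /cvgrPdist_le/(_ _ e0) n1 := c1.
have [a [a0 ae]] := filter_ex (filterI (nbhs_right_gt (0 : R)) n1).
exists a => // phi psi cphi phiM /(part_le_norm cphi)/le_trans; apply.
move: ae; rewrite sub0r normrN => /(le_trans (ler_norm _)); apply: le_trans.
rewrite ler_wpM2l// mulr_ge0// subr_ge0 ler_expR.
by have := ltW a0; lra.
Qed.

Lemma part_le_unit (psi1 : hist r m) (c : R) (phi psi : lipHist r m) :
  coneB B psi1 -> 0 <= c ->
  (forall eta : lipHist r m, coneB B ((c * `|eta|) *: psi1 + eta)) ->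
  leB B psi1 phi -> leB B psi1 psi -> part_le (c * `|phi - psi|) phi psi.
Proof.
move=> cpsi1 c0 cu.
have half (f g : lipHist r m) : leB B psi1 g ->
    leB B (expR (- (c * `|f - g|)) *: (f : hist r m)) g.
  move=> pg; set k := c * `|f - g|.
  have k0 : 0 <= k by rewrite mulr_ge0.
  have cg := coneB_ge cpsi1 pg.
  have h1 : leB B f (k *: psi1 + g).
    by rewrite /leB -addrA /k distrC; exact: cu (g - f).
  have h2 : leB B (k *: psi1 + g) ((k + 1) *: (g : hist r m)).
    by rewrite /leB scalerDl scale1r opprD addrACA subrr addr0 -scalerBr; exact: coneBZ.
  have h3 : leB B ((k + 1) *: (g : hist r m)) (expR k *: (g : hist r m)).
    by apply: leBZr => //; rewrite addrC; exact: expR_ge1Dx.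
  have := leBZ (expR_ge0 (- k)) (leB_trans h1 (leB_trans h2 h3)).
  by rewrite scalerA -expRD addNr expR0 scale1r.
move=> p1 p2; split; [by rewrite mulr_ge0|exact: half|].
by rewrite distrC; exact: half.
Qed.

Lemma part_dist_sym phi psi : part_dist phi psi = part_dist psi phi.
Proof. by congr inf; apply/seteqP; split=> a /=; exact: part_le_sym. Qed.

Lemma part_dist_le a phi psi : part_le a phi psi -> part_dist phi psi <= a.
Proof. by move=> h; apply: ge_inf => //; exists 0 => b []. Qed.

Lemma part_dist_ge b phi psi : (exists a, part_le a phi psi) ->
  (forall a, part_le a phi psi -> b <= a) -> b <= part_dist phi psi.
Proof. by move=> ex h; apply: lb_le_inf. Qed.

Lemma part_dist_refl phi : part_dist phi phi = 0.
Proof.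
have h : part_le 0 phi phi by split=> //; rewrite oppr0 expR0 scale1r; exact: leB_refl.
apply/eqP; rewrite eq_le part_dist_le//=.
by apply: part_dist_ge; [exists 0|move=> a []].
Qed.

Lemma part_dist_lt b phi psi : coneB B phi -> coneB B psi ->
  (exists a, part_le a phi psi) -> part_dist phi psi < b -> part_le b phi psi.
Proof.
move=> cphi cpsi ex h; apply: contrapT => nb.
suff /le_lt_trans/(_ h) : b <= part_dist phi psi by rewrite ltxx.
apply: part_dist_ge; first exact: ex.
move=> a ha; rewrite leNgt; apply/negP => ab.
by case: nb; exact: part_le_mono cphi cpsi (ltW ab) ha.
Qed.

Lemma part_dist_triangle phi psi chi :
  (exists a, part_le a phi psi) -> (exists a, part_le a psi chi) ->
  part_dist phi chi <= part_dist phi psi + part_dist psi chi.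
Proof.
move=> ex1 ex2; rewrite -lerBlDr; apply: part_dist_ge; first exact: ex1.
move=> a ha.
rewrite lerBlDr addrC -lerBlDr; apply: part_dist_ge; first exact: ex2.
move=> b hb.
by rewrite lerBlDr addrC; apply: part_dist_le; exact: part_le_trans hb.
Qed.

Lemma part_dist_eq0 phi psi : coneB B phi -> coneB B psi ->
  (exists a, part_le a phi psi) -> part_dist phi psi <= 0 -> phi = psi.
Proof.
move=> cphi cpsi ex h.
apply/eqP; rewrite -subr_eq0 -normr_le0; apply/ler_addgt0Pr => e e0; rewrite add0r.
have [a a0 aP] := part_le_norm_small `|phi| e0.
by apply: aP => //; exact: part_dist_lt cphi cpsi ex (le_lt_trans h a0).
Qed.

End part_metric.

(** * The omega-limit set *)

Lemma cluster_invariant (R : realType) (X : topologicalType) (f : X -> X) (u : R -> X) (h : R) x :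
  continuous f -> (forall s, u (s + h) = f (u s)) ->
  cluster (u @ +oo) x -> cluster (u @ +oo) (f x).
Proof.
move=> fc uf ux A V [K [Kr KA]] /fc fV.
have : (u @ +oo) (u @` [set s | K - h < s]).
  by exists (K - h); split=> [|s Ks]; [exact: num_real|exists s].
move=> /ux/(_ fV)[_ [[s /= Ks <-] Vs]].
by exists (u (s + h)); split; [apply: KA; rewrite -ltrBlDr|rewrite uf].
Qed.

Lemma cluster_closed (X : topologicalType) (G : set_system X) : closed (cluster G).
Proof.
rewrite clusterE; apply: closed_bigI => A _; exact: closed_closure.
Qed.

Section base_flow.
Context {R : realType} {Omega : metricType R} {sigma : R -> Omega -> Omega}.
Context (sigma_flow : is_flow sigma)
  (sigma_minimal : minimal_set [set: R] sigma [set: Omega]).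

Lemma time_continuous t : continuous (sigma t).
Proof.
move=> w; have [sc _ _] := sigma_flow.
exact: (cvg_comp _ _ (cvg_to_pair (nbhs_filter w) (cvg_cst t) cvg_id) (sc (t, w))).
Qed.

Let cluster_full (u : R -> Omega) (e : R) :
  (forall s t, u (s + e * t) = sigma t (u s)) -> forall w', cluster (u @ +oo) w'.
Proof.
move=> ue; have [_ s0 sD] := sigma_flow; have [_ cO _ mO] := sigma_minimal.
suff -> : cluster (u @ +oo) = [set: Omega] by [].
have inv t w : cluster (u @ +oo) w -> cluster (u @ +oo) (sigma t w).
  by apply: (cluster_invariant (h := e * t)) => //; exact: time_continuous.
apply: mO => //.
- by have [w [_ uw]] := cO (u @ +oo) _ filterT; exists w.
- by apply: (subclosed_compact (@cluster_closed _ _) cO).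
- move=> t _; apply/seteqP; split=> [_ [w cw <-]|w cw]; first exact: inv.
  by exists (sigma (- t) w); [exact: inv|rewrite -sD subrr s0].
Qed.

Lemma flow_cluster_forward w w' : cluster (sigma t w @[t --> +oo]) w'.
Proof.
have [_ _ sD] := sigma_flow.
by apply: (@cluster_full (sigma^~ w) 1) => s t; rewrite mul1r addrC sD.
Qed.

Lemma flow_cluster_backward w w' : cluster (sigma (- t) w @[t --> +oo]) w'.
Proof.
have [_ _ sD] := sigma_flow.
by apply: (@cluster_full (fun t => sigma (- t) w) (-1)) => s t; rewrite mulN1r opprB sD.
Qed.

End base_flow.

Lemma segment_glue (R : realType) (V : normedModType R) (y : R -> V) (L c : R) (D : set R) :
  D c ->
  (forall s t, D s -> D t -> s <= t -> t <= c -> `|y t - y s| <= L * (t - s)) ->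
  (forall s t, D s -> D t -> c <= s -> s <= t -> `|y t - y s| <= L * (t - s)) ->
  forall s t, D s -> D t -> s <= t -> `|y t - y s| <= L * (t - s).
Proof.
move=> Dc h1 h2 s t Ds Dt st.
have [tc|/ltW ct] := leP t c; first exact: h1.
have [cs|/ltW sc] := leP c s; first exact: h2.
apply: le_trans (ler_distD (y c) _ _) _.
have -> : L * (t - s) = L * (t - c) + L * (c - s) by rewrite -mulrDr addrA subrK.
by rewrite lerD//; [exact: h2|exact: h1].
Qed.

Section orbit_of_point.
Context {R : realType} {r : R} {m : nat} {Omega : metricType R}.
Context {sigma : R -> Omega -> Omega} {B : 'M[R]_m}
  {F : Omega -> hist r m -> 'cV[R]_m}.
Context (r_gt0 : 0 < r) (sigma_flow : is_flow sigma)
  (B_quasipos : quasipositive B)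
  (F_cont : continuous (fun p : Omega * hist r m => F p.1 p.2))
  (F_C1 : C1_snd F)
  (F_bdd : forall X1 : set (hist r m), bounded_set X1 ->
     bounded_set [set F p.1 p.2 | p in [set: Omega] `*` X1])
  (F_mono : forall (w : Omega) (phi psi : hist r m), leB B phi psi ->
     vle (B *m (psi 0 - phi 0)) (F w psi - F w phi))
  (F_sublin : forall (w : Omega) (psi : hist r m) (l : R),
     leB B 0 psi -> 0 <= l -> l <= 1 ->
     vle (l *: F w psi) (F w (l *: psi))).

Lemma orbit_exists (M : R) (psi1 : hist r m) w (phi : lipHist r m) :
  coneB B phi ->
  (forall t, 0 <= t -> `|sol_hist sigma F t w phi| <= M) ->
  (forall t, 0 <= t -> leB B psi1 (sol_hist sigma F t w phi)) ->
  exists L x, orbits sigma F B M L psi1 0 x /\ emb x = (w, phi).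
Proof.
move=> cphi hM hp.
have [y [ys yphi ypast]] := sol_solves r_gt0 sigma_flow B_quasipos F_cont F_bdd F_mono F_sublin w cphi.
have hy t : 0 <= t -> sol_hist sigma F t w phi = hist_at y t.
  by move=> t0; exact: (sol_hist_eq r_gt0 sigma_flow F_cont F_C1 ys).
have [yc yd] := ys.
have [C C0 CP] := F_bounded_ball F_bdd M.
have ht t : 0 <= t -> `|hist_at y t : hist r m| <= M by move=> t0; rewrite -hy//; exact: hM.
have hr : delay_itv r (- r) by apply/delay_itvE; split=> //; rewrite oppr_le0 ltW.
have h0 : delay_itv r 0 by exact: hist0.
have yM t : `|y t| <= M.
  have itv s : delay_itv r s -> `|y s| <= M.
    move=> sr; have := le_trans (hist_norm_ge (hist_at y 0 : hist r m) sr) (ht 0 (lexx _)).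
    by rewrite hist_atE// add0r.
  have [tr|rt] := leP t (- r); first by rewrite ypast// -yphi//; exact: itv.
  have [t0|t0] := leP t 0; first by apply: itv; apply/delay_itvE; split=> //; exact: ltW.
  have := le_trans (hist_norm_ge (hist_at y t : hist r m) h0) (ht t (ltW t0)).
  by rewrite hist_atE// addr0.
pose L := Num.max C `|phi|.
have LC : C <= L by rewrite le_max lexx.
have Lp : `|phi| <= L by rewrite le_max lexx orbT.
have up s t : 0 <= s -> s <= t -> `|y t - y s| <= L * (t - s).
  move=> s0 st.
  have := @rderiv_mean_le _ _ _ y (fun u => F (sigma u w) (hist_at y u)) s t L 0 st
    (le_trans (ltW C0) LC) yc.
  rewrite scaler0 subr0; apply=> u su ut; have u0 := le_trans s0 su.
  by split; [exact: yd|rewrite subr0; apply: le_trans LC; exact/CP/ht].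
have mid s t : - r <= s -> s <= t -> t <= 0 -> `|y t - y s| <= L * (t - s).
  move=> rs st t0.
  have sr : delay_itv r s by apply/delay_itvE; split=> //; exact: le_trans t0.
  have tr : delay_itv r t by apply/delay_itvE; split=> //; exact: le_trans st.
  rewrite !yphi//; apply: le_trans (lip_norm_slope phi sr tr) _.
  by rewrite ger0_norm ?subr_ge0// ler_wpM2r// subr_ge0.
have low s t : s <= t -> t <= - r -> `|y t - y s| <= L * (t - s).
  move=> st tr; rewrite !ypast ?(le_trans st)// subrr normr0 mulr_ge0 ?subr_ge0//.
  exact: le_trans (ltW C0) LC.
have all_ s t : s <= t -> `|y t - y s| <= L * (t - s).
  apply: (@segment_glue _ _ y L 0 setT) => // {}s {}t _ _; last exact: up.
  move=> st t0; apply: (@segment_glue _ _ y L (- r) [set u | u <= 0]) => //=.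
  - by case/delay_itvE : hr.
  - by move=> s' t' _ _; exact: low.
  - by move=> s' t' _ t'0 rs' s't'; exact: mid.
  - exact: le_trans t0.
have yL : lip_traj L y.
  move=> s t; have [st|/ltW ts] := leP s t.
    by rewrite distrC [`|s - t|]distrC [X in _ * X]ger0_norm ?subr_ge0//; exact: all_.
  by rewrite [X in _ * X]ger0_norm ?subr_ge0//; exact: all_.
exists L, (w, y); split.
  split; [exact: yM|exact: yL|exact: yd|move=> t t0 /=].
  by rewrite -hy//; exact: hp.
rewrite /emb /=; congr pair; apply/val_inj/histP => s sr.
rewrite -[LHS]/((lip_at y : hist r m) s) (lip_atE yL) hist_atE// add0r.
exact: yphi.
Qed.

End orbit_of_point.

Lemma hausdorff_pair (X Y : topologicalType) : hausdorff_space X -> hausdorff_space Y ->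
  hausdorff_space (X * Y)%type.
Proof.
move=> hX hY [a b] [a' b'] ab; congr pair; [apply: hX|apply: hY] => U V nU nV.
  have [||[u v] [/= [Uu _] [Vu _]]] := ab (U `*` setT) (V `*` setT); last by exists u.
    by exists (U, setT) => //; split=> //; exact: filterT.
  by exists (V, setT) => //; split=> //; exact: filterT.
have [||[u v] [/= [_ Uu] [_ Vu]]] := ab (setT `*` U) (setT `*` V); last by exists v.
  by exists (setT, U) => //; split=> //; exact: filterT.
by exists (setT, V) => //; split=> //; exact: filterT.
Qed.

Lemma lmod_half_split (R : realType) (V : lmodType R) (p f g : V) (k : R) :
  g - 2^-1 *: p = (k *: p + (g - f)) + (f - p) + (2^-1 - k) *: p.
Proof.
have h : 2^-1 + 2^-1 = 1 :> R by lra.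
have pp : p = 2^-1 *: p + 2^-1 *: p by rewrite -scalerDl h scale1r.
rewrite scalerBl {3}pp; move: (2^-1 *: p) (k *: p) => q u.
by rewrite -(addrA u) subrKA [RHS]addrC subrKA [RHS]addrC opprD addrA subrK.
Qed.

Lemma compact_ultra_cvg (I : Type) (X : topologicalType) (K : set X) (U : set_system I)
  (UU : UltraFilter U) (f : I -> X) : compact K -> (forall i, K (f i)) ->
  exists2 x, K x & f @ U --> x.
Proof.
move=> + Kf; rewrite compact_ultra => cK.
have UP := @ultra_proper _ _ UU.
have [||x [Kx fx]] := cK (f @ U); last by exists x.
  exact: fmap_ultra.
exact: (@filterE _ U).
Qed.

Section limit_set.
Context {R : realType} {r : R} {m : nat} {Omega : metricType R}.
Context {sigma : R -> Omega -> Omega} {B : 'M[R]_m}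
  {F : Omega -> hist r m -> 'cV[R]_m}.
Context (r_gt0 : 0 < r) (sigma_flow : is_flow sigma)
  (sigma_minimal : minimal_set [set: R] sigma [set: Omega])
  (B_quasipos : quasipositive B)
  (F_cont : continuous (fun p : Omega * hist r m => F p.1 p.2))
  (F_C1 : C1_snd F)
  (F_bdd : forall X1 : set (hist r m), bounded_set X1 ->
     bounded_set [set F p.1 p.2 | p in [set: Omega] `*` X1])
  (F_mono : forall (w : Omega) (phi psi : hist r m), leB B phi psi ->
     vle (B *m (psi 0 - phi 0)) (F w psi - F w phi))
  (F_sublin : forall (w : Omega) (psi : hist r m) (l : R),
     leB B 0 psi -> 0 <= l -> l <= 1 ->
     vle (l *: F w psi) (F w (l *: psi))).
Local Notation traj := {ptws R -> 'cV[R]_m}.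
Local Notation space := (Omega * traj)%type.
Local Notation tshift := (time_shift sigma).
Implicit Types (x y : space) (s t : R).

Context {M L c : R} {psi1 : hist r m}.
Context (psi1_cone : coneB B psi1) (c_gt0 : 0 < c)
  (psi1_unit : forall eta : lipHist r m, coneB B ((c * `|eta|) *: psi1 + eta)).
Local Notation orb := (orbits sigma F B M L psi1).

Local Notation state x t := (hist_at x.2 t : hist r m).

Definition orbit_dist x y : R := @part_dist R r m B (state x 0) (state y 0).

Lemma orbit_now x : orb 0 x -> [/\ lip_at x.2 = state x 0 :> hist r m,
  coneB B (state x 0), leB B psi1 (state x 0) & continuous (x.2 : R -> 'cV[R]_m)].
Proof.
move=> [xM xL xd xp]; split; [exact: lip_atE xL|exact: coneB_ge psi1_cone (xp 0 (lexx _))|exact: xp|].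
exact: lip_traj_continuous xL.
Qed.

Lemma orbit_part_le x y : orb 0 x -> orb 0 y ->
  @part_le R r m B (c * `|(lip_at x.2 : lipHist r m) - lip_at y.2|) (state x 0) (state y 0).
Proof.
move=> /orbit_now[x1 x2 x3 _] /orbit_now[y1 y2 y3 _].
have := @part_le_unit _ _ _ B psi1 c (lip_at x.2) (lip_at y.2) psi1_cone (ltW c_gt0) psi1_unit.
rewrite x1 y1; exact.
Qed.

Lemma orbit_future x t : orb 0 x -> 0 <= t ->
  sol_hist sigma F t x.1 (state x 0) = state x t.
Proof.
move=> [xM xL xd xp] t0; have yc := lip_traj_continuous xL.
apply: (sol_hist_eq r_gt0 sigma_flow F_cont F_C1 (y := x.2)) => //.
by move=> s sr; rewrite hist_atE// add0r.
Qed.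

Lemma sol_part_le w phi psi t a : coneB B phi -> coneB B psi -> 0 <= t ->
  @part_le R r m B a phi psi ->
  @part_le R r m B a (sol_hist sigma F t w phi) (sol_hist sigma F t w psi).
Proof.
move=> cphi cpsi t0 [a0 h1 h2].
have e1 : expR (- a) <= 1 by rewrite -expR0 ler_expR oppr_le0.
have cmp := sol_hist_compare r_gt0 sigma_flow B_quasipos F_cont F_C1 F_bdd F_mono F_sublin.
split; first exact: a0.
  exact: (cmp w _ _ (expR (- a)) t cphi cpsi (expR_ge0 _) e1 h1 t0).
exact: (cmp w _ _ (expR (- a)) t cpsi cphi (expR_ge0 _) e1 h2 t0).
Qed.

Lemma orbit_part_le_future x y t a : orb 0 x -> orb 0 y -> x.1 = y.1 -> 0 <= t ->
  @part_le R r m B a (state x 0) (state y 0) ->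
  @part_le R r m B a (state x t) (state y t).
Proof.
move=> ox oy xy t0.
have [_ x2 _ _] := orbit_now ox; have [_ y2 _ _] := orbit_now oy.
have fx := orbit_future ox t0; have fy := orbit_future oy t0; rewrite -xy in fy.
by move=> /(sol_part_le x.1 x2 y2 t0); rewrite fx fy.
Qed.

Lemma orbit_sub_r a : a <= 0 -> orb a `<=` orb 0.
Proof. exact: orbits_subset. Qed.

Lemma orbit_dist_sym x y : orbit_dist x y = orbit_dist y x.
Proof. exact: part_dist_sym. Qed.

Lemma orbit_dist_triangle x y z : orb 0 x -> orb 0 y -> orb 0 z ->
  orbit_dist x z <= orbit_dist x y + orbit_dist y z.
Proof.
move=> ox oy oz; apply: part_dist_triangle.
  by eexists; exact: orbit_part_le.
by eexists; exact: orbit_part_le.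
Qed.

Lemma orbit_dist_le x y : orb 0 x -> orb 0 y ->
  orbit_dist x y <= c * `|(lip_at x.2 : lipHist r m) - lip_at y.2|.
Proof. by move=> ox oy; apply: part_dist_le; exact: orbit_part_le. Qed.

Lemma orbit_dist_near x e : orb (- r) x -> 0 < e ->
  \forall y \near x, orb (- r) y -> orbit_dist x y < e.
Proof.
move=> ox e0.
have r0 : - r <= 0 by rewrite oppr_le0 ltW.
have d0 : 0 < e / 2 / c by rewrite !divr_gt0.
apply: (@filterS _ (nbhs x) _ _ _ _ (lip_at_near sigma_flow F_cont ox d0)) => y h oy.
apply: le_lt_trans (orbit_dist_le (orbit_sub_r r0 ox) (orbit_sub_r r0 oy)) _.
have := h oy; rewrite ler_pdivlMr// mulrC => /le_lt_trans; apply.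
by rewrite ltr_pdivrMr// ltr_pMr// ltr1n.
Qed.

Lemma orbit_dist_future x y t : orb 0 x -> orb 0 y -> x.1 = y.1 -> 0 <= t ->
  orbit_dist (tshift t x) (tshift t y) <= orbit_dist x y.
Proof.
move=> ox oy xy t0; apply: part_dist_ge; first by eexists; exact: orbit_part_le.
move=> a ha; apply: part_dist_le.
by rewrite /= !hist_at_shift !add0r; exact: orbit_part_le_future.
Qed.

Lemma orbit_dist_eq0 x y : orb 0 x -> orb 0 y -> orbit_dist x y <= 0 ->
  state x 0 = state y 0.
Proof.
move=> ox oy; have [_ x2 _ _] := orbit_now ox; have [_ y2 _ _] := orbit_now oy.
by apply: part_dist_eq0 => //; eexists; exact: orbit_part_le.
Qed.

Context {x0 : space} (x0_orb : orb 0 x0).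
Local Notation orbit0 := (fun t => tshift t x0).

Definition limit_trajs : set space := cluster (orbit0 @ +oo).
Local Notation Lam := limit_trajs.

Let Omega_compact : compact [set: Omega].
Proof. by have [_ + _ _] := sigma_minimal. Qed.

Lemma orbit0_orb a t : - a <= t -> orb a (tshift t x0).
Proof.
move=> at_; apply: orbits_subset (orbits_shift sigma_flow t x0_orb).
by rewrite add0r lerNl.
Qed.

Lemma limit_trajs_orb a : Lam `<=` orb a.
Proof.
move=> x lx; apply: (orbits_closed sigma_flow F_cont) => V xV; apply: lx xV.
exists (- a); split; first exact: num_real.
by move=> t at_; apply: orbit0_orb; exact: ltW.
Qed.

Lemma limit_trajs_compact : compact Lam.
Proof.
apply: (subclosed_compact (@cluster_closed _ _) (orbits_compact sigma_flow F_cont (M := M) (L := L)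
  (psi1 := psi1) (B := B) (a := 0) Omega_compact)).
exact: limit_trajs_orb.
Qed.

Lemma limit_trajs_shift t x : Lam x -> Lam (tshift t x).
Proof.
apply: (cluster_invariant (h := t)); first exact: time_shift_continuous.
by move=> s; rewrite addrC (time_shiftD sigma_flow).
Qed.

Lemma limit_trajs_ultra x : Lam x ->
  exists U : set_system R, [/\ UltraFilter U, +oo `<=` U & orbit0 @ U --> x].
Proof. exact: cluster_ultra. Qed.

Lemma orbit0_cluster (G : set_system R) (GF : ProperFilter G) : +oo `<=` G ->
  exists2 x, Lam x & cluster (orbit0 @ G) x.
Proof.
move=> Goo.
have cK := orbits_compact sigma_flow F_cont (M := M) (L := L)
  (psi1 := psi1) (B := B) (a := 0) Omega_compact.
have [|x [_ xG]] := cK (orbit0 @ G) _.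
  apply: Goo; exists 0; split; first exact: num_real.
  by move=> t t0; apply: orbit0_orb; rewrite oppr0 ltW.
exists x => //; move=> A V /Goo; exact: xG.
Qed.

Lemma limit_trajs_neq0 : Lam !=set0.
Proof. by have [x lx _] := @orbit0_cluster +oo _ (fun A h => h); exists x. Qed.

Let semiflow_orbit t x : orb 0 x -> 0 <= t -> semiflow sigma F t (emb x) = emb (tshift t x).
Proof. by move=> [_ xL xd _]; exact: (semiflow_emb r_gt0 sigma_flow F_cont F_C1 xL xd). Qed.

Lemma omega_limit_emb w (phi : lipHist r m) : emb x0 = (w, phi) ->
  omega_limit sigma F w phi = emb @` Lam.
Proof.
move=> e0; apply/seteqP; split=> [q [t_ [t0 tinc too tq]]|_ [x lx <-]]; last first.
  have ebx : forall n T, exists t, T <= t /\ ball (emb x : Omega * lipHist r m) n.+1%:R^-1 (emb (tshift t x0)).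
    move=> n T; have [U [UU Uoo Ux]] := limit_trajs_ultra lx.
    have ev : \forall t \near U, orb (- r) (tshift t x0).
      apply: Uoo; exists r; split; first exact: num_real.
      by move=> t rt; apply: orbit0_orb; rewrite opprK ltW.
    have cv := emb_cvg sigma_flow F_cont (@filter_filter _ _ (@ultra_proper _ _ UU)) ev (@limit_trajs_orb (- r) _ lx) Ux.
    have near_T : U [set t | T <= t] by apply: Uoo; apply: nbhs_pinfty_ge; exact: num_real.
    have near_b : U [set t | ball (emb x : Omega * lipHist r m) n.+1%:R^-1 (emb (tshift t x0))].
      by apply: cv; apply: nbhsx_ballx; rewrite invr_gt0.
    by have [t [? ?]] := @filter_ex _ U _ _ (@filterI _ U _ _ _ near_T near_b); exists t.
  have [f fP] := choice (fun nT : nat * R => ebx nT.1 nT.2).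
  pose t_ := fix t n : R := if n is k.+1 then f (k.+1, t k + 1) else f (0%N, 0).
  have tS n : t_ n + 1 <= t_ n.+1 by have [] := fP (n.+1, t_ n + 1).
  have tn n : n%:R <= t_ n.
    elim: n => [|n IH]; first by have [] := fP (0%N, 0).
    by rewrite -natr1; apply: le_trans (tS n); rewrite lerD2r.
  have tb n : ball (emb x : Omega * lipHist r m) n.+1%:R^-1 (emb (tshift (t_ n) x0)).
    by case: n => [|n]; [have [] := fP (0%N, 0)|have [] := fP (n.+1, t_ n + 1)].
  exists t_; split.
  - by move=> n; exact: le_trans (tn n).
  - by apply/increasing_seqP => n; apply: lt_le_trans (tS n); rewrite ltrDl.
  - apply/cvgryPge => A; near=> n; apply: le_trans (tn n).
    by near: n; exact: nbhs_infty_ger.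
  - rewrite -e0; apply/cvg_ballP => e ep; near=> n.
    rewrite semiflow_orbit//; last exact: le_trans (tn n).
    apply: le_ball (tb n); apply: ltW; near: n.
    exact: (near_infty_natSinv_lt (PosNum ep)).
rewrite -e0 in tq.
have GP : ProperFilter (t_ @ \oo) by exact: fmap_proper_filter.
have [x lx xG] := orbit0_cluster GP too.
have [U [UU GU Ux]] := cluster_ultra GP xG.
have UP := @ultra_proper _ _ UU.
have Uoo : +oo `<=` U by move=> A /too; exact: GU.
exists x => //.
have ev : U [set t | orb (- r) (tshift t x0)].
  apply: Uoo; exists r; split; first exact: num_real.
  by move=> t rt; apply: orbit0_orb; rewrite opprK ltW.
have cv := emb_cvg sigma_flow F_cont (@filter_filter _ _ UP) ev (@limit_trajs_orb (- r) _ lx) Ux.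
have Uq : emb (tshift t x0) @[t --> U] --> q.
  have Sq : semiflow sigma F t (emb x0) @[t --> U] --> q by move=> V /tq; exact: GU.
  apply: cvg_trans Sq; apply: (@near_eq_cvg _ _ U).
  apply: Uoo; exists 0; split; first exact: num_real.
  by move=> t t0' /=; rewrite semiflow_orbit// ltW.
have hd : hausdorff_space (Omega * lipHist r m)%type.
  by apply: hausdorff_pair; [exact: metric_hausdorff|exact: norm_hausdorff].
exact: (@cvg_unique _ hd (emb (tshift t x0) @[t --> U]) _ _ _ cv Uq).
Unshelve. all: by end_near. Qed.

Let Nr0 : - r <= 0. Proof. by rewrite oppr_le0 ltW. Qed.

Local Notation hemb := (emb : space -> Omega * lipHist r m).

Let limit_dist_triangle x y z : Lam x -> Lam y -> Lam z ->
  orbit_dist x z <= orbit_dist x y + orbit_dist y z.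
Proof. by move=> lx ly lz; apply: orbit_dist_triangle; exact: limit_trajs_orb. Qed.

Let limit_dist_near x : Lam x -> forall e, 0 < e -> \forall y \near x, Lam y -> orbit_dist x y < e.
Proof.
move=> lx e e0; have n := orbit_dist_near (@limit_trajs_orb (- r) _ lx) e0.
by apply: (@filterS _ (nbhs x) _ _ _ _ n) => y h ly; apply: h; exact: limit_trajs_orb.
Qed.

Lemma orbit_dist_iso t x y : Lam x -> Lam y -> x.1 = y.1 ->
  orbit_dist (tshift t x) (tshift t y) = orbit_dist x y.
Proof.
move=> lx ly xy.
apply: (@fiber_isometry R space Omega Lam tshift fst sigma orbit_dist limit_trajs_compact
  (@metric_hausdorff _ Omega)).
- by move=> [w z]; exact: cvg_fst.
- by move=> *; exact: limit_trajs_shift.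
- by move=> *; exact: (time_shiftD sigma_flow).
- by move=> *; exact: (time_shift0 sigma_flow).
- by [].
- exact: (flow_cluster_backward sigma_flow sigma_minimal).
- by move=> *; exact: orbit_dist_sym.
- exact: limit_dist_triangle.
- exact: limit_dist_near.
- move=> s u v s0 lu lv uv.
  exact: orbit_dist_future (@limit_trajs_orb 0 _ lu) (@limit_trajs_orb 0 _ lv) uv s0.
- exact: lx.
- exact: ly.
- exact: xy.
Qed.

Lemma emb_inj x y : Lam x -> Lam y -> hemb x = hemb y -> x = y.
Proof.
move=> lx ly [xy1 xy2].
have ox := @limit_trajs_orb 0 _ lx; have oy := @limit_trajs_orb 0 _ ly.
have [x1 _ _ xc] := orbit_now ox; have [y1 _ _ yc] := orbit_now oy.
have xy0 : state x 0 = state y 0 by rewrite -x1 -y1 xy2.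
have d0 : orbit_dist x y = 0 by rewrite /orbit_dist xy0 part_dist_refl.
have dt t : state x t = state y t.
  have := @orbit_dist_eq0 (tshift t x) (tshift t y) (@limit_trajs_orb 0 _ (@limit_trajs_shift t _ lx))
    (@limit_trajs_orb 0 _ (@limit_trajs_shift t _ ly)).
  by rewrite orbit_dist_iso// d0 /= !hist_at_shift !add0r; apply.
case: x y xy1 {xy2} lx ly ox oy x1 y1 xc yc xy0 d0 dt => w z [w' z'] /= -> lx ly ox oy x1 y1 xc yc xy0 d0 dt.
congr pair; apply/funext => t.
have := congr1 (fun f : hist r m => f 0) (dt t).
by rewrite !hist_atE ?addr0//; exact: hist0.
Qed.

Local Notation O := (hemb @` Lam).

Lemma emb_continuous_within : {within Lam, continuous hemb}.
Proof.
apply/subspace_continuousP => x lx.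
apply: (emb_cvg sigma_flow F_cont (M := M) (L := L) (psi1 := psi1) (B := B)).
- by apply: filterS (withinT _ _) => y; exact: limit_trajs_orb.
- exact: limit_trajs_orb.
- exact: cvg_within.
Qed.

Lemma emb_limit_compact : compact O.
Proof. by apply: continuous_compact; [exact: emb_continuous_within|exact: limit_trajs_compact]. Qed.

Definition emb_inv (q : Omega * lipHist r m) : space := xget x0 [set x | Lam x /\ hemb x = q].

Lemma emb_invP q : O q -> Lam (emb_inv q) /\ hemb (emb_inv q) = q.
Proof. by move=> [x lx xq]; apply: (@xgetPex _ x0 [set x | Lam x /\ hemb x = q]); exists x. Qed.

Lemma embK x : Lam x -> emb_inv (hemb x) = x.
Proof. by move=> lx; have [|l e] := @emb_invP (hemb x); [exists x|exact: emb_inj]. Qed.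

Let space_hausdorff : hausdorff_space (Omega * lipHist r m)%type.
Proof. by apply: hausdorff_pair; [exact: metric_hausdorff|exact: norm_hausdorff]. Qed.

Lemma emb_inv_cvg q : O q -> emb_inv @ within O (nbhs q) --> emb_inv q.
Proof.
move=> Oq V /nbhs_interior nV.
have [lq eq] := emb_invP Oq.
pose C := Lam `&` ~` interior V.
have cC : compact C by apply: compact_closedI; [exact: limit_trajs_compact|apply: open_closedC; exact: open_interior].
have cE : closed (hemb @` C).
  apply: (compact_closed space_hausdorff); apply: continuous_compact => //.
  by apply: continuous_subspaceW emb_continuous_within => x [].
have nq : nbhs q (~` (hemb @` C)).
  apply: open_nbhs_nbhs; split; first exact: closed_openC.
  move=> [x [lx nVx] xq]; apply: nVx.
  have -> : x = emb_inv q by rewrite -xq embK.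
  exact: nbhs_singleton nV.
apply: (@filterS _ (nbhs q) _ _ _ _ nq) => q' nq' Oq' /=.
have [lq' eq'] := emb_invP Oq'.
apply: contrapT => nVq'; apply: nq'; exists (emb_inv q') => //; split=> //.
by move=> /interior_subset.
Qed.

Definition limit_flow t (q : Omega * lipHist r m) : Omega * lipHist r m :=
  emb (tshift t (emb_inv q)).

Lemma limit_flow_extension : flow_extension sigma F O limit_flow.
Proof.
split.
- by move=> t q /emb_invP[lq _]; exists (tshift t (emb_inv q)) => //; exact: limit_trajs_shift.
- apply/subspace_continuousP => -[t q] [_ Oq].
  set G := within _ _.
  have GF : Filter G by exact: within_filter.
  have GO : G [set p | O p.2] by apply: filterS (@withinT _ _ _ _) => p [].
  have G2 : (fun p : R * (Omega * lipHist r m) => p.2) @ G --> within O (nbhs q).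
    move=> V nV.
    suff : nbhs (t, q) [set p | ([set: R] `*` O) p -> V p.2] by [].
    exists (setT, [set q' | O q' -> V q']); first by split; [exact: filterT|exact: nV].
    by move=> [t' q'] [/= _ h] [_ Oq']; exact: h.
  have G1 : (fun p : R * (Omega * lipHist r m) => p.1) @ G --> t.
    by apply: cvg_within_filter; exact: cvg_fst.
  have Ginv : (fun p : R * (Omega * lipHist r m) => emb_inv p.2) @ G --> emb_inv q.
    exact: cvg_comp G2 (emb_inv_cvg Oq).
  apply: (emb_cvg sigma_flow F_cont (M := M) (L := L) (psi1 := psi1) (B := B)).
  + apply: filterS GO => p /emb_invP[lp _]; exact: (@limit_trajs_orb (- r) _ (limit_trajs_shift lp)).
  + by have [lq _] := emb_invP Oq; exact: (@limit_trajs_orb (- r) _ (limit_trajs_shift lq)).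
  + apply: (@time_shift_cvg _ _ _ _ sigma_flow _ G GF _ _ _ _ L) => //.
    by apply: filterS GO => p /emb_invP[lp _]; have [] := @limit_trajs_orb 0 _ lp.
- by move=> q Oq; have [lq eq] := emb_invP Oq; rewrite /limit_flow (time_shift0 sigma_flow).
- move=> s t q Oq; have [lq eq] := emb_invP Oq.
  by rewrite /limit_flow embK ?(time_shiftD sigma_flow)//; exact: limit_trajs_shift.
- move=> t q t0 Oq; have [lq eq] := emb_invP Oq.
  by rewrite /limit_flow -(semiflow_orbit (@limit_trajs_orb 0 _ lq) t0) eq.
Qed.

Lemma limit_flow_distal : fiber_distal O limit_flow.
Proof.
move=> w p1 p2 O1 O2 p12.
have [l1 e1] := emb_invP O1; have [l2 e2] := emb_invP O2.
set x1 := emb_inv (w, p1) in l1 e1; set x2 := emb_inv (w, p2) in l2 e2.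
have x12 : x1.1 = x2.1 by move: e1 e2 => [-> _] [-> _].
have o1 t := @limit_trajs_orb 0 _ (@limit_trajs_shift t _ l1).
have o2 t := @limit_trajs_orb 0 _ (@limit_trajs_shift t _ l2).
have d0 : 0 < orbit_dist x1 x2.
  rewrite ltNge; apply/negP => /(orbit_dist_eq0 (@limit_trajs_orb 0 _ l1) (@limit_trajs_orb 0 _ l2)) h.
  apply: p12; have [q1 _ _ _] := orbit_now (@limit_trajs_orb 0 _ l1).
  have [q2 _ _ _] := orbit_now (@limit_trajs_orb 0 _ l2).
  move: e1 e2 => [_ <-] [_ <-]; apply/val_inj => /=.
  exact: etrans q1 (etrans h (esym q2)).
exists (orbit_dist x1 x2 / c); first by rewrite divr_gt0.
move=> t; rewrite ler_pdivrMr// mulrC -(orbit_dist_iso t l1 l2 x12).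
exact: orbit_dist_le (o1 t) (o2 t).
Qed.

Lemma limit_strongly_positive (psi0 : lipHist r m) (k : R) : intConeB B psi0 -> 0 < k ->
  psi1 = k *: (psi0 : hist r m) -> strongly_positive B O.
Proof.
move=> int0 k0 pk; split; first exact: emb_limit_compact.
move=> _ [x lx <-]; split=> //.
have ox := @limit_trajs_orb 0 _ lx; have [x1 _ x3 _] := orbit_now ox.
apply: (intConeB_ge int0 k0); first by rewrite -pk x1.
by move=> s; apply: (lip_at_derivable sigma_flow F_cont); exact: (@limit_trajs_orb (- r) _ lx).
Qed.

Let lip_hist_continuous : continuous (fun phi : lipHist r m => phi : hist r m).
Proof.
move=> phi V /nbhs_ballP[e /= e0 eV].
suff : nbhs phi [set psi : lipHist r m | V (psi : hist r m)] by [].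
apply/nbhs_ballP; exists e => //= psi; rewrite -ball_normE /= => h.
apply: eV; rewrite -ball_normE /=; apply: le_lt_trans h.
exact: (lip_norm_sup (phi - psi)).
Qed.

Let limit_states := [set (x.1, state x 0) | x in Lam] : set (Omega * hist r m).

Let limit_states_compact : compact limit_states.
Proof.
pose f (q : Omega * lipHist r m) : Omega * hist r m := (q.1, q.2 : hist r m).
have fc : continuous f.
  move=> [w phi]; apply: (cvg_to_pair (nbhs_filter (w, phi))); first exact: cvg_fst.
  by apply: (cvg_comp _ _ (@cvg_snd _ _ (nbhs w) (nbhs phi) _)); exact: lip_hist_continuous.
have -> : limit_states = f @` O.
  apply/seteqP; split=> [_ [x lx <-]|_ [_ [x lx <-] <-]].
    exists (hemb x); first by exists x.
    by have [x1 _ _ _] := orbit_now (@limit_trajs_orb 0 _ lx); rewrite /f /= x1.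
  exists x => //.
  by have [x1 _ _ _] := orbit_now (@limit_trajs_orb 0 _ lx); rewrite /f /= x1.
by apply: continuous_compact; [exact: continuous_subspaceT|exact: emb_limit_compact].
Qed.

Lemma limit_uniformly_stable : uniformly_stable sigma F B O.
Proof.
move=> e e0.
have e80 : 0 < e / 8 by rewrite divr_gt0.
have [d1 d10 d1P] := @compact_unif_continuous R _ _ (fun p : Omega * hist r m => F p.1 p.2)
  limit_states limit_states_compact F_cont _ e80.
pose eta := Num.min (d1 / 2) (e / 8).
have eta0 : 0 < eta by rewrite lt_min divr_gt0.
have eta1 : eta < d1.
  by rewrite gt_min ltr_pdivrMr// ltr_pMr// ltr1n.
have eta2 : eta <= e / 8 by rewrite ge_min lexx orbT.
have [a a0 aP] := @part_le_norm_small R r m B M eta eta0.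
pose d := Num.min (e / 8) (Num.min (a / (2 * c)) ((2 * c)^-1)).
have d0 : 0 < d by rewrite !lt_min e80 divr_gt0 ?invr_gt0 ?mulr_gt0.
exists d => // w phi psi [x lx [xw xphi]] ipsi.
rewrite -xw -xphi {w phi xw xphi} !lt_min => /andP[h1 /andP[h2 h3]] T T0.
have ox := @limit_trajs_orb 0 _ lx; have [x1 x2 x3 xc] := orbit_now ox.
have [xM xL xd _] := ox.
set phi : lipHist r m := lip_at x.2 in x1 h1 h2 h3 *.
set h := `|phi - psi| in h1 h2 h3.
have c20 : 0 < 2 * c by rewrite mulr_gt0.
rewrite ltr_pdivlMr// in h2; rewrite -[X in _ < X]mul1r ltr_pdivlMr// in h3.
pose p2 : hist r m := 2^-1 *: psi1.
have p2_cone : coneB B p2 by apply: coneBZ; rewrite ?invr_ge0.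
have p2_phi : leB B p2 phi.
  rewrite x1; apply: leB_trans x3; rewrite -[X in leB B _ X]scale1r.
  by apply: leBZr => //; rewrite invf_le1// ler1n.
have p2_psi : leB B p2 psi.
  rewrite /leB /p2 (@lmod_half_split R _ psi1 (phi : hist r m) (psi : hist r m) (c * h)).
  apply: coneBD; first apply: coneBD.
  - by rewrite /h distrC; exact: psi1_unit (psi - phi).
  - by rewrite x1; exact: x3.
  - by apply: coneBZ => //; rewrite subr_ge0; lra.
have psi_cone : coneB B psi := coneB_ge p2_cone p2_psi.
have p2_unit (zeta : lipHist r m) : coneB B ((2 * c * `|zeta|) *: p2 + zeta).
  rewrite /p2 scalerA (_ : 2 * c * _ * _ = c * `|zeta|); first exact: psi1_unit.
  by rewrite mulrAC -!mulrA mulrCA !mulrA mulfK// pnatr_eq0.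
have pl : @part_le R r m B a phi psi.
  apply: (@part_le_mono _ _ _ B (2 * c * h)) => //; first by rewrite x1.
    by rewrite mulrC ltW.
  exact: part_le_unit p2_cone (ltW c20) p2_unit p2_phi p2_psi.
have near_ t : 0 <= t -> `|state x t - sol_hist sigma F t x.1 psi| <= eta.
  move=> t0; rewrite x1 in pl.
  have := sol_part_le x.1 x2 psi_cone t0 pl; rewrite orbit_future//.
  apply: aP.
    have [_ + _ _] := orbit_now (@limit_trajs_orb 0 _ (@limit_trajs_shift t _ lx)).
    by rewrite /= hist_at_shift add0r.
  apply: hist_norm_le; first exact: le_trans (xM 0).
  by move=> s sr; rewrite hist_atE.
have stM t : `|state x t| <= M.
  by apply: hist_norm_le => [|s sr]; [exact: le_trans (xM 0)|rewrite hist_atE].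
have [L' [z [[_ zL zd _] [zw zpsi]]]] : exists L' z, orbits sigma F B (M + eta) L' 0 0 z /\ emb z = (x.1, psi).
  apply: (orbit_exists r_gt0 sigma_flow B_quasipos F_cont F_C1 F_bdd F_mono F_sublin psi_cone).
    move=> t t0; have := near_ t t0; have := stM t.
    by have := ler_distD (state x t) (sol_hist sigma F t x.1 psi) 0; rewrite !subr0 distrC; lra.
  move=> t t0; apply/leB0.
  exact: (sol_hist_cone r_gt0 sigma_flow B_quasipos F_cont F_C1 F_bdd F_mono F_sublin).
have zc := lip_traj_continuous zL.
have x_past s : delay_itv r s -> phi s = x.2 s.
  by move=> sr; rewrite -[LHS]/((phi : hist r m) s) x1 hist_atE// add0r.
have z_past s : delay_itv r s -> psi s = z.2 s.
  by move=> sr; rewrite -zpsi -[LHS]/((lip_at z.2 : hist r m) s) (lip_atE zL) hist_atE// add0r.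
have z_future t : 0 <= t -> sol_hist sigma F t x.1 psi = state z t.
  move=> t0; rewrite -zw; apply: (sol_hist_eq r_gt0 sigma_flow F_cont F_C1 (y := z.2)) => //.
  by move=> s sr; rewrite z_past.
have rhs_close t : 0 <= t -> `|rhs sigma F x t - rhs sigma F z t| <= e / 8.
  move=> t0; have := d1P (sigma t x.1, state x t) (sigma t x.1, state z t).
  have Cx : limit_states (sigma t x.1, state x t).
    exists (tshift t x); first exact: limit_trajs_shift.
    by rewrite /= hist_at_shift add0r.
  move=> /(_ Cx); rewrite /rhs zw.
  have b : ball (sigma t x.1, state x t) d1 (sigma t x.1, state z t).
    split; first exact: ballxx.
    rewrite -z_future//= -ball_normE /=; exact: le_lt_trans (near_ t t0) eta1.
  by move=> /(_ b); rewrite -ball_normE /= => /ltW.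
pose y := (x.2 : R -> 'cV[R]_m) \- z.2.
have yc : continuous y by move=> u; apply: cvgB; [exact: xc|exact: zc].
have y_slope s t : - r <= s -> - r <= t -> s <= t -> `|y t - y s| <= e / 8 * (t - s).
  move=> rs rt; apply: (@segment_glue _ _ y (e / 8) 0 [set u | - r <= u]) => //=.
  - move=> {rs rt}s {}t rs rt st t0.
    have sr : delay_itv r s by apply/delay_itvE; split=> //; exact: le_trans t0.
    have tr : delay_itv r t by apply/delay_itvE.
    have := lip_norm_slope (phi - psi) sr tr.
    rewrite [in X in X <= _](_ : (phi - psi) t - (phi - psi) s = y t - y s); last first.
      rewrite -[(phi - psi) t]/(phi t - psi t) -[(phi - psi) s]/(phi s - psi s).
      by rewrite !x_past// !z_past.
    move/le_trans; apply; rewrite ger0_norm ?subr_ge0// ler_wpM2r ?subr_ge0//.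
    exact: ltW.
  - move=> {rs rt}s {}t _ _ s0 st.
    have := @rderiv_mean_le _ _ _ y (fun u => rhs sigma F x u - rhs sigma F z u) s t (e / 8) 0 st (ltW e80) yc.
    rewrite scaler0 subr0; apply=> u su ut; have u0 := le_trans s0 su.
    by split; [apply: rderivB; [exact: xd|exact: zd]|rewrite subr0; exact: rhs_close].
have xT : sol_lip sigma F T x.1 phi = lip_at (tshift T x).2.
  exact: (congr1 (fun q : Omega * lipHist r m => q.2) (semiflow_orbit ox T0)).
have zT : sol_lip sigma F T x.1 psi = lip_at (tshift T z).2.
  by have := congr1 (fun q : Omega * lipHist r m => q.2) (semiflow_emb r_gt0 sigma_flow F_cont F_C1 zL zd T0); rewrite /= zw zpsi.
rewrite xT zT.
have yT s : delay_itv r s -> (lip_at (tshift T x).2 - lip_at (tshift T z).2 : lipHist r m) s = y (s + T).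
  move=> sr; set f : lipHist r m := lip_at _; set g : lipHist r m := lip_at _.
  rewrite -[LHS]/((f : hist r m) s - (g : hist r m) s) /f /g.
  have xLT := @lip_traj_shift _ _ _ sigma L T x xL; have zLT := @lip_traj_shift _ _ _ sigma L' T z zL.
  rewrite (lip_atE xLT) (lip_atE zLT) (hist_atE 0 (lip_traj_continuous xLT) sr).
  by rewrite (hist_atE 0 (lip_traj_continuous zLT) sr) add0r.
apply: le_lt_trans (lip_norm_le (k := e / 8) (l := e / 8) (ltW e80) (ltW e80) _ _) _; last by lra.
- move=> s sr; rewrite yT//.
  have := hist_norm_ge (state x T - state z T) sr.
  have := near_ T T0; rewrite z_future// => n1 n2; apply: le_trans eta2.
  apply: le_trans n1; apply: le_trans n2.
  rewrite -[(state x T - state z T) s]/(state x T s - state z T s) !hist_atE//.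
  by rewrite addrC.
- move=> s t sr tr st; rewrite !yT//.
  have -> : t - s = (t + T) - (s + T) by rewrite opprD addrACA subrr addr0.
  move/delay_itvE : sr => [rs _]; move/delay_itvE : tr => [rt _].
  by apply: y_slope; rewrite ?lerD2r//; [apply: le_trans rs _|apply: le_trans rt _]; rewrite lerDl.
Qed.

Let orbit_dist_cvg (I : Type) (U : set_system I) (UF : ProperFilter U) (f : I -> space) x e :
  orb (- r) x -> U [set i | orb (- r) (f i)] -> f @ U --> x -> 0 < e ->
  U [set i | orbit_dist x (f i) < e].
Proof.
move=> ox Uo fx e0; have n := fx _ (orbit_dist_near ox e0).
by apply: (@filterS _ U _ _ _ _ (@filterI _ U _ _ _ n Uo)) => i [h oi]; exact: h.
Qed.

Let orbit0_eventually (U : set_system R) (UF : Filter U) (T : R) : +oo `<=` U -> U [set t | T <= t].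
Proof. by move=> Uoo; apply: Uoo; apply: nbhs_pinfty_ge; exact: num_real. Qed.

Let fst_cvg (I : Type) (U : set_system I) (UF : Filter U) (f : I -> space) x :
  f @ U --> x -> (fun i => (f i).1) @ U --> x.1.
Proof. by move=> fx; apply: (cvg_comp _ _ fx); case: x {fx} => w z; exact: cvg_fst. Qed.

Let add_quarters (a b p q e : R) : 0 < e -> a < e / 4 -> p < e / 4 -> q < e / 4 -> b <= p + q ->
  a + b < e.
Proof. by lra. Qed.

Lemma limit_approximation (N : set space) x e : N !=set0 -> N `<=` Lam -> compact N ->
  (forall t x, N x -> N (tshift t x)) -> Lam x -> 0 < e ->
  exists2 x', N x' & x'.1 = x.1 /\ orbit_dist x x' < e.
Proof.
move=> [b Nb] NL cN N_shift lx e0.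
have e40 : 0 < e / 4 by rewrite divr_gt0.
have e80 : 0 < e / 8 by rewrite divr_gt0.
have [U [UU Uoo Ub]] := limit_trajs_ultra (NL _ Nb).
have UP := @ultra_proper _ _ UU; have UF := @filter_filter _ _ UP.
have ev (W : set_system R) (WF : Filter W) : +oo `<=` W -> W [set t | orb (- r) (tshift t x0)].
  move=> Woo; apply: (@filterS _ W WF _ _ _ (orbit0_eventually WF r Woo)) => t rt.
  by apply: orbit0_orb; rewrite opprK.
have [y [Ny yx0 Uy]] := @fiber_approximation R space Omega Lam tshift fst sigma orbit_dist
  limit_trajs_compact (@metric_hausdorff _ Omega)
  (fun x => fst_cvg (nbhs_filter x) cvg_id) limit_trajs_shift (fun _ _ => erefl)
  (flow_cluster_forward sigma_flow sigma_minimal) (fun _ _ _ _ => orbit_dist_sym _ _)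
  limit_dist_triangle limit_dist_near N x0.1 U UU b (e / 8) orbit_dist_iso NL cN N_shift Nb
  (fst_cvg UF Ub) e80.
have U1 := orbit_dist_cvg UP (@limit_trajs_orb (- r) _ (NL _ Nb)) (ev _ UF Uoo) Ub e80.
have [t1 [[/= d1 d2] t10]] := @filter_ex _ U UP _ (@filterI _ U UF _ _ (@filterI _ U UF _ _ U1 Uy)
  (orbit0_eventually UF 0 Uoo)).
have o1 : orb 0 (tshift t1 x0) by apply: orbit0_orb; rewrite oppr0.
have oy t : orb 0 (tshift t y) := @limit_trajs_orb 0 _ (limit_trajs_shift (NL _ Ny)).
have ob : orb 0 b := @limit_trajs_orb 0 _ (NL _ Nb).
have d12 : orbit_dist (tshift t1 x0) (tshift t1 y) < e / 4.
  apply: le_lt_trans (orbit_dist_triangle o1 ob (oy t1)) _.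
  by rewrite orbit_dist_sym; move: d1 d2; move: (orbit_dist b _) (orbit_dist b _) => u v; lra.
have d12t t : t1 <= t -> orbit_dist (tshift t x0) (tshift t y) < e / 4.
  move=> tt1; apply: le_lt_trans d12.
  rewrite -[t](subrK t1) !(time_shiftD sigma_flow (t - t1)).
  by apply: (orbit_dist_future o1 (oy t1)); rewrite ?subr_ge0//= yx0.
have [V [VU Voo Vx]] := limit_trajs_ultra lx.
have VP := @ultra_proper _ _ VU; have VF := @filter_filter _ _ VP.
have [x' Nx' Vx'] := compact_ultra_cvg VU cN (fun t => N_shift t y Ny).
have V1 := orbit_dist_cvg VP (@limit_trajs_orb (- r) _ lx) (ev _ VF Voo) Vx e40.
have V2 : V [set t | orbit_dist x' (tshift t y) < e / 4].
  apply: (orbit_dist_cvg VP _ _ Vx' e40); first exact: (@limit_trajs_orb (- r) _ (NL _ Nx')).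
  by apply: (@filterE _ V VF) => t; exact: (@limit_trajs_orb (- r) _ (limit_trajs_shift (NL _ Ny))).
exists x' => //; split.
  apply: (@cvg_unique _ (@metric_hausdorff _ Omega) (sigma t x0.1 @[t --> V]) _ _ _).
    by have := fst_cvg VF Vx'; rewrite /= yx0.
  by have := fst_cvg VF Vx.
have [t [[/= k1 k2] [k3 k4]]] := @filter_ex _ V VP _ (@filterI _ V VF _ _ (@filterI _ V VF _ _ V1 V2)
  (@filterI _ V VF _ _ (orbit0_eventually VF t1 Voo) (orbit0_eventually VF 0 Voo))).
have ox := @limit_trajs_orb 0 _ lx; have ox' := @limit_trajs_orb 0 _ (NL _ Nx').
have ot : orb 0 (tshift t x0) by apply: orbit0_orb; rewrite oppr0.
apply: le_lt_trans (orbit_dist_triangle ox ot ox') _.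
have tri := orbit_dist_triangle ot (oy t) ox'; rewrite (orbit_dist_sym (tshift t y) x') in tri.
exact: add_quarters e0 k1 (d12t t k3) k2 tri.
Qed.

Lemma limit_minimal : minimal_set nonneg_times (semiflow sigma F) O.
Proof.
have [z lz] := limit_trajs_neq0.
split; [by exists (hemb z), z|exact: emb_limit_compact| |].
  move=> t t0; apply/seteqP; split=> [_ [_ [x lx <-] <-]|_ [x lx <-]].
    exists (tshift t x); first exact: limit_trajs_shift.
    by rewrite (semiflow_orbit (@limit_trajs_orb 0 _ lx) t0).
  exists (hemb (tshift (- t) x)); first by exists (tshift (- t) x) => //; exact: limit_trajs_shift.
  rewrite (semiflow_orbit (@limit_trajs_orb 0 _ (limit_trajs_shift lx)) t0).
  by rewrite -(time_shiftD sigma_flow) subrr (time_shift0 sigma_flow).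
move=> N [q0 Nq0] cN N_inv NO; apply/seteqP; split=> // _ [x lx <-].
pose N' := emb_inv @` N.
have N'P y : N' y <-> Lam y /\ N (hemb y).
  split=> [[q Nq <-]|[ly Ny]]; last by exists (hemb y) => //; exact: embK.
  by have [lq eq] := emb_invP (NO _ Nq); rewrite eq.
have N'L : N' `<=` Lam by move=> y /N'P[].
have cN' : compact N'.
  apply: continuous_compact => //; apply/subspace_continuousP => q Nq V nV.
  have n : nbhs q [set q' | O q' -> V (emb_inv q')] := emb_inv_cvg (NO _ Nq) nV.
  suff : nbhs q [set q' | N q' -> V (emb_inv q')] by [].
  by apply: filterS n => q' h Nq'; apply: h; exact: NO.
have N'_shift t y : N' y -> N' (tshift t y).
  move=> /N'P[ly Ny]; apply/N'P; split; first exact: limit_trajs_shift.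
  have [t0|/ltW t0] := leP 0 t.
    rewrite -(semiflow_orbit (@limit_trajs_orb 0 _ ly) t0) -(N_inv t t0).
    by exists (hemb y).
  have Nt0 : 0 <= - t by rewrite oppr_ge0.
  have : N (hemb y) := Ny; rewrite -{1}(N_inv _ Nt0) => -[q Nq].
  have [ly1 ey1] := emb_invP (NO _ Nq).
  move=> e1; rewrite -ey1 (semiflow_orbit (@limit_trajs_orb 0 _ ly1) Nt0) in e1.
  have <- := emb_inj (limit_trajs_shift ly1) ly e1.
  by rewrite -(time_shiftD sigma_flow) subrr (time_shift0 sigma_flow) ey1.
have N'0 : N' !=set0 by exists (emb_inv q0), q0.
have approx n : exists y, N' y /\ (y.1 = x.1 /\ orbit_dist x y < n.+1%:R^-1).
  have n0 : 0 < n.+1%:R^-1 :> R by rewrite invr_gt0.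
  by have [y Ny h] := limit_approximation N'0 N'L cN' N'_shift lx n0; exists y.
have [f fP] := choice approx.
have [U [UU Uoo]] := ultraFilterLemma (@eventually_filter).
have UP := @ultra_proper _ _ UU; have UF := @filter_filter _ _ UP.
have [y Ny Uy] := compact_ultra_cvg UU cN' (fun n => (fP n).1).
have y1 : y.1 = x.1.
  have fx : (fun n => (f n).1) = (fun=> x.1) by apply/funext => n; exact: (fP n).2.1.
  have Ux : (fun=> x.1) @ U --> y.1 by rewrite -fx; have := fst_cvg UF Uy.
  exact: (@cvg_unique _ (@metric_hausdorff _ Omega) ((fun=> x.1) @ U) _ _ _ Ux (cvg_cst _)).
have ox := @limit_trajs_orb 0 _ lx; have oy := @limit_trajs_orb 0 _ (N'L _ Ny).
have d0 : orbit_dist x y <= 0.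
  apply/ler_addgt0Pr => e e0; rewrite add0r.
  have e20 : 0 < e / 2 by rewrite divr_gt0.
  have V1 := orbit_dist_cvg UP (@limit_trajs_orb (- r) _ (N'L _ Ny))
    (@filterE _ U UF _ (fun n => @limit_trajs_orb (- r) _ (N'L _ (fP n).1))) Uy e20.
  have V2 : U [set n | n.+1%:R^-1 < e / 2] := Uoo _ (near_infty_natSinv_lt (PosNum e20)).
  have [n [/= k1 k2]] := @filter_ex _ U UP _ (@filterI _ U UF _ _ V1 V2).
  apply: le_trans (orbit_dist_triangle ox (@limit_trajs_orb 0 _ (N'L _ (fP n).1)) oy) _.
  rewrite (orbit_dist_sym (f n) y) [e]splitr.
  exact: lerD (ltW (lt_trans (fP n).2.2 k2)) (ltW k1).
have [_ Ney] := (N'P y).1 Ny; suff -> : hemb x = hemb y by [].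
have h := orbit_dist_eq0 ox oy d0.
have [x1 _ _ _] := orbit_now ox; have [y2 _ _ _] := orbit_now oy.
rewrite /emb y1; congr pair; apply/val_inj => /=.
exact: etrans x1 (etrans h (esym y2)).
Qed.

End limit_set.

Lemma intConeB_cone (R : realType) (r : R) (m : nat) (B : 'M[R]_m) (psi : lipHist r m) (c : R) :
  0 < c -> (forall eta : lipHist r m, coneB B ((c * `|eta|) *: (psi : hist r m) + eta)) ->
  coneB B psi.
Proof.
move=> c0 /(_ psi) h.
have k0 : 0 < c * `|psi| + 1 by rewrite ltr_wpDl// mulr_ge0// ltW.
have -> : (psi : hist r m) = (c * `|psi| + 1)^-1 *: ((c * `|psi|) *: (psi : hist r m) + psi).
  have <- : (c * `|psi| + 1) *: (psi : hist r m) = (c * `|psi|) *: (psi : hist r m) + psi.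
    by rewrite scalerDl scale1r.
  by rewrite scalerA mulVf ?scale1r ?gt_eqF.
by apply: coneBZ => //; rewrite invr_ge0 ltW.
Qed.

Section conclusion.
Context {R : realType} {r : R} {m : nat} {Omega : metricType R}.
Context {sigma : R -> Omega -> Omega} {B : 'M[R]_m}
  {F : Omega -> hist r m -> 'cV[R]_m}.
Context (r_gt0 : 0 < r) (sigma_flow : is_flow sigma)
  (sigma_minimal : minimal_set [set: R] sigma [set: Omega])
  (B_quasipos : quasipositive B)
  (F_cont : continuous (fun p : Omega * hist r m => F p.1 p.2))
  (F_C1 : C1_snd F)
  (F_bdd : forall X1 : set (hist r m), bounded_set X1 ->
     bounded_set [set F p.1 p.2 | p in [set: Omega] `*` X1])
  (F_mono : forall (w : Omega) (phi psi : hist r m), leB B phi psi ->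
     vle (B *m (psi 0 - phi 0)) (F w psi - F w phi))
  (F_sublin : forall (w : Omega) (psi : hist r m) (l : R),
     leB B 0 psi -> 0 <= l -> l <= 1 ->
     vle (l *: F w psi) (F w (l *: psi))).

Lemma omega_limit_structure (M k : R) (psi0 : lipHist r m) w (phi : lipHist r m) :
  intConeB B psi0 -> 0 < k -> coneB B phi ->
  (forall t, 0 <= t -> `|sol_hist sigma F t w phi| <= M) ->
  (forall t, 0 <= t -> leB B (k *: (psi0 : hist r m)) (sol_hist sigma F t w phi)) ->
  let O := omega_limit sigma F w phi in
  [/\ uniformly_stable sigma F B O, strongly_positive B O,
      minimal_set nonneg_times (semiflow sigma F) O &
      exists theta, flow_extension sigma F O theta /\ fiber_distal O theta].
Proof.
move=> int0 k0 cphi hM hp O.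
have [c0 c00 c0P] := intConeB_order_unit B_quasipos r_gt0 int0.
have cone0 := intConeB_cone c00 c0P.
pose c := c0 / k; pose psi1 : hist r m := k *: (psi0 : hist r m).
have c_gt0 : 0 < c by rewrite divr_gt0.
have psi1_cone : coneB B psi1 by apply: coneBZ => //; exact: ltW.
have psi1_unit (eta : lipHist r m) : coneB B ((c * `|eta|) *: psi1 + eta).
  rewrite /psi1 scalerA (_ : c * _ * k = c0 * `|eta|)//.
  by rewrite mulrAC /c mulfVK// gt_eqF.
have [L [x0 [ox0 ex0]]] := orbit_exists r_gt0 sigma_flow B_quasipos F_cont F_C1 F_bdd F_mono F_sublin cphi hM hp.
rewrite /O (omega_limit_emb r_gt0 sigma_flow sigma_minimal F_cont F_C1 ox0 ex0).
split.
- exact: (limit_uniformly_stable r_gt0 sigma_flow sigma_minimal B_quasipos F_cont F_C1 F_bdd F_mono F_sublin psi1_cone c_gt0 psi1_unit ox0).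
- exact: (limit_strongly_positive sigma_flow sigma_minimal F_cont psi1_cone ox0 int0 k0 erefl).
- exact: (limit_minimal r_gt0 sigma_flow sigma_minimal B_quasipos F_cont F_C1 F_bdd F_mono F_sublin psi1_cone c_gt0 psi1_unit ox0).
exists (limit_flow (sigma := sigma) (x0 := x0)); split.
  exact: (limit_flow_extension r_gt0 sigma_flow sigma_minimal B_quasipos F_cont F_C1 F_bdd F_mono F_sublin psi1_cone c_gt0 psi1_unit ox0).
exact: (limit_flow_distal r_gt0 sigma_flow sigma_minimal B_quasipos F_cont F_C1 F_bdd F_mono F_sublin psi1_cone c_gt0 psi1_unit ox0).
Qed.

(* The base flow is minimal, so the omega-limit set of the given orbit meets
   every fiber. *)
Lemma bounded_solution_over (M : R) (psi0 : lipHist r m) w0 (phi0 : lipHist r m) w :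
  coneB B phi0 ->
  (forall t, 0 <= t -> `|sol_hist sigma F t w0 phi0| <= M) ->
  (forall t, 0 <= t -> leB B psi0 (sol_hist sigma F t w0 phi0)) ->
  exists phi : lipHist r m, leB B psi0 phi /\ forall t, 0 <= t ->
    `|sol_hist sigma F t w phi| <= M /\ leB B psi0 (sol_hist sigma F t w phi).
Proof.
move=> cphi0 hM hp.
have [L [x0 [ox0 [x01 _]]]] := orbit_exists r_gt0 sigma_flow B_quasipos F_cont F_C1 F_bdd F_mono F_sublin cphi0 hM hp.
have [U [UU Uoo Uw]] := cluster_ultra _ (@flow_cluster_forward _ _ _ sigma_flow sigma_minimal w0 w).
have UP := @ultra_proper _ _ UU.
have [x lx xU] := orbit0_cluster sigma_flow sigma_minimal F_cont ox0 UP Uoo.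
have [V [VU UV Vx]] := cluster_ultra UP xU.
have VP := @ultra_proper _ _ VU.
have xw : x.1 = w.
  have V1 : (fun t => (time_shift sigma t x0).1) @ V --> x.1.
    by apply: (cvg_comp _ _ Vx); case: (x) => w' y; exact: cvg_fst.
  have V2 : (fun t => (time_shift sigma t x0).1) @ V --> w.
    by rewrite /= x01; move=> W /Uw; exact: UV.
  exact: (@cvg_unique _ (@metric_hausdorff _ Omega) (_ @ V) _ _ _ V1 V2).
have ox := limit_trajs_orb sigma_flow F_cont ox0 0 lx.
have [xM xL _ xp] := ox; have yc := lip_traj_continuous xL.
exists (lip_at x.2); rewrite (lip_atE xL); split; first exact: xp.
move=> t t0; rewrite -xw (orbit_future r_gt0 sigma_flow F_cont F_C1 ox t0); split; last exact: xp.
by apply: hist_norm_le => [|s sr]; [exact: le_trans (xM 0)|rewrite hist_atE].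
Qed.

End conclusion.

Theorem proposition3p3 (R : realType) (r : R) (m : nat) (Omega : metricType R)
  (sigma : R -> Omega -> Omega) (B : 'M[R]_m)
  (F : Omega -> hist r m -> 'cV[R]_m)
  (r_gt0 : 0 < r) (m_gt0 : (0 < m)%N)
  (sigma_flow : is_flow sigma)
  (sigma_minimal : minimal_set [set: R] sigma [set: Omega])
  (B_quasipos : quasipositive B)
  (F_cont : continuous (fun p : Omega * hist r m => F p.1 p.2))
  (F_C1 : C1_snd F)
  (F_bdd : forall X1 : set (hist r m), bounded_set X1 ->
     bounded_set [set F p.1 p.2 | p in [set: Omega] `*` X1])
  (F_mono : forall (w : Omega) (phi psi : hist r m), leB B phi psi ->
     vle (B *m (psi 0 - phi 0)) (F w psi - F w phi))
  (F_sublin : forall (w : Omega) (psi : hist r m) (l : R),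
     leB B 0 psi -> 0 <= l -> l <= 1 ->
     vle (l *: F w psi) (F w (l *: psi)))
  (F_bounded_orbit : exists (w0 : Omega) (phi0 : lipHist r m),
     [/\ intConeB B phi0,
         bounded_set [set sol_hist sigma F t w0 phi0 | t in nonneg_times] &
         exists2 psi0 : lipHist r m, intConeB B psi0 &
           forall t : R, 0 <= t -> leB B psi0 (sol_hist sigma F t w0 phi0)]) :
  forall (w : Omega) (phi : lipHist r m), intConeB B phi ->
    let O := omega_limit sigma F w phi in
    [/\ uniformly_stable sigma F B O,
        strongly_positive B O,
        minimal_set nonneg_times (semiflow sigma F) O &
        exists theta : R -> Omega * lipHist r m -> Omega * lipHist r m,
          flow_extension sigma F O theta /\ fiber_distal O theta].
Proof.
move=> w phi iphi.
have [w0 [phi0 [iphi0 bphi0 [psi0 ipsi0 hpsi0]]]] := F_bounded_orbit.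
have [M0 M00 M0P] := pinfty_ex_gt0 bphi0.
have hM t : 0 <= t -> `|sol_hist sigma F t w0 phi0| <= M0 by move=> t0; apply: M0P; exists t.
have [c1 c10 c1P] := intConeB_order_unit B_quasipos r_gt0 iphi0.
have [a a0 aP] := intConeB_order_unit B_quasipos r_gt0 iphi.
have [b b0 bP] := intConeB_order_unit B_quasipos r_gt0 ipsi0.
have cphi := intConeB_cone a0 aP.
have cpsi0 := intConeB_cone b0 bP.
have [chi [psi0_chi chiP]] := bounded_solution_over r_gt0 sigma_flow sigma_minimal B_quasipos
  F_cont F_C1 F_bdd F_mono F_sublin w (intConeB_cone c10 c1P) hM hpsi0.
have cchi := coneB_ge cpsi0 psi0_chi.
pose p := a * `|chi|; pose q := b * `|phi|; pose l := (1 + p + q)^-1.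
have p0 : 0 <= p by rewrite mulr_ge0// ltW.
have q0 : 0 <= q by rewrite mulr_ge0// ltW.
have d0 : 0 < 1 + p + q by lra.
have l0 : 0 < l by rewrite invr_gt0.
have l1 : l <= 1 by rewrite invf_le1//; lra.
have scaled (k : R) (f g : hist r m) : 0 <= k -> k <= 1 + p + q -> coneB B g ->
    leB B f (k *: g) -> leB B (l *: f) g.
  move=> k0 kd cg /(leBZ (ltW l0)) /leB_trans; apply.
  rewrite scalerA -[X in leB B _ X]scale1r; apply: leBZr => //.
  by rewrite mulrC ler_pdivrMr// mul1r.
have chi_phi : leB B (l *: (chi : hist r m)) phi.
  apply: (scaled p) => //; first by lra.
  by have := aP (- chi); rewrite normrN.
have phi_chi : leB B (l *: (phi : hist r m)) chi.
  apply: (scaled q) => //; first by lra.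
  apply: (@leB_trans _ _ _ B _ (q *: (psi0 : hist r m))); last exact: leBZ.
  by have := bP (- phi); rewrite normrN.
have cmp := sol_hist_compare r_gt0 sigma_flow B_quasipos F_cont F_C1 F_bdd F_mono F_sublin.
apply: (omega_limit_structure (M := l^-1 * M0) (k := l) r_gt0 sigma_flow sigma_minimal B_quasipos
  F_cont F_C1 F_bdd F_mono F_sublin ipsi0 l0 cphi) => t t0.
  have h := leB_norm (coneBZ (ltW l0) (sol_hist_cone r_gt0 sigma_flow B_quasipos F_cont F_C1
    F_bdd F_mono F_sublin w cphi t0)) (cmp w _ _ l t cphi cchi (ltW l0) l1 phi_chi t0).
  rewrite normrZ (ger0_norm (ltW l0)) in h.
  rewrite mulrC ler_pdivlMr// mulrC; apply: le_trans h _.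
  exact: (chiP t t0).1.
apply: leB_trans (cmp w _ _ l t cchi cphi (ltW l0) l1 chi_phi t0).
by apply: leBZ; [exact: ltW|exact: (chiP t t0).2].
Qed.
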